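(* Let $(\Gamma,E)$ be a generalised Cartan lattice. Then there are canonical poset isomorphisms $$\mathrm{Sub}(\Gamma,E)\xrightarrow{\ \sim\ }\mathrm{Exc}(\Gamma,E)\xrightarrow{\ \sim\ }\mathrm{NC}(\Gamma,E).$$ The first sends the class of a monomorphism $\phi\colon(\Gamma',E')\to(\Gamma,E)$ to $[\phi E']$, and the second sends $[F]$ to $s_F$.
   Context: A bilinear lattice is an abelian group $\Gamma$ with a non-degenerate bilinear form $\langle-,-\rangle\colon\Gamma\times\Gamma\to\mathbb Z$ (i.e. $\langle x,-\rangle=0$ implies $x=0$, and $\langle-,y\rangle=0$ implies $y=0$); its symmetrised form is $(x,y)=\langle x,y\rangle+\langle y,x\rangle$. A root (pseudo-real root) is $a\in\Gamma$ with $\langle a,a\rangle>0$ and $\frac{\langle a,x\rangle}{\langle a,a\rangle},\frac{\langle x,a\rangle}{\langle a,a\rangle}\in\mathbb Z$ for all $x\in\Gamma$; it defines the reflection $s_a(x)=x-2\frac{(x,a)}{(a,a)}a$. An exceptional sequence of length $r$ is a sequence of roots $E=(e_1,\dots,e_r)$ with $\langle e_i,e_j\rangle=0$ for $i>j$ (the empty sequence is allowed); it is complete if the subgroup $\mathbb ZE$ generated by the $e_i$ is $\Gamma$, and orthogonal if $\langle e_i,e_j\rangle\le0$ for all $i\ne j$. Write $s_E=s_{e_1}\cdots s_{e_r}$. A generalised Cartan lattice $(\Gamma,E)$ is a bilinear lattice $\Gamma$ with a complete orthogonal exceptional sequence $E=(e_1,\dots,e_n)$. Its Weyl group $W(\Gamma,E)$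 is the subgroup generated by $s_{e_1},\dots,s_{e_n}$ in the group of automorphisms of $\Gamma$ preserving the symmetrised form. Its real roots are $\Phi(\Gamma,E)=\{w(e_i)\mid w\in W(\Gamma,E),1\le i\le n\}$ and its reflections are the $s_a$, $a\in\Phi(\Gamma,E)$. Its Coxeter element is $\mathrm{cox}(\Gamma)=s_E$. The absolute length $\ell(w)$ of $w\in W(\Gamma,E)$ is the minimal number of reflections whose product is $w$; $u\le v$ iff $\ell(u)+\ell(u^{-1}v)=\ell(v)$; and $\mathrm{NC}(\Gamma,E)=\{w\in W(\Gamma,E)\mid\mathrm{id}\le w\le\mathrm{cox}(\Gamma)\}$ with this order. A real exceptional sequence in $(\Gamma,E)$ is a subsequence of a complete exceptional sequence $(f_1,\dots,f_n)$ in $\Gamma$ with every $f_i\in\Phi(\Gamma,E)$. A morphism $\phi\colon(\Gamma',E')\to(\Gamma,E)$ of generalised Cartan lattices is a group homomorphism $\Gamma'\to\Gamma$ preserving the bilinear forms such that $\phi E'$ is a real exceptional sequence in $(\Gamma,E)$. All morphisms are monomorphisms. $\mathrm{Sub}(\Gamma,E)$ is the poset of subobjects in this category: equivalence classes of monomorphisms ending in $(\Gamma,E)$, where $\phi,\phi'$ are equivalent if each factors through the other, and $[\phi]\le[\phi']$ iff $\phi$ factors through $\phi'$. The group $\{\pm1\}\wr B_r=\{\pm1\}^r\rtimes B_r$ ($B_r$ the braid group on $r$ strands with standard generators $\sigma_i$) acts on real exceptional sequences of length $r$ by $\sigma_i(f_1,\dots,f_r)=(f_1,\dots,f_{i-1},f_{i+1},s_{f_{i+1}}(f_i),f_{i+2},\dots,f_r)$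 and $\varepsilon(f_1,\dots,f_r)=(\varepsilon_1f_1,\dots,\varepsilon_rf_r)$. $\mathrm{Exc}(\Gamma,E)$ is the set of orbits $[F]$ of real exceptional sequences $F$ (of all lengths) under these actions, with partial order $[G]\le[F]$ iff $G$ is an initial subsequence of $\sigma F$ for some $\sigma\in\{\pm1\}\wr B_r$, $r$ the length of $F$. *)

(* Defs.v *)
From mathcomp Require Import all_boot all_order all_algebra.
From mathcomp Require Import boolp classical_sets.
From Corelib Require Relations.Relation_Definitions.

Set Implicit Arguments.
Unset Strict Implicit.
Unset Printing Implicit Defensive.

Import Order.TTheory GRing.Theory Num.Theory.
Local Open Scope classical_set_scope.
Local Open Scope ring_scope.

(** * Bilinear lattices, roots, exceptional sequences *)

Record bilLattice := BilLattice {
  bl_zmod :> zmodType;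
  bform : bl_zmod -> bl_zmod -> int;
  bformDl : forall x y z, bform (x + y) z = bform x z + bform y z;
  bformDr : forall x y z, bform x (y + z) = bform x y + bform x z;
  bform_nondegl : forall x, (forall y, bform x y = 0) -> x = 0;
  bform_nondegr : forall y, (forall x, bform x y = 0) -> y = 0
}.

Section BilinearLattice.
Variable L : bilLattice.
Implicit Types (a b x y : L) (E F G : seq L) (i : nat).

Definition symform x y : int := bform x y + bform y x.

Definition is_root a : Prop :=
  0 < bform a a /\
  forall x, (bform a a %| bform a x)%Z /\ (bform a a %| bform x a)%Z.

(* The coefficient 2 (x, a) / (a, a) is an integer when a is a root, and the
   integer division is then exact. *)
Definition srefl a x : L := x - a *~ ((2 * symform x a) %/ symform a a)%Z.

(* s_E = s_{e_1} \o ... \o s_{e_r}, the last reflection being applied first. *)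
Definition srefl_seq E : L -> L := foldr (fun a w => srefl a \o w) id E.

Definition exceptional E : Prop :=
  (forall a, a \in E -> is_root a) /\
  forall i j, (j < i)%N -> (i < size E)%N -> bform E`_i E`_j = 0.

Definition complete E : Prop := forall x, inIntSpan (in_tuple E) x.

Definition orthogonal_seq E : Prop :=
  forall i j, (i < size E)%N -> (j < size E)%N -> i <> j ->
    bform E`_i E`_j <= 0.

(* Elements of the group of automorphisms of L preserving the symmetrised form
   are represented by their underlying functions. *)
Definition is_sym_aut (w : L -> L) : Prop :=
  [/\ forall x y, w (x + y) = w x + w y,
      bijective w
    & forall x y, symform (w x) (w y) = symform x y].

Definition is_sym_aut_subgroup (H : set (L -> L)) : Prop :=
  [/\ H `<=` is_sym_aut,
      H id,
      forall u v, H u -> H v -> H (u \o v)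
    & forall u v, H u -> cancel u v -> cancel v u -> H v].

(* The moves are indexed from 0: braid_sigma i acts on the entries F`_i and
   F`_i.+1. *)
Definition braid_sigma i F : seq L :=
  take i F ++ [:: F`_i.+1; srefl F`_i.+1 F`_i] ++ drop i.+2 F.

(* The inverse of sigma_i: (g, h) |-> (s_g h, g), since s_g is an involution. *)
Definition braid_sigmaV i F : seq L :=
  take i F ++ [:: srefl F`_i F`_i.+1; F`_i] ++ drop i.+2 F.

Definition sign_act (eps : nat -> bool) F : seq L :=
  mkseq (fun i => F`_i *~ ((-1) ^+ eps i)) (size F).

(* The orbit of F under {+1,-1} wr B_r, r = size F: every element of the group
   is a product of sign vectors, of the sigma_i and of their inverses. *)
Inductive braid_orbit F : set (seq L) :=
  | BraidOrbit_id : braid_orbit F F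
  | BraidOrbit_sigma i G : braid_orbit F G -> (i.+1 < size G)%N ->
      braid_orbit F (braid_sigma i G)
  | BraidOrbit_sigmaV i G : braid_orbit F G -> (i.+1 < size G)%N ->
      braid_orbit F (braid_sigmaV i G)
  | BraidOrbit_sign eps G : braid_orbit F G ->
      braid_orbit F (sign_act eps G).

End BilinearLattice.

(** * Generalised Cartan lattices and non-crossing partitions *)

Record gcLattice := GCLattice {
  gc_lattice :> bilLattice;
  gc_seq : seq gc_lattice;
  gc_exceptional : exceptional gc_seq;
  gc_complete : complete gc_seq;
  gc_orthogonal : orthogonal_seq gc_seq
}.

Section GeneralisedCartanLattice.
Variable L : gcLattice.
Implicit Types (u v w : L -> L) (F G : seq L).

Definition weyl : set (L -> L) :=
  smallest (@is_sym_aut_subgroup L) [set srefl e | e in [set` gc_seq L]].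

Definition real_root : set L :=
  [set x | exists w e, [/\ weyl w, e \in gc_seq L & x = w e]].

Definition cox : L -> L := srefl_seq (gc_seq L).

Definition is_refl_product w (k : nat) : Prop :=
  exists A : seq L,
    [/\ size A = k, forall a, a \in A -> real_root a & w = srefl_seq A].

(* For w in the Weyl group a minimal k exists, and it is unique; the default
   value is never used. *)
Definition abs_length w : nat :=
  xget 0%N [set k | is_refl_product w k /\
                    forall j, is_refl_product w j -> (k <= j)%N].

(* u' is the inverse of u, so that u' \o v is u^-1 v. *)
Definition abs_le u v : Prop :=
  exists u', [/\ cancel u u', cancel u' u &
    (abs_length u + abs_length (u' \o v))%N = abs_length v].

Definition NC : Type :=
  {w : L -> L | [/\ weyl w, abs_le id w & abs_le w cox]}.

Definition NC_le (u v : NC) : Prop := abs_le (sval u) (sval v).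

(** * Real exceptional sequences and their orbits *)

Definition real_exceptional F : Prop :=
  exists C : seq L,
    [/\ exceptional C, complete C, forall f, f \in C -> real_root f
      & subseq F C].

Definition Exc : Type :=
  {C : set (seq L) | exists2 F, real_exceptional F & C = braid_orbit F}.

Definition exc_class F (hF : real_exceptional F) : Exc :=
  exist _ (braid_orbit F) (ex_intro2 _ _ F hF erefl).

Definition Exc_le (C D : Exc) : Prop :=
  exists G F (hG : real_exceptional G) (hF : real_exceptional F),
    [/\ C = exc_class hG, D = exc_class hF
      & exists2 F', braid_orbit F F' & prefix G F'].

End GeneralisedCartanLattice.

(** * The category of generalised Cartan lattices and its subobjects *)

Record gcMorphism (L' L : gcLattice) := GCMorphism {
  gcm_fun :> {additive L' -> L};
  gcm_form : forall x y, bform (gcm_fun x) (gcm_fun y) = bform x y;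
  gcm_exceptional : real_exceptional (map gcm_fun (gc_seq L'))
}.

Definition is_mono (L' L : gcLattice) (phi : gcMorphism L' L) : Prop :=
  forall (K : gcLattice) (psi psi' : gcMorphism K L'),
    phi \o psi =1 phi \o psi' -> psi =1 psi'.

Record monoInto (L : gcLattice) := MonoInto {
  mi_dom : gcLattice;
  mi_mor :> gcMorphism mi_dom L;
  mi_mono : is_mono mi_mor
}.

Section Subobjects.
Variable L : gcLattice.
Implicit Types phi psi : monoInto L.

Definition factors_through phi psi : Prop :=
  exists theta : gcMorphism (mi_dom phi) (mi_dom psi), phi =1 psi \o theta.

Definition sub_equiv phi psi : Prop :=
  factors_through phi psi /\ factors_through psi phi.

Definition Subobj : Type :=
  {C : monoInto L -> Prop | exists phi, C = sub_equiv phi}.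

Definition subobj_class phi : Subobj :=
  exist _ (sub_equiv phi) (ex_intro _ phi erefl).

Definition Subobj_le (C D : Subobj) : Prop :=
  exists phi psi,
    [/\ C = subobj_class phi, D = subobj_class psi & factors_through phi psi].

End Subobjects.

(** * Poset isomorphisms *)

Definition poset_iso (A B : Type) (leA : A -> A -> Prop) (leB : B -> B -> Prop)
    (f : A -> B) : Prop :=
  [/\ Relation_Definitions.order A leA, Relation_Definitions.order B leB,
      bijective f & forall x y, leA x y <-> leB (f x) (f y)].

(* Main.v *)
(* Both maps become injections into the poset NC once everything is expressed
   through products of reflections: [phi] <= [psi] and [G] <= [F] both turn out
   to mean that s_{phi E'}, respectively s_G, precedes s_{psi E''}, respectively
   s_F, in the absolute order.

   Coxeter side. The Weyl group acts affinely, s_a becoming the reflection in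
   the hyperplane (x, a) = rho a with rho e_i = <e_i, e_i>, and the displacement
   w(0) of every element is a nonnegative combination of E. Minimising the sum
   of the heights of the partial displacements over a Hurwitz orbit of
   factorisations of the Coxeter element gives a factorisation all of whose
   steps go up; the exchange condition braids it to E. Hence the factorisations
   of cox into n reflections form one orbit, and they are the complete real
   exceptional sequences.

   It remains to see that s_F = s_G forces F ~ G. The lattice is the
   Grothendieck group of the representations of a rational species; members of a
   complete real exceptional sequence are, up to sign, classes of exceptional
   modules. Their Hom-dimensions show that a representative F' of [F] with
   positive entries of least total height is orthogonal. If s_F = s_G, then F'
   and G' have a common completion H, and the perpendicular category of H is
   filtered by the modules of F' as well as by those of G'. So F' and G' lie in
   each other's cones and agree up to a permutation. An orthogonal
   representative also makes the span of F a generalised Cartan lattice, which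
   shows that every orbit comes from a subobject. *)
Require Import Defs.
From HB Require Import structures.
From mathcomp Require Import all_boot all_order all_algebra.
From mathcomp Require Import boolp classical_sets.
From mathcomp Require Import zify ring.

Set Implicit Arguments.
Unset Strict Implicit.
Unset Printing Implicit Defensive.

Import Order.TTheory GRing.Theory Num.Theory.
Local Open Scope classical_set_scope.
Local Open Scope ring_scope.

(** * Reflections and exceptional sequences *)

(** The linear action offers no point from which to measure a product of reflections. The affine
    action is what conjugation by the translation along a Weyl vector would give: it attaches to w
    the vector rho - w(rho), so that products get heights even when the symmetrised form is
    indefinite and the group infinite.

    Cones are compared through filtrations, hence through modules. As <e_i, e_i> may be any positive
    integer, a vertex field of that degree is needed for every i; adjoining 2^(1/d) to the rationals
    gives one, with explicit intersections. As e_i and e_j are roots, <e_i, e_j> is a multiple of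
    the lcm of the two degrees, which is the dimension of one arrow bimodule; the quotient is the
    number of arrows.

    It is never shown that an exceptional module is determined by its class. The modules that two
    sequences attach to the common completion H are therefore known to share their classes only, and
    the passage from one perpendicular category to the other rests on [semistable_hom0], a
    comparison of dimensions. *)

Section BilinearLatticeTheory.
Variable L : bilLattice.
Implicit Types (a b x y z : L) (E F G : seq L) (k : int).

Lemma bform0l y : bform (0 : L) y = 0.
Proof. by apply: (addrI (bform 0 y)); rewrite -bformDl !addr0. Qed.

Lemma bform0r x : bform x (0 : L) = 0.
Proof. by apply: (addrI (bform x 0)); rewrite -bformDr !addr0. Qed.

Lemma bformNl x y : bform (- x) y = - bform x y.
Proof. by apply: (addrI (bform x y)); rewrite -bformDl !subrr bform0l. Qed.

Lemma bformNr x y : bform x (- y) = - bform x y.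
Proof. by apply: (addrI (bform x y)); rewrite -bformDr !subrr bform0r. Qed.

Lemma bformMzl x y k : bform (x *~ k) y = bform x y * k.
Proof.
have Hn (n : nat) : bform (x *+ n) y = bform x y * n%:Z.
  elim: n => [|n IHn]; first by rewrite mulr0n bform0l mulr0.
  by rewrite mulrS bformDl IHn -addn1 PoszD; ring.
case: k => n; first by rewrite -pmulrn Hn.
by rewrite NegzE mulrNz bformNl -pmulrn Hn mulrN.
Qed.

Lemma bformMzr x y k : bform x (y *~ k) = bform x y * k.
Proof.
have Hn (n : nat) : bform x (y *+ n) = bform x y * n%:Z.
  elim: n => [|n IHn]; first by rewrite mulr0n bform0r mulr0.
  by rewrite mulrS bformDr IHn -addn1 PoszD; ring.
case: k => n; first by rewrite -pmulrn Hn.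
by rewrite NegzE mulrNz bformNr -pmulrn Hn mulrN.
Qed.

Definition bformE := (bformDl, bformDr, bformNl, bformNr, bformMzl, bformMzr,
  bform0l, bform0r).

Lemma bform_suml I (r : seq I) (P : pred I) (f : I -> L) y :
  bform (\sum_(i <- r | P i) f i) y = \sum_(i <- r | P i) bform (f i) y.
Proof.
by apply: (big_morph (fun z => bform z y)) => [u v|]; rewrite ?bformDl ?bform0l.
Qed.

Lemma bform_sumr I (r : seq I) (P : pred I) (f : I -> L) x :
  bform x (\sum_(i <- r | P i) f i) = \sum_(i <- r | P i) bform x (f i).
Proof.
by apply: (big_morph (bform x)) => [u v|]; rewrite ?bformDr ?bform0r.
Qed.

Lemma bform_extr x y : (forall z, bform z x = bform z y) -> x = y.
Proof.
move=> eq_xy; apply/eqP; rewrite -subr_eq0; apply/eqP.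
by apply: bform_nondegr => z; rewrite !bformE eq_xy subrr.
Qed.

(** A non-degenerate form with values in the integers leaves no room for torsion. *)
Lemma mulrz_inj_lattice x k : k != 0 -> x *~ k = 0 -> x = 0.
Proof.
move=> k_neq0 xk0; apply: bform_nondegl => y.
have: bform (x *~ k) y = 0 by rewrite xk0 bform0l.
by rewrite bformMzl => /eqP; rewrite mulf_eq0 (negPf k_neq0) orbF => /eqP.
Qed.

Lemma symformC x y : symform x y = symform y x.
Proof. by rewrite /symform addrC. Qed.

Definition root_coef a x : int := ((2 * symform x a) %/ symform a a)%Z.

Lemma sreflE a x : srefl a x = x - a *~ root_coef a x.
Proof. by []. Qed.

Lemma root_gt0 a : is_root a -> 0 < bform a a.
Proof. by case. Qed.

Lemma root_neq0 a : is_root a -> bform a a != 0.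
Proof. by move/root_gt0; rewrite lt0r => /andP[]. Qed.

Lemma root_dvdl a x : is_root a -> exists k, bform a x = k * bform a a.
Proof. by case=> _ /(_ x)[/dvdzP[k ->] _]; exists k. Qed.

Lemma root_dvdr a x : is_root a -> exists k, bform x a = k * bform a a.
Proof. by case=> _ /(_ x)[_ /dvdzP[k ->]]; exists k. Qed.

(** With <a, x> = k <a, a> and <x, a> = l <a, a> the dividend 2 (x, a) equals (k + l) (a, a), so the
    integer division is exact. From here on the coefficient is handled through this identity and not
    through division. *)
Lemma root_coefE a x : is_root a -> root_coef a x * bform a a = symform x a.
Proof.
move=> ra; have [k ax] := root_dvdl x ra; have [l xa] := root_dvdr x ra.
have d0 := root_neq0 ra.
rewrite /root_coef /symform ax xa.
have -> : 2 * (l * bform a a + k * bform a a)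
          = (l + k) * (bform a a + bform a a) by ring.
rewrite mulzK; first by ring.
by rewrite -mulr2n mulrn_eq0.
Qed.

Lemma root_coef_uniq a x k :
  is_root a -> k * bform a a = symform x a -> root_coef a x = k.
Proof.
by move=> ra; rewrite -root_coefE // => /(mulIf (root_neq0 ra)).
Qed.

Lemma root_coefD a x y :
  is_root a -> root_coef a (x + y) = root_coef a x + root_coef a y.
Proof.
move=> ra; apply: root_coef_uniq => //.
by rewrite mulrDl !root_coefE // /symform !bformE; ring.
Qed.

Lemma root_coefMz a x k : is_root a -> root_coef a (x *~ k) = root_coef a x * k.
Proof.
move=> ra; apply: root_coef_uniq => //.
by rewrite mulrAC root_coefE // /symform !bformE; ring.
Qed.

Lemma sreflD a x y : is_root a -> srefl a (x + y) = srefl a x + srefl a y.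
Proof. by move=> ra; rewrite /srefl -!/(root_coef _ _) root_coefD // mulrzDr opprD addrACA. Qed.

Lemma sreflMz a x k : is_root a -> srefl a (x *~ k) = srefl a x *~ k.
Proof.
by move=> ra; rewrite !sreflE root_coefMz // mulrzBl mulrzA.
Qed.

Lemma sreflN a x : is_root a -> srefl a (- x) = - srefl a x.
Proof. by move=> ra; rewrite -[- x](mulrNz x 1) sreflMz // mulrNz. Qed.

Lemma srefl_self a : is_root a -> srefl a a = - a.
Proof.
move=> ra; rewrite sreflE (@root_coef_uniq _ _ 2) //.
  by rewrite -[2]/(1 + 1) mulrzDr opprD addrA subrr add0r.
by rewrite /symform; ring.
Qed.

Lemma symform_srefl a x y :
  is_root a -> symform (srefl a x) (srefl a y) = symform x y.
Proof.
move=> ra; rewrite !sreflE.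
have := root_coefE x ra; have := root_coefE y ra.
move: (root_coef a x) (root_coef a y) => k l; rewrite /symform !bformE.
move=> /eqP; rewrite -subr_eq => /eqP <- /eqP; rewrite -subr_eq => /eqP <-.
by ring.
Qed.

Lemma symform_srefl_self a x : is_root a -> symform (srefl a x) a = - symform x a.
Proof.
move=> ra; rewrite -(symform_srefl x a ra) srefl_self //.
by rewrite /symform !bformE; ring.
Qed.

Lemma sreflK a : is_root a -> involutive (srefl a).
Proof.
move=> ra x; rewrite [LHS]sreflE [root_coef a _](@root_coef_uniq _ _ (- root_coef a x)) //.
  by rewrite sreflE mulrNz opprK subrK.
by rewrite mulNr root_coefE // symform_srefl_self.
Qed.

Lemma bform_symform x : symform x x = 2 * bform x x.
Proof. by rewrite /symform; ring. Qed.

Lemma bform_srefl a x : is_root a -> bform (srefl a x) (srefl a x) = bform x x.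
Proof.
move=> ra; apply: (@mulfI _ 2) => //.
by rewrite -!bform_symform symform_srefl.
Qed.

(** Both summands of (x, a) are multiples of <x, x> as well, because x is a root; this divisibility
    is what makes s_a x a root again. *)
Lemma root_coefr a x : is_root a -> is_root x ->
  exists k, root_coef a x * bform a a = k * bform x x.
Proof.
move=> ra rx; rewrite root_coefE // /symform.
have [k ->] := root_dvdl a rx; have [l ->] := root_dvdr a rx.
by exists (k + l); ring.
Qed.

Lemma root_srefl a x : is_root a -> is_root x -> is_root (srefl a x).
Proof.
move=> ra rx; split; first by rewrite bform_srefl // root_gt0.
move=> y; rewrite bform_srefl // sreflE !bformE.
have [k1 e1] := root_dvdl y rx; have [k2 e2] := root_dvdr y rx.
have [l1 e3] := root_dvdl y ra; have [l2 e4] := root_dvdr y ra.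
have [m e5] := root_coefr ra rx.
split; apply/dvdzP.
  exists (k1 - m * l1); rewrite e1 e3.
  by rewrite -[l1 * _ * _]mulrA [_ * root_coef _ _]mulrC e5; ring.
exists (k2 - m * l2); rewrite e2 e4.
by rewrite -[l2 * _ * _]mulrA [_ * root_coef _ _]mulrC e5; ring.
Qed.

Lemma root_opp a : is_root a -> is_root (- a).
Proof.
move=> ra; split; first by rewrite !bformE opprK root_gt0.
move=> x; rewrite !bformE opprK; have [k ->] := root_dvdl x ra.
have [l ->] := root_dvdr x ra.
by split; apply/dvdzP; [exists (- k)|exists (- l)]; rewrite mulNr.
Qed.

Lemma root_coefN a x : is_root a -> root_coef (- a) x = - root_coef a x.
Proof.
move=> ra; apply: (root_coef_uniq (root_opp ra)).
by rewrite !bformE opprK mulNr root_coefE // /symform !bformE; ring.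
Qed.

Lemma srefl_opp a : is_root a -> srefl (- a) =1 srefl a.
Proof. by move=> ra x; rewrite !sreflE root_coefN // mulNrz mulrNz opprK. Qed.

Lemma root_coef_srefl a b x : is_root a -> is_root b ->
  root_coef (srefl b a) (srefl b x) = root_coef a x.
Proof.
move=> ra rb; apply: root_coef_uniq; first exact: root_srefl.
by rewrite bform_srefl // root_coefE // symform_srefl.
Qed.

Lemma srefl_conj a b x : is_root a -> is_root b ->
  srefl (srefl b a) (srefl b x) = srefl b (srefl a x).
Proof.
move=> ra rb; rewrite [LHS]sreflE root_coef_srefl // [srefl a x]sreflE.
by rewrite sreflD // sreflN // sreflMz.
Qed.

Lemma srefl_orth a x : is_root a -> symform x a = 0 -> srefl a x = x.
Proof.
by move=> ra xa0; rewrite sreflE (@root_coef_uniq _ _ 0) // ?mul0r ?xa0 // mulr0z subr0.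
Qed.

Definition all_roots E := forall a, a \in E -> is_root a.

Lemma roots_cons a E : all_roots (a :: E) <-> is_root a /\ all_roots E.
Proof.
split=> [rE|[ra rE] b].
  by split=> [|b bE]; apply: rE; rewrite inE ?eqxx ?bE ?orbT.
by rewrite inE => /predU1P[->|/rE].
Qed.

Lemma roots_cat E F : all_roots (E ++ F) <-> all_roots E /\ all_roots F.
Proof.
split=> [rE|[rE rF] b].
  by split=> b bE; apply: rE; rewrite mem_cat bE ?orbT.
by rewrite mem_cat => /orP[/rE|/rF].
Qed.

Lemma srefl_seq_cat E F x : srefl_seq (E ++ F) x = srefl_seq E (srefl_seq F x).
Proof. by elim: E => //= a E ->. Qed.

Lemma srefl_seqD E x y :
  all_roots E -> srefl_seq E (x + y) = srefl_seq E x + srefl_seq E y.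
Proof.
by elim: E => //= a E IHE /roots_cons[ra /IHE ->]; rewrite sreflD.
Qed.

Lemma srefl_seqMz E x k : all_roots E -> srefl_seq E (x *~ k) = srefl_seq E x *~ k.
Proof.
by elim: E => //= a E IHE /roots_cons[ra /IHE ->]; rewrite sreflMz.
Qed.

Lemma srefl_seqN E x : all_roots E -> srefl_seq E (- x) = - srefl_seq E x.
Proof.
by elim: E => //= a E IHE /roots_cons[ra /IHE ->]; rewrite sreflN.
Qed.

Lemma symform_srefl_seq E x y :
  all_roots E -> symform (srefl_seq E x) (srefl_seq E y) = symform x y.
Proof.
by elim: E => //= a E IHE /roots_cons[ra /IHE <-]; rewrite symform_srefl.
Qed.

Lemma root_srefl_seq E x : all_roots E -> is_root x -> is_root (srefl_seq E x).
Proof.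
by elim: E => //= a E IHE /roots_cons[ra /IHE rx] /rx; apply: root_srefl.
Qed.

Lemma bform_srefl_seq E x :
  all_roots E -> bform (srefl_seq E x) (srefl_seq E x) = bform x x.
Proof.
by elim: E => //= a E IHE /roots_cons[ra /IHE <-]; rewrite bform_srefl.
Qed.

Lemma roots_rev E : all_roots E -> all_roots (rev E).
Proof. by move=> rE a; rewrite mem_rev; apply: rE. Qed.

Lemma srefl_seq_revK E : all_roots E -> cancel (srefl_seq E) (srefl_seq (rev E)).
Proof.
elim: E => //= a E IHE /roots_cons[ra rE] x.
by rewrite rev_cons -cats1 srefl_seq_cat /= sreflK // IHE.
Qed.

Lemma srefl_seqK E : all_roots E -> cancel (srefl_seq (rev E)) (srefl_seq E).
Proof. by move=> rE x; have := srefl_seq_revK (roots_rev rE) x; rewrite revK. Qed.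

Lemma srefl_seq_conj E a x : all_roots E -> is_root a ->
  srefl (srefl_seq E a) (srefl_seq E x) = srefl_seq E (srefl a x).
Proof.
elim: E => //= b E IHE /roots_cons[rb rE] ra.
by rewrite srefl_conj ?IHE //; apply: root_srefl_seq.
Qed.

End BilinearLatticeTheory.

(** * Braid orbits *)

Section Orbits.
Variable L : bilLattice.
Implicit Types (a b x y z : L) (A B E F G H : seq L) (k : int) (i : nat).

Lemma braid_sigma_cat A x y B :
  braid_sigma (size A) (A ++ x :: y :: B) = A ++ y :: srefl y x :: B.
Proof.
rewrite /braid_sigma take_size_cat // !nth_cat ltnn subnn ltnNge leqnSn /=.
rewrite -addn2 addnC -drop_drop drop_size_cat //=.
by rewrite subSnn /= drop0.
Qed.

Lemma braid_sigmaV_cat A x y B :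
  braid_sigmaV (size A) (A ++ x :: y :: B) = A ++ srefl x y :: x :: B.
Proof.
rewrite /braid_sigmaV take_size_cat // !nth_cat ltnn subnn ltnNge leqnSn /=.
rewrite -addn2 addnC -drop_drop drop_size_cat //=.
by rewrite subSnn /= drop0.
Qed.

Lemma seq_split2 G i : (i.+1 < size G)%N ->
  G = take i G ++ G`_i :: G`_i.+1 :: drop i.+2 G /\ size (take i G) = i.
Proof.
move=> lti; split; last by rewrite size_takel // ltnW // ltnW.
by rewrite -!drop_nth ?cat_take_drop // ltnW.
Qed.

Lemma bo_sigma F A x y B : braid_orbit F (A ++ x :: y :: B) ->
  braid_orbit F (A ++ y :: srefl y x :: B).
Proof.
move=> oF; rewrite -braid_sigma_cat; apply: BraidOrbit_sigma => //.
by rewrite size_cat /= !addnS !ltnS leq_addr.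
Qed.

Lemma bo_sigmaV F A x y B : braid_orbit F (A ++ x :: y :: B) ->
  braid_orbit F (A ++ srefl x y :: x :: B).
Proof.
move=> oF; rewrite -braid_sigmaV_cat; apply: BraidOrbit_sigmaV => //.
by rewrite size_cat /= !addnS !ltnS leq_addr.
Qed.

Lemma bo_trans F G H : braid_orbit F G -> braid_orbit G H -> braid_orbit F H.
Proof.
move=> oFG; elim=> // {H}.
- by move=> i H _ oH lti; apply: BraidOrbit_sigma.
- by move=> i H _ oH lti; apply: BraidOrbit_sigmaV.
- by move=> eps H _ oH; apply: BraidOrbit_sign.
Qed.

Lemma bo_sgn F G (p : pred L) : braid_orbit F G ->
  braid_orbit F (map (fun x => if p x then x else - x) G).
Proof.
move=> oG; suff -> : map (fun x => if p x then x else - x) G =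
    sign_act (fun i => ~~ p G`_i) G by apply: BraidOrbit_sign.
apply: (@eq_from_nth _ 0) => [|i]; first by rewrite size_map size_mkseq.
rewrite size_map => lti; rewrite (nth_map 0) // nth_mkseq //.
by case: (p _); rewrite /= ?expr0 ?expr1 ?mulr1z ?mulrN1z.
Qed.

Lemma sign_act_cat eps F G : sign_act eps (F ++ G) =
  sign_act eps F ++ sign_act (fun i => eps (size F + i)%N) G.
Proof.
apply: (@eq_from_nth _ 0) => [|i]; first by rewrite size_cat !size_mkseq size_cat.
rewrite size_mkseq size_cat => lti; rewrite nth_mkseq ?size_cat // !nth_cat.
rewrite size_mkseq; case: ltnP => ltF; first by rewrite nth_mkseq.
by rewrite nth_mkseq ?subnKC // ltn_subLR.
Qed.

Lemma sign_act1 eps x : sign_act eps [:: x] = [:: if eps 0%N then - x else x].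
Proof.
by rewrite /sign_act /mkseq /=; case: (eps 0%N); rewrite /= ?expr0 ?expr1 ?mulr1z ?mulrN1z.
Qed.

(** An induction principle with the moves written on concatenations and the signs changed one entry
    at a time; a sign vector is a succession of such changes. *)
Lemma bo_ind F (P : seq L -> Prop) :
  P F ->
  (forall A x y B, braid_orbit F (A ++ x :: y :: B) -> P (A ++ x :: y :: B) ->
     P (A ++ y :: srefl y x :: B)) ->
  (forall A x y B, braid_orbit F (A ++ x :: y :: B) -> P (A ++ x :: y :: B) ->
     P (A ++ srefl x y :: x :: B)) ->
  (forall A x B, P (A ++ x :: B) -> P (A ++ - x :: B)) ->
  forall G, braid_orbit F G -> P G.
Proof.
move=> P0 Ps Pv Pn G; elim=> // {G}.
- move=> i G oG PG lti; have [eG si] := seq_split2 lti.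
  by rewrite eG -{1}si braid_sigma_cat; apply: Ps; rewrite -eG.
- move=> i G oG PG lti; have [eG si] := seq_split2 lti.
  by rewrite eG -{1}si braid_sigmaV_cat; apply: Pv; rewrite -eG.
move=> eps G _; suff H A B : P (A ++ B) -> P (A ++ sign_act (fun i => eps (size A + i)%N) B).
  by move/(H [::] G).
elim: B A => [|x B IHB] A PAB; first exact: PAB.
rewrite -[x :: B]cat1s sign_act_cat sign_act1 addn0 /=.
have {}PAB : P (rcons A (if eps (size A) then - x else x) ++ B).
  by rewrite cat_rcons; case: (eps _) => //; apply: Pn.
have := IHB _ PAB; rewrite cat_rcons size_rcons; congr (P (_ ++ _ :: _)).
by apply: eq_map => i; rewrite addSnnS.
Qed.

Lemma bo_size F G : braid_orbit F G -> size G = size F.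
Proof.
move: G; apply: (@bo_ind F (fun G => size G = size F)) => //.
- by move=> A x y B _ <-; rewrite !size_cat.
- by move=> A x y B _ <-; rewrite !size_cat.
- by move=> A x B <-; rewrite !size_cat.
Qed.

Lemma bo_roots F G : all_roots F -> braid_orbit F G -> all_roots G.
Proof.
move=> rF; move: G; apply: (@bo_ind F (@all_roots L)) => // [A x y B _|A x y B _|A x B].
- move/roots_cat=> [rA /roots_cons[rx /roots_cons[ry rB]]].
  apply/roots_cat; split=> //; apply/roots_cons; split=> //.
  by apply/roots_cons; split=> //; apply: root_srefl.
- move/roots_cat=> [rA /roots_cons[rx /roots_cons[ry rB]]].
  apply/roots_cat; split=> //; apply/roots_cons; split=> //; first exact: root_srefl.
  exact/roots_cons.
- move/roots_cat=> [rA /roots_cons[rx rB]].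
  by apply/roots_cat; split=> //; apply/roots_cons; split=> //; apply: root_opp.
Qed.

Lemma srefl_srefl x y z : is_root x -> is_root y ->
  srefl (srefl y x) z = srefl y (srefl x (srefl y z)).
Proof. by move=> rx ry; rewrite -srefl_conj // sreflK. Qed.

Lemma bo_ind_roots F (P : seq L -> Prop) :
  all_roots F -> P F ->
  (forall A x y B, [/\ all_roots A, is_root x, is_root y & all_roots B] ->
     braid_orbit F (A ++ x :: y :: B) -> P (A ++ x :: y :: B) ->
     P (A ++ y :: srefl y x :: B)) ->
  (forall A x y B, [/\ all_roots A, is_root x, is_root y & all_roots B] ->
     braid_orbit F (A ++ x :: y :: B) -> P (A ++ x :: y :: B) ->
     P (A ++ srefl x y :: x :: B)) ->
  (forall A x B, [/\ all_roots A, is_root x & all_roots B] ->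
     P (A ++ x :: B) -> P (A ++ - x :: B)) ->
  forall G, braid_orbit F G -> P G.
Proof.
move=> rF P0 Ps Pv Pn G oG.
suff [] : all_roots G /\ P G by [].
move: G oG; apply: (@bo_ind F (fun G => all_roots G /\ P G)) => // [A x y B oG|A x y B oG|A x B].
- move=> [/roots_cat[rA /roots_cons[rx /roots_cons[ry rB]]] PG].
  split; last exact: Ps.
  by apply: bo_roots rF _; apply: bo_sigma.
- move=> [/roots_cat[rA /roots_cons[rx /roots_cons[ry rB]]] PG].
  split; last exact: Pv.
  by apply: bo_roots rF _; apply: bo_sigmaV.
- move=> [/roots_cat[rA /roots_cons[rx rB]] PG].
  split; last exact: Pn.
  by apply/roots_cat; split=> //; apply/roots_cons; split=> //; apply: root_opp.
Qed.

(** Both moves rest on s_{s_y x} = s_y s_x s_y, and a sign does not alter a reflection. *)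
Lemma bo_srefl_seq F G : all_roots F -> braid_orbit F G -> srefl_seq G =1 srefl_seq F.
Proof.
move=> rF oG z; move: G oG.
apply: (@bo_ind_roots F (fun G => srefl_seq G z = srefl_seq F z)) => //.
- move=> A x y B [rA rx ry rB] _ <-.
  by rewrite !srefl_seq_cat /= srefl_srefl // sreflK.
- move=> A x y B [rA rx ry rB] _ <-.
  by rewrite !srefl_seq_cat /= srefl_srefl // sreflK.
- by move=> A x B [rA rx rB] <-; rewrite !srefl_seq_cat /= srefl_opp.
Qed.

Lemma bo_cat A B F G : braid_orbit F G -> braid_orbit (A ++ F ++ B) (A ++ G ++ B).
Proof.
move=> oG; elim: oG => {G} [|i G _ oG lti|i G _ oG lti|eps G _ oG].
- exact: BraidOrbit_id.
- have [eG si] := seq_split2 lti; move: (take i G) si eG => T si eG.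
  rewrite eG -si braid_sigma_cat si -catA /= (catA A T); apply: bo_sigma.
  by move: oG; rewrite {1}eG -!catA.
- have [eG si] := seq_split2 lti; move: (take i G) si eG => T si eG.
  rewrite eG -si braid_sigmaV_cat si -catA /= (catA A T); apply: bo_sigmaV.
  by move: oG; rewrite {1}eG -!catA.
(* The sign vector is padded with trivial signs on [A] and on [B]. *)
pose eps' i := if (i < size A)%N then false else
  if (i - size A < size G)%N then eps (i - size A)%N else false.
suff <- : sign_act eps' (A ++ G ++ B) = A ++ sign_act eps G ++ B.
  exact: BraidOrbit_sign.
have sgn_id (e : nat -> bool) D : (forall i, (i < size D)%N -> e i = false) -> sign_act e D = D.
  move=> e0; apply: (@eq_from_nth _ 0) => [|i]; first by rewrite size_mkseq.
  by rewrite size_mkseq => lti; rewrite nth_mkseq // e0 // expr0 mulr1z.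
rewrite !sign_act_cat; congr (_ ++ (_ ++ _)).
- by apply: sgn_id => i lti; rewrite /eps' lti.
- apply/eq_in_map => i; rewrite mem_iota add0n /= => lti.
  by rewrite /eps' ltnNge leq_addr /= addKn lti.
- by apply: sgn_id => i lti; rewrite /eps' ltnNge leq_addr /= addKn ltnNge leq_addr.
Qed.

Lemma bo_catl B F G : braid_orbit F G -> braid_orbit (F ++ B) (G ++ B).
Proof. exact: (@bo_cat [::] B). Qed.

Lemma bo_catr A F G : braid_orbit F G -> braid_orbit (A ++ F) (A ++ G).
Proof. by move/(@bo_cat A [::]); rewrite !cats0. Qed.

Lemma bo_opp A x B : braid_orbit (A ++ x :: B) (A ++ - x :: B).
Proof.
rewrite -[x :: B]cat1s -[- x :: B]cat1s; apply: bo_cat.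
have -> : [:: - x] = sign_act (fun=> true) [:: x] by rewrite sign_act1.
exact/BraidOrbit_sign/BraidOrbit_id.
Qed.

(** The two kinds of moves undo each other because reflections in roots are involutions; this is
    where the entries must be roots. *)
Lemma bo_sym F G : all_roots F -> braid_orbit F G -> braid_orbit G F.
Proof.
move=> rF; move: G; apply: (@bo_ind_roots F (fun G => braid_orbit G F)) => //.
- exact: BraidOrbit_id.
- move=> A x y B [rA rx ry rB] _ oF; apply: bo_trans oF.
  by rewrite -{2}[x](sreflK ry); apply/bo_sigmaV/BraidOrbit_id.
- move=> A x y B [rA rx ry rB] _ oF; apply: bo_trans oF.
  by rewrite -{2}[y](sreflK rx); apply/bo_sigma/BraidOrbit_id.
- move=> A x B [rA rx rB] oF; apply: bo_trans oF.
  by rewrite -{2}[x]opprK; apply: bo_opp.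
Qed.

End Orbits.

(** * Exceptional sequences and their spans *)

Section ExceptionalSequences.
Variable L : bilLattice.
Implicit Types (a b x y z : L) (A B E F G H : seq L) (k : int).

(** The integer span, one coefficient peeled off at a time, in a form suited to induction on the
    sequence; [completeP] relates it to [inIntSpan]. *)
Fixpoint spn E x : Prop :=
  if E is a :: E' then exists k, spn E' (x - a *~ k) else x = 0.

Lemma spn0 E : spn E 0.
Proof. by elim: E => //= a E IHE; exists 0; rewrite mulr0z subr0. Qed.

Lemma spnD E x y : spn E x -> spn E y -> spn E (x + y).
Proof.
elim: E x y => /= [x y -> ->|a E IHE x y [k xE] [l yE]]; first exact: addr0.
by exists (k + l); rewrite mulrzDr opprD addrACA; apply: IHE.
Qed.

Lemma spnMz E x k : spn E x -> spn E (x *~ k).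
Proof.
elim: E x => /= [x ->|a E IHE x [l xE]]; first exact: mul0rz.
by exists (l * k); rewrite mulrzA -mulrzBl; apply: IHE.
Qed.

Lemma spnN E x : spn E x -> spn E (- x).
Proof. by move/(spnMz (-1)); rewrite mulrN1z. Qed.

Lemma spnB E x y : spn E x -> spn E y -> spn E (x - y).
Proof. by move=> xE yE; apply: spnD => //; apply: spnN. Qed.

Lemma spn_mem E a : a \in E -> spn E a.
Proof.
elim: E => //= b E IHE; rewrite inE => /predU1P[->|/IHE aE].
  by exists 1; rewrite mulr1z subrr; apply: spn0.
by exists 0; rewrite mulr0z subr0.
Qed.

Lemma spn_sub E F x : (forall a, a \in E -> spn F a) -> spn E x -> spn F x.
Proof.
elim: E x => /= [x _ ->|a E IHE x EF [k xE]]; first exact: spn0.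
rewrite -(subrK (a *~ k) x); apply: spnD.
  by apply: IHE xE => b bE; apply: EF; rewrite inE bE orbT.
by apply/spnMz/EF; rewrite inE eqxx.
Qed.

Lemma spn_cat E F x : spn (E ++ F) x <-> exists y z, [/\ spn E y, spn F z & x = y + z].
Proof.
split=> [|[y [z [yE zF ->]]]]; last first.
  apply: spnD; [apply: spn_sub yE|apply: spn_sub zF] => a aE;
  by apply: spn_mem; rewrite mem_cat aE ?orbT.
elim: E x => /= [x xF|a E IHE x [k /IHE[y [z [yE zF eqx]]]]].
  by exists 0, x; rewrite add0r.
exists (y + a *~ k), z; split=> //; first by exists k; rewrite addrK.
by rewrite addrAC -eqx subrK.
Qed.

Lemma spn_srefl E a x : is_root a -> a \in E -> spn E x -> spn E (srefl a x).
Proof.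
by move=> ra aE xE; rewrite sreflE; apply: spnB => //; apply/spnMz/spn_mem.
Qed.

Lemma completeP E : complete E <-> forall x, spn E x.
Proof.
have H x : spn E x <-> exists c : nat -> int, x = \sum_(i < size E) E`_i *~ c i.
  elim: E x => /= [x|a E IHE x].
    by split=> [->|[c ->]]; [exists (fun=> 0)|]; rewrite big_ord0.
  split=> [[k /IHE[c xE]]|[c]].
    exists (fun i => if i is j.+1 then c j else k); rewrite big_ord_recl /=.
    by rewrite -xE addrC subrK.
  rewrite big_ord_recl /= => xE; exists (c 0%N); apply/IHE.
  by exists (fun i => c i.+1); rewrite xE addrC addKr.
split=> cE x.
  have [c xE] := cE x; apply/H.
  exists (fun i => if insub i is Some j then c j else 0).
  by rewrite xE; apply: eq_bigr => i _; rewrite valK.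
have /H[c xE] := cE x.
by exists [ffun i : 'I_(size E) => c i]; rewrite xE; apply: eq_bigr => i _; rewrite ffunE.
Qed.

(** The arguments are exchanged because [pairwise] presents the earlier entry first, while the form
    has to vanish with the later entry on the left. *)
Definition bforth a b := bform b a == 0.

Lemma exceptionalP E : exceptional E <-> all_roots E /\ pairwise bforth E.
Proof.
split=> [[rE oE]|[rE /(pairwiseP 0) oE]]; split=> //.
  apply/(pairwiseP 0) => i j; rewrite !inE => lti ltj ltij.
  by apply/eqP; apply: oE.
move=> i j ltji lti; apply/eqP; apply: oE; rewrite ?inE //.
exact: ltn_trans ltji lti.
Qed.

Lemma exceptional_nil : exceptional (Nil L).
Proof. exact/exceptionalP. Qed.

Lemma exceptional_roots E : exceptional E -> all_roots E.
Proof. by move/exceptionalP=> []. Qed.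

Lemma exceptional_cons a E : exceptional (a :: E) <->
  [/\ is_root a, exceptional E & forall e, e \in E -> bform e a = 0].
Proof.
split=> [/exceptionalP[/roots_cons[ra rE]] /= /andP[/allP aE oE]|].
  by split=> //; [apply/exceptionalP|move=> e /aE/eqP].
case=> ra /exceptionalP[rE oE] aE; apply/exceptionalP; split; first exact/roots_cons.
by rewrite /= oE andbT; apply/allP => e eE; apply/eqP/aE.
Qed.

Lemma exceptional_cat E F : exceptional (E ++ F) <->
  [/\ exceptional E, exceptional F
    & forall e f, e \in E -> f \in F -> bform f e = 0].
Proof.
split=> [/exceptionalP[/roots_cat[rE rF]]|].
  rewrite pairwise_cat => /and3P[/allrelP aEF oE oF].
  by split; [apply/exceptionalP|apply/exceptionalP|move=> e f eE fF; apply/eqP/aEF].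
case=> /exceptionalP[rE oE] /exceptionalP[rF oF] aEF.
apply/exceptionalP; split; first exact/roots_cat.
rewrite pairwise_cat oE oF !andbT; apply/allrelP => e f eE fF.
exact/eqP/aEF.
Qed.

Lemma exceptional_subseq E F : subseq E F -> exceptional F -> exceptional E.
Proof.
move=> sEF /exceptionalP[rF oF]; apply/exceptionalP.
by split; [move=> a /(mem_subseq sEF)/rF | apply: subseq_pairwise oF].
Qed.

Lemma spn_bform0l E y x : (forall e, e \in E -> bform e y = 0) -> spn E x -> bform x y = 0.
Proof.
elim: E x => /= [x _ ->|a E IHE x aE [k xE]]; first exact: bform0l.
have: bform (x - a *~ k) y = 0.
  by apply: IHE xE => e eE; apply: aE; rewrite inE eE orbT.
by rewrite !bformE (aE a) ?inE ?eqxx // mul0r subr0.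
Qed.

Lemma spn_bform0r E y x : (forall e, e \in E -> bform y e = 0) -> spn E x -> bform y x = 0.
Proof.
elim: E x => /= [x _ ->|a E IHE x aE [k xE]]; first exact: bform0r.
have: bform y (x - a *~ k) = 0.
  by apply: IHE xE => e eE; apply: aE; rewrite inE eE orbT.
by rewrite !bformE (aE a) ?inE ?eqxx // mul0r subr0.
Qed.

(* The product of the reflections of a complete exceptional sequence is thus
   determined by the form alone. *)
Lemma bform_srefl_seq_spn E x y : exceptional E -> spn E y ->
  bform y (srefl_seq E x) = - bform x y.
Proof.
elim: E x y => [x y _ /= ->|a E IHE x y]; first by rewrite !bformE oppr0.
case/exceptional_cons=> ra oE aE /= [k yE].
have {}IHE := IHE x _ oE yE.
have y0 := spn_bform0l aE yE.
rewrite sreflE; have := root_coefE (srefl_seq E x) ra.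
(* The reflections of the tail move [x] by an element of its span, which is left orthogonal to
   [a]. *)
have zx : bform (srefl_seq E x) a = bform x a.
  have /spn_bform0l-/(_ a aE) : spn E (srefl_seq E x - x).
    elim: {IHE yE y0} E {aE} oE => [|b E IHE] /=; first by rewrite subrr.
    case/exceptional_cons=> rb oE _; rewrite sreflE addrAC; exists (- root_coef b (srefl_seq E x)).
    by rewrite mulrNz opprK subrK; apply: IHE.
  by rewrite !bformE => /eqP; rewrite subr_eq0 => /eqP.
move: (root_coef _ _) zx IHE y0 => l; rewrite /symform !bformE => zx IHE y0 kl.
have ya : bform y a = bform a a * k by lia.
by rewrite ya; move: kl IHE; rewrite zx; nia.
Qed.

Lemma srefl_seq_complete E F : exceptional E -> exceptional F ->
  complete E -> complete F -> srefl_seq E =1 srefl_seq F.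
Proof.
move=> oE oF /completeP cE /completeP cF x; apply: bform_extr => y.
by rewrite !bform_srefl_seq_spn.
Qed.

(** Pairing with [a] on the right kills the span of the tail but not [a] itself; this is the linear
    independence of an exceptional sequence. *)
Lemma exceptional_free E a x k : exceptional (a :: E) -> spn E x ->
  x = a *~ k -> k = 0.
Proof.
move/exceptional_cons=> [ra oE aE] xE eqx; have := spn_bform0l aE xE.
by rewrite eqx bformMzl => /eqP; rewrite mulf_eq0 (negPf (root_neq0 ra)) => /eqP.
Qed.

(** The only pair that is not immediate is (y, s_y x): as <y, x> = 0, the reflection coefficient
    times <y, y> is <x, y>, so that <s_y x, y> = 0. The inverse move is symmetric. *)
Lemma exceptional_bo E F : exceptional E -> braid_orbit E F -> exceptional F.
Proof.
move=> oE; move: F; apply: (@bo_ind L E (@exceptional L)) => // [A x y B _|A x y B _|A x B].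
- case/exceptional_cat=> oA /exceptional_cons[rx /exceptional_cons[ry oB yB] xB] AB.
  have yx : bform y x = 0 by apply: xB; rewrite inE eqxx.
  apply/exceptional_cat; split=> //.
    apply/exceptional_cons; split=> //.
      apply/exceptional_cons; split=> //; first exact: root_srefl.
      move=> e eB; rewrite sreflE !bformE yB // xB ?inE ?eB ?orbT //; ring.
    move=> e; rewrite inE => /predU1P[->|/yB//].
    rewrite sreflE !bformE; have := root_coefE x ry; rewrite /symform yx; lia.
  move=> e f eA; rewrite !inE => /or3P[/eqP->|/eqP->|fB].
  - by apply: AB => //; rewrite !inE eqxx ?orbT.
  - by rewrite sreflE !bformE !AB ?inE ?eqxx ?orbT //; ring.
  - by apply: AB; rewrite ?inE ?fB ?orbT.
- case/exceptional_cat=> oA /exceptional_cons[rx /exceptional_cons[ry oB yB] xB] AB.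
  have yx : bform y x = 0 by apply: xB; rewrite inE eqxx.
  apply/exceptional_cat; split=> //.
    apply/exceptional_cons; split; first exact: root_srefl.
      by apply/exceptional_cons; split=> // e eB; apply: xB; rewrite inE eB orbT.
    move=> e; rewrite inE => /predU1P[->|eB].
      rewrite sreflE !bformE; have := root_coefE y rx; rewrite /symform yx; lia.
    by rewrite sreflE !bformE yB // xB ?inE ?eB ?orbT //; ring.
  move=> e f eA; rewrite !inE => /or3P[/eqP->|/eqP->|fB].
  - by rewrite sreflE !bformE !AB ?inE ?eqxx ?orbT //; ring.
  - by apply: AB => //; rewrite !inE eqxx ?orbT.
  - by apply: AB; rewrite ?inE ?fB ?orbT.
case/exceptional_cat=> oA /exceptional_cons[rx oB xB] AB.
apply/exceptional_cat; split=> //.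
  apply/exceptional_cons; split=> //; first exact: root_opp.
  by move=> e eB; rewrite !bformE xB ?oppr0.
move=> e f eA; rewrite inE => /predU1P[->|fB].
  by rewrite !bformE AB ?oppr0 // inE eqxx.
by apply: AB; rewrite // inE fB orbT.
Qed.

Lemma spn_bo_sub E F x : all_roots E -> braid_orbit E F -> spn F x -> spn E x.
Proof.
move=> rE oF; move: F oF x.
apply: (@bo_ind_roots L E (fun F => forall x, spn F x -> spn E x)) => //.
- move=> A a b B [rA ra rb rB] _ IH x xF; apply: IH; apply: spn_sub xF => c.
  rewrite mem_cat !inE => /or4P[cA|/eqP->|/eqP->|cB].
  - by apply: spn_mem; rewrite mem_cat cA.
  - by apply: spn_mem; rewrite mem_cat !inE eqxx ?orbT.
  - by apply: spn_srefl => //; [|apply: spn_mem]; rewrite mem_cat !inE eqxx ?orbT.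
  - by apply: spn_mem; rewrite mem_cat !inE cB ?orbT.
- move=> A a b B [rA ra rb rB] _ IH x xF; apply: IH; apply: spn_sub xF => c.
  rewrite mem_cat !inE => /or4P[cA|/eqP->|/eqP->|cB].
  - by apply: spn_mem; rewrite mem_cat cA.
  - by apply: spn_srefl => //; [|apply: spn_mem]; rewrite mem_cat !inE eqxx ?orbT.
  - by apply: spn_mem; rewrite mem_cat !inE eqxx ?orbT.
  - by apply: spn_mem; rewrite mem_cat !inE cB ?orbT.
move=> A a B [rA ra rB] IH x xF; apply: IH; apply: spn_sub xF => c.
rewrite mem_cat !inE => /or3P[cA|/eqP->|cB].
- by apply: spn_mem; rewrite mem_cat cA.
- by apply/spnN/spn_mem; rewrite mem_cat !inE eqxx ?orbT.
- by apply: spn_mem; rewrite mem_cat !inE cB ?orbT.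
Qed.

Lemma spn_bo E F x : all_roots E -> braid_orbit E F -> spn F x <-> spn E x.
Proof.
move=> rE oF; split; first exact: spn_bo_sub.
by apply: spn_bo_sub; [apply: bo_roots oF|apply: bo_sym].
Qed.

Lemma complete_bo E F : all_roots E -> complete E -> braid_orbit E F -> complete F.
Proof.
move=> rE /completeP cE oF; apply/completeP => x.
exact/(spn_bo x rE oF).
Qed.

(** Every entry that [x] passes reflects it, the leftmost one first; hence the reversed sequence. *)
Lemma bo_move_right A x F B : all_roots F -> is_root x ->
  braid_orbit (A ++ x :: F ++ B) (A ++ F ++ srefl_seq (rev F) x :: B).
Proof.
elim: F A x => [|f F IHF] A x /=; first by move=> *; apply: BraidOrbit_id.
case/roots_cons=> rf rF rx; rewrite rev_cons -cats1 srefl_seq_cat /=.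
have step : braid_orbit (A ++ [:: x, f & F ++ B]) (A ++ [:: f, srefl f x & F ++ B]).
  exact/bo_sigma/BraidOrbit_id.
apply: bo_trans step _; rewrite -[f :: srefl f x :: _]cat1s catA.
have := IHF (A ++ [:: f]) (srefl f x) rF (root_srefl rf rx).
by rewrite -!catA.
Qed.

(** The entries outside [F] are pushed to the right past the entries of [F], which stay as they are.
    So subsequences of complete sequences may be replaced by initial segments. *)
Lemma bo_subseq_front E F : all_roots E -> subseq F E ->
  exists H, braid_orbit E (F ++ H).
Proof.
elim: E F => [|a E IHE] F; first by move=> _ /eqP->; exists [::]; apply: BraidOrbit_id.
case/roots_cons=> ra rE.
case: F => [|f F]; first by exists (a :: E); apply: BraidOrbit_id.
rewrite /=; case: eqP => [->|_] sF; last first.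
  have [H oH] := IHE _ rE sF; exists (srefl_seq (rev (f :: F)) a :: H).
  have o1 := bo_catr [:: a] oH; apply: bo_trans o1 _.
  apply: (@bo_move_right [::]) => //.
  by have /roots_cat[] := bo_roots rE oH.
have [H oH] := IHE _ rE sF; exists H.
exact: (bo_catr [:: a] oH).
Qed.

End ExceptionalSequences.

(** * Heights and the affine Weyl group *)

Lemma exceptional_sum_eq0 (L : bilLattice) (E : seq L) (c : nat -> int) :
  exceptional E -> \sum_(i < size E) E`_i *~ c i = 0 ->
  forall i, (i < size E)%N -> c i = 0.
Proof.
elim: E c => [|a E IHE] c oE //; rewrite big_ord_recl /= => sum0.
have c0 : c 0%N = 0.
  apply/eqP; rewrite -oppr_eq0; apply/eqP.
  apply: (exceptional_free oE (x := \sum_(i < size E) E`_i *~ c i.+1)).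
    apply: (big_ind (spn E)) => [|x y|i _]; [exact: spn0|exact: spnD|].
    by apply/spnMz/spn_mem/mem_nth.
  by rewrite mulrNz; apply/eqP; rewrite -addr_eq0 addrC; apply/eqP.
case=> [//|i] /= lti; apply: (IHE (fun i => c i.+1)) => //.
  by case/exceptional_cons: oE.
by move: sum0; rewrite c0 mulr0z add0r.
Qed.

Section GCLattice.
Variable L : gcLattice.
Implicit Types (a b e f g x y z : L) (u v p A B F G : seq L) (k : int).
Notation E := (gc_seq L).
Notation n := (size E).

Lemma gc_roots : all_roots E.
Proof. exact/exceptional_roots/gc_exceptional. Qed.

Lemma simple_root e : e \in E -> is_root e.
Proof. exact: gc_roots. Qed.

Lemma coord_exists x : exists c : nat -> int, x = \sum_(i < n) E`_i *~ c i.
Proof.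
have [c xE] := gc_complete x.
exists (fun i => if insub i is Some j then c j else 0).
by rewrite xE; apply: eq_bigr => i _; rewrite valK.
Qed.

(** A function on all of [nat]; its values are meaningful below the rank only, hence the bounds in
    the lemmas on coordinates. *)
Definition coord x : nat -> int := sval (cid (coord_exists x)).

Lemma coordE x : x = \sum_(i < n) E`_i *~ coord x i.
Proof. exact: (svalP (cid (coord_exists x))). Qed.

Lemma coord_uniq x (c : nat -> int) i :
  x = \sum_(i < n) E`_i *~ c i -> (i < n)%N -> coord x i = c i.
Proof.
move=> xE lti; apply/eqP; rewrite -subr_eq0; apply/eqP.
apply: (exceptional_sum_eq0 (c := fun i => coord x i - c i)) lti.
  exact: gc_exceptional.
rewrite (eq_bigr (fun i : 'I_n => E`_i *~ coord x i - E`_i *~ c i)) => [|j _].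
  by rewrite sumrB -coordE -xE subrr.
by rewrite mulrzBr.
Qed.

Lemma coordD x y i : (i < n)%N -> coord (x + y) i = coord x i + coord y i.
Proof.
apply: (coord_uniq (c := fun i => coord x i + coord y i)).
rewrite {1}[x]coordE {1}[y]coordE -big_split /=.
by apply: eq_bigr => j _; rewrite mulrzDr.
Qed.

Lemma coordMz x k i : (i < n)%N -> coord (x *~ k) i = coord x i * k.
Proof.
apply: (coord_uniq (c := fun i => coord x i * k)).
rewrite {1}[x]coordE mulrz_suml.
by apply: eq_bigr => j _; rewrite mulrzA.
Qed.

Lemma coordN x i : (i < n)%N -> coord (- x) i = - coord x i.
Proof. by move=> lti; rewrite -[- x]mulrN1z coordMz // mulrN1. Qed.

Lemma coord0 i : (i < n)%N -> coord 0 i = 0.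
Proof. by move=> lti; rewrite -(mulr0z 0) coordMz // mulr0. Qed.

Lemma coord_nth i j : (i < n)%N -> (j < n)%N -> coord E`_j i = (i == j)%:R.
Proof.
move=> lti ltj; apply: (coord_uniq (c := fun i => (i == j)%:R)) => //.
rewrite (bigD1 (Ordinal ltj)) //= eqxx mulr1z big1 ?addr0 // => k.
by rewrite -val_eqE /= => /negPf->; rewrite mulr0z.
Qed.

Lemma coord_inj x y : (forall i, (i < n)%N -> coord x i = coord y i) -> x = y.
Proof.
by move=> eq_xy; rewrite [x]coordE [y]coordE; apply: eq_bigr => i _; rewrite eq_xy.
Qed.

Definition pos x := forall i, (i < n)%N -> 0 <= coord x i.

Lemma pos0 : pos 0.
Proof. by move=> i lti; rewrite coord0. Qed.

Lemma posD x y : pos x -> pos y -> pos (x + y).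
Proof. by move=> px py i lti; rewrite coordD // addr_ge0 ?px ?py. Qed.

Lemma posMz x k : 0 <= k -> pos x -> pos (x *~ k).
Proof. by move=> k0 px i lti; rewrite coordMz // mulr_ge0 ?px. Qed.

Lemma pos_simple e : e \in E -> pos e.
Proof.
by move=> eE i lti; rewrite -(nth_index 0 eE) coord_nth ?index_mem //; case: eqP.
Qed.

Lemma pos_anti x : pos x -> pos (- x) -> x = 0.
Proof.
move=> px nx; apply: coord_inj => i lti; rewrite coord0 //; apply/eqP.
by rewrite eq_le px // andbT -oppr_ge0 -coordN // nx.
Qed.

(** The pairing with a Weyl vector, since (e_i, e_i) / 2 = <e_i, e_i>. The vector itself need not
    exist in the lattice, for instance when the symmetrised form is degenerate. *)
Definition rho x : int := \sum_(i < n) coord x i * bform E`_i E`_i.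

Lemma rhoD x y : rho (x + y) = rho x + rho y.
Proof.
by rewrite -big_split; apply: eq_bigr => i _; rewrite coordD //= mulrDl.
Qed.

Lemma rhoMz x k : rho (x *~ k) = rho x * k.
Proof.
by rewrite big_distrl; apply: eq_bigr => i _; rewrite coordMz //= mulrAC.
Qed.

Lemma rhoN x : rho (- x) = - rho x.
Proof. by rewrite -mulrN1z rhoMz mulrN1. Qed.

Lemma rho0 : rho 0 = 0.
Proof. by rewrite -(mulr0z 0) rhoMz mulr0. Qed.

Lemma rhoB x y : rho (x - y) = rho x - rho y.
Proof. by rewrite rhoD rhoN. Qed.

Lemma rho_simple e : e \in E -> rho e = bform e e.
Proof.
move=> eE; rewrite /rho; have lte : (index e E < n)%N by rewrite index_mem.
rewrite (bigD1 (Ordinal lte)) //= big1 ?addr0 => [|i].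
  by rewrite -{1}(nth_index 0 eE) coord_nth // eqxx mul1r nth_index.
rewrite -val_eqE /= => /negPf nie; rewrite -{1}(nth_index 0 eE) coord_nth // nie.
exact: mul0r.
Qed.

Lemma nth_root i : (i < n)%N -> 0 < bform E`_i E`_i.
Proof. by move=> lti; apply/root_gt0/simple_root/mem_nth. Qed.

Lemma rho_ge0 x : pos x -> 0 <= rho x.
Proof.
by move=> px; apply: sumr_ge0 => i _; rewrite mulr_ge0 ?px // ltW ?nth_root.
Qed.

Lemma rho_eq0 x : pos x -> rho x = 0 -> x = 0.
Proof.
move=> px /eqP; rewrite psumr_eq0 => [|i _]; last first.
  by rewrite mulr_ge0 ?px // ltW ?nth_root.
move/allP=> x0; apply: coord_inj => i lti; rewrite coord0 //.
have := x0 (Ordinal lti) (mem_index_enum _).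
by rewrite mulf_eq0 /= (gt_eqF (nth_root lti)) orbF => /eqP.
Qed.

Lemma rho_gt0 x : pos x -> x != 0 -> 0 < rho x.
Proof.
move=> px x0; rewrite lt0r rho_ge0 // andbT.
by apply: contraNneq x0 => /(rho_eq0 px)->.
Qed.

Lemma root_nz a : is_root a -> a != 0.
Proof. by move/root_neq0; apply: contraNneq => ->; rewrite bform0l. Qed.

Lemma rho_srefl a x : rho (srefl a x) = rho x - rho a * root_coef a x.
Proof. by rewrite sreflE rhoB rhoMz. Qed.

(** The height of the coroot of [a]. *)
Definition coht a : int := (rho a %/ bform a a)%Z.

(* The affine reflection in the hyperplane (x, a) = rho a; the quotient coht a
   is exact for the roots used, by [good] below. *)
Definition arefl a x : L := srefl a x + a *~ coht a.

(** This divisibility is all that the affine calculus asks of a root. It holds for simple roots and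
    is inherited under reflections, so that it holds for real roots. *)
Definition good a := is_root a /\ exists k, rho a = k * bform a a.

Lemma good_root a : good a -> is_root a.
Proof. by case. Qed.

Lemma cohtE a : good a -> coht a * bform a a = rho a.
Proof. by case=> ra [k e]; rewrite /coht e (mulzK _ (root_neq0 ra)). Qed.

Lemma coht_uniq a k : is_root a -> k * bform a a = rho a -> coht a = k.
Proof.
move=> ra e; have ga : good a by split=> //; exists k.
by apply: (mulIf (root_neq0 ra)); rewrite cohtE.
Qed.

Lemma good_simple e : e \in E -> good e.
Proof.
by move=> eE; split; [apply: simple_root|exists 1; rewrite rho_simple // mul1r].
Qed.

Lemma coht_simple e : e \in E -> coht e = 1.
Proof.
by move=> eE; apply: coht_uniq; [apply: simple_root|rewrite rho_simple ?mul1r].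
Qed.

Lemma good_srefl b a : good b -> good a -> good (srefl b a).
Proof.
move=> [rb [l eb]] [ra [k ea]]; split; first exact: root_srefl.
have [m em] := root_coefr rb ra; exists (k - l * m).
rewrite rho_srefl bform_srefl // ea eb.
have -> : l * bform b b * root_coef b a = l * (m * bform a a) by rewrite -em; ring.
by ring.
Qed.

Lemma areflE a x : arefl a x = x - a *~ (root_coef a x - coht a).
Proof. by rewrite /arefl sreflE mulrzBr opprB addrA addrAC. Qed.

Lemma areflK a : good a -> involutive (arefl a).
Proof.
move=> [ra _] x; rewrite [LHS]areflE; set k := root_coef a x - coht a.
have -> : root_coef a (arefl a x) - coht a = - k.
  rewrite areflE -/k root_coefD // -mulrNz root_coefMz //.
  rewrite [root_coef a a](@root_coef_uniq _ _ _ 2) //; first by rewrite /k; ring.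
  by rewrite bform_symform.
by rewrite areflE -/k mulrNz opprK subrK.
Qed.

Lemma arefl_opp a x : good a -> arefl (- a) x = arefl a x.
Proof.
move=> ga; have ra := good_root ga; rewrite /arefl srefl_opp //; congr (_ + _).
rewrite (@coht_uniq _ (- coht a)) ?mulrNz ?mulNrz ?opprK //; first exact: root_opp.
by rewrite !bformE opprK mulNr cohtE // rhoN.
Qed.

Lemma arefl_conj a b x : good a -> good b ->
  arefl (srefl b a) (arefl b x) = arefl b (arefl a x).
Proof.
move=> ga gb; have ra := good_root ga; have rb := good_root gb.
have gba := good_srefl gb ga.
(* The affine function [root_coef a x - coht a], whose zeros form the mirror of [a], is carried by
   [arefl b] to that of s_b a. *)
have key : root_coef (srefl b a) (arefl b x) - coht (srefl b a) =
           root_coef a x - coht a.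
  apply: (mulIf (root_neq0 ra)); rewrite !mulrBl cohtE // root_coefE //.
  rewrite -{1 2}(bform_srefl a rb) cohtE // (root_coefE _ (good_root gba)).
  have -> : symform (arefl b x) (srefl b a) =
      symform (srefl b x) (srefl b a) + symform (srefl b a) b * coht b.
    by rewrite /arefl /symform !bformE; ring.
  rewrite symform_srefl // symform_srefl_self // rho_srefl.
  by rewrite -(cohtE gb) -(root_coefE a rb); ring.
rewrite (areflE (srefl b a)) key (areflE a) /arefl.
by rewrite sreflD // sreflN // sreflMz // addrAC.
Qed.

Definition arefl_seq A : L -> L := foldr (fun a w => arefl a \o w) id A.

Lemma arefl_seq_cat A B x : arefl_seq (A ++ B) x = arefl_seq A (arefl_seq B x).
Proof. by elim: A => //= a A ->. Qed.

Definition goods A := forall a, a \in A -> good a.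

Lemma goods_cons a A : goods (a :: A) <-> good a /\ goods A.
Proof.
split=> [gA|[ga gA] b].
  by split=> [|b bA]; apply: gA; rewrite inE ?eqxx ?bA ?orbT.
by rewrite inE => /predU1P[->|/gA].
Qed.

Lemma goods_rev A : goods A -> goods (rev A).
Proof. by move=> gA a; rewrite mem_rev; apply: gA. Qed.

Lemma goods_roots A : goods A -> all_roots A.
Proof. by move=> gA a /gA/good_root. Qed.

Lemma good_srefl_seq A a : goods A -> good a -> good (srefl_seq A a).
Proof.
by elim: A => //= b A IHA /goods_cons[gb gA] ga; apply: good_srefl => //; apply: IHA.
Qed.

Lemma arefl_seq_conj A a x : goods A -> good a ->
  arefl (srefl_seq A a) (arefl_seq A x) = arefl_seq A (arefl a x).
Proof.
elim: A => //= b A IHA /goods_cons[gb gA] ga.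
by rewrite arefl_conj ?IHA //; apply: good_srefl_seq.
Qed.

(** In the presence of a Weyl vector rho this is the classical rho - w(rho). *)
Definition displ A : L := arefl_seq A 0.

Lemma arefl_seqE A x : goods A -> arefl_seq A x = srefl_seq A x + displ A.
Proof.
rewrite /displ; elim: A => [|b A IHA] /=; first by rewrite addr0.
case/goods_cons=> gb gA; rewrite IHA // /arefl (sreflD _ _ (good_root gb)).
by rewrite -addrA.
Qed.

Lemma displ_cat A B : goods A -> displ (A ++ B) = srefl_seq A (displ B) + displ A.
Proof. by move=> gA; rewrite {1}/displ arefl_seq_cat arefl_seqE. Qed.

Lemma displ1 a : is_root a -> displ [:: a] = a *~ coht a.
Proof.
move=> ra; rewrite /displ /= /arefl.
by have := sreflMz 0 0 ra; rewrite !mulr0z => ->; rewrite add0r.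
Qed.

(** A further factor moves the displacement along the root s_A a, so the sign of that root decides
    whether the step goes up or down. *)
Lemma displ_rcons A a : goods A -> good a ->
  displ (rcons A a) = srefl_seq A a *~ coht a + displ A.
Proof.
move=> gA ga; rewrite -cats1 displ_cat // (displ1 (good_root ga)).
by rewrite srefl_seqMz //; apply: goods_roots.
Qed.

Lemma arefl_seq_srefl A B : goods A -> goods B -> arefl_seq A =1 arefl_seq B ->
  srefl_seq A =1 srefl_seq B.
Proof.
move=> gA gB eqAB x; apply: (addIr (displ A)).
by rewrite -arefl_seqE // eqAB arefl_seqE // /displ eqAB.
Qed.

Lemma arefl_seq_revK A : goods A -> cancel (arefl_seq A) (arefl_seq (rev A)).
Proof.
elim: A => //= a A IHA /goods_cons[ga gA] x.
by rewrite rev_cons -cats1 arefl_seq_cat /= areflK // IHA.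
Qed.

Lemma arefl_seqK A : goods A -> cancel (arefl_seq (rev A)) (arefl_seq A).
Proof. by move=> gA x; have := arefl_seq_revK (goods_rev gA) x; rewrite revK. Qed.

Definition word u := all (fun e => e \in E) u.

Lemma word_cat u v : word (u ++ v) = word u && word v.
Proof. exact: all_cat. Qed.

Lemma word_rcons u e : word (rcons u e) = (e \in E) && word u.
Proof. exact: all_rcons. Qed.

Lemma word_goods u : word u -> goods u.
Proof. by move/allP=> uE a /uE/good_simple. Qed.

(** Length is measured in the affine group; that the linear action carries the same information
    follows only from the positivity proved below. *)
Definition reduced u := word u /\
  forall v, word v -> arefl_seq v =1 arefl_seq u -> (size u <= size v)%N.

Lemma reduced_exists u : word u -> exists v, reduced v /\ arefl_seq v =1 arefl_seq u.
Proof.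
have [m] := ubnP (size u); elim: m u => // m IHm u; rewrite ltnS => le_um wu.
case: (pselect (reduced u)) => [ru|nru]; first by exists u.
have [v [wv eq_vu lt_vu]] : exists v,
    [/\ word v, arefl_seq v =1 arefl_seq u & (size v < size u)%N].
  apply: contrapT => nv; apply: nru; split=> // v wv eq_vu; rewrite leqNgt.
  by apply/negP => lt_vu; apply: nv; exists v.
have [v' [rv' eq_v']] := IHm v (leq_trans lt_vu le_um) wv.
by exists v'; split=> // x; rewrite eq_v'.
Qed.

Lemma simple_orth e f : e \in E -> f \in E -> e != f -> bform e f <= 0.
Proof.
move=> eE fE; rewrite -(nth_index 0 eE) -(nth_index 0 fE) => ne_ef.
apply: gc_orthogonal; rewrite ?index_mem // => eq_ef.
by rewrite eq_ef eqxx in ne_ef.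
Qed.

Lemma simple_sorth e f : e \in E -> f \in E -> e != f -> symform e f <= 0.
Proof.
move=> eE fE ef; have fe := ef; rewrite eq_sym in fe.
by have := simple_orth eE fE ef; have := simple_orth fE eE fe; rewrite /symform; lia.
Qed.

(* A Vieta argument: the two coefficients of e that x and s_e x have multiply
   to a number of known sign. *)
Lemma rank2_flip e f x (al be : nat) :
  e \in E -> f \in E -> e != f -> is_root x ->
  x = e *~ al + f *~ be ->
  (bform x x = bform e e \/ bform x x = bform f f) ->
  (exists al' : nat, srefl e x = e *~ al' + f *~ be) \/ x = e.
Proof.
move=> eE fE ef rx ex nx; have re := simple_root eE.
have [k eqk] : exists k : nat, symform f e = - k%:Z * bform e e.
  have := simple_sorth eE fE ef; rewrite symformC -(root_coefE f re).
  rewrite pmulr_lle0 ?root_gt0 //; case: (root_coef e f) => m.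
    by rewrite lez_nat leqn0 => /eqP->; exists 0%N; rewrite !mul0r.
  by exists m.+1; rewrite NegzE.
have se : srefl e x = e *~ (k%:Z * be%:Z - al%:Z) + f *~ be.
  rewrite sreflE (@root_coef_uniq _ _ _ (2 * al%:Z - k%:Z * be%:Z)) //.
    by rewrite {1}ex addrAC -mulrzBr; congr (e *~ _ + _); ring.
  by rewrite ex /symform !bformE; move: eqk; rewrite /symform; nia.
case: (lerP al%:Z (k%:Z * be%:Z)) => le_al.
  by left; exists (k * be - al)%N; rewrite se -subzn ?PoszM // -lez_nat PoszM.
right.
have d0 := root_gt0 re; have df0 := root_gt0 (simple_root fE).
have nxE : bform x x = bform e e * al%:Z * (al%:Z - k%:Z * be%:Z)
                       + bform f f * be%:Z * be%:Z.
  by rewrite {1 2}ex !bformE; move: eqk; rewrite /symform; nia.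
(* Both [al] and al - k be are at least 1; with [be] nonzero, <x, x> would exceed <e, e> and <f, f>
   at once. *)
have be0 : be = 0%N.
  case: be {ex se} nxE le_al nx => // be nxE le_al nx.
  have kb : 0 <= k%:Z * be.+1%:Z by apply: mulr_ge0.
  have le1 : bform e e <= bform e e * (al%:Z * (al%:Z - k%:Z * be.+1%:Z)).
    by rewrite ler_pMr //; apply: mulr_ege1; lia.
  have le2 : bform f f <= bform f f * (be.+1%:Z * be.+1%:Z).
    by rewrite ler_pMr //; apply: mulr_ege1.
  have le4 : bform f f * (be.+1%:Z * be.+1%:Z) > 0 by apply: lt_le_trans le2.
  rewrite mulrA in le1; rewrite mulrA in le2; rewrite mulrA in le4.
  case: nx; first by lia.
  move=> nf.
  by lia.
have xal : x = e *~ al by rewrite ex be0 mulr0z addr0.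
(* As x = al e is a root, al^2 <e, e> divides al <e, e>, which makes [al] a unit. *)
have [m em] := root_dvdl e rx.
suff -> : x = e *~ 1 by rewrite mulr1z.
rewrite xal; congr (_ *~ _).
have: bform e e * al%:Z * (1 - m * al%:Z) = 0.
  by move: em; rewrite xal !bformE; nia.
move/eqP; rewrite !mulf_eq0 (gt_eqF d0) /= => /orP[/eqP al0|/eqP mal].
  by move: (root_nz rx); rewrite xal al0 mulr0z eqxx.
have : al%:Z \is a GRing.unit by apply/unitrP; exists m; rewrite mulrC; lia.
by case: (al) => [|[|al']].
Qed.

(** Reading the word from the right, the image of [e] stays in the cone of [e] and [f] until a
    letter meets its own root; at that place the exchange condition applies. *)
Lemma rank2_word e f p : e \in E -> f \in E -> e != f ->
  all (fun g => (g == e) || (g == f)) p ->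
  (exists al be : nat, srefl_seq p e = e *~ al + f *~ be) \/
  (exists p1 g p2, p = p1 ++ g :: p2 /\ srefl_seq p2 e = g).
Proof.
move=> eE fE ef; have re := simple_root eE.
elim: p => [_|g p IHp /= /andP[ge pe]].
  by left; exists 1%N, 0%N; rewrite mulr1z mulr0z addr0.
have [[al [be ex]]|[p1 [g' [p2 [-> eg]]]]] := IHp pe; last first.
  by right; exists (g :: p1), g', p2.
have rp : all_roots p.
  by move=> h /(allP pe)/orP[]/eqP->; apply: simple_root.
have rx := root_srefl_seq rp re.
have nx := bform_srefl_seq e rp.
case/orP: ge => /eqP ->.
  have [[al' ->]|ee] := rank2_flip eE fE ef rx ex (or_introl nx).
    by left; exists al', be.
  by right; exists [::], e, p.
rewrite addrC in ex; rewrite eq_sym in ef.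
have [[al' ->]|ee] := rank2_flip fE eE ef rx ex (or_intror nx).
  by left; exists al, al'; rewrite addrC.
by right; exists [::], f, p.
Qed.

Lemma word_exchange u1 g u2 e : word (u1 ++ g :: u2) -> e \in E ->
  srefl_seq u2 e = g ->
  arefl_seq (rcons (u1 ++ g :: u2) e) =1 arefl_seq (u1 ++ u2).
Proof.
rewrite word_cat /= => /and3P[_ _ w2] eE <- x.
have ge := good_simple eE; have g2 := word_goods w2.
by rewrite -cats1 !arefl_seq_cat /= arefl_seq_conj // areflK.
Qed.

(* Deodhar's lemma, by the reduction to rank two. *)
Lemma reduced_pos u e : reduced u -> e \in E ->
  (forall v, word v -> arefl_seq v =1 arefl_seq (rcons u e) -> (size u <= size v)%N) ->
  pos (srefl_seq u e).
Proof.
have [m] := ubnP (size u); elim: m u e => // m IHm u e.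
case/lastP: u => [|u0 f]; first by move=> _ _ eE _; apply: pos_simple.
rewrite {1}size_rcons ltnS => lt_um ru eE longer; set u := rcons u0 f in ru longer *.
have [wu mu] := ru; have [w0 fE] : word u0 /\ f \in E.
  by move: wu; rewrite word_rcons => /andP[].
have ef : e != f.
  apply/eqP => ef; have /(longer _ w0) : arefl_seq u0 =1 arefl_seq (rcons u e).
    move=> x; rewrite /u -!cats1 -catA !arefl_seq_cat /= ef areflK //.
    exact: good_simple.
  by rewrite /u size_rcons ltnn.
(* Write u = v p with additive lengths, [p] in the dihedral subgroup of [e] and [f], and [v] as
   short as possible. *)
pose cand (j : nat) := exists v p, [/\ size v = j, word v,
  all (fun g => (g == e) || (g == f)) p, arefl_seq (v ++ p) =1 arefl_seq u
  & (size v + size p = size u)%N].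
have cand_last : cand (size u0).
  exists u0, [:: f]; split=> //=; first by rewrite eqxx orbT.
    by rewrite cats1.
  by rewrite addn1 size_rcons.
have [j [v [p [sv wv pe evp svp]]] minj] : exists2 j, cand j & forall i, cand i -> (j <= i)%N.
  have exj : exists j, `[< cand j >] by exists (size u0); apply/asboolP.
  exists (ex_minn exj); case: ex_minnP => j /asboolP // _ minj i ci.
  by apply: minj; apply/asboolP.
have ltv : (size v < m)%N by rewrite sv; apply: leq_ltn_trans (minj _ cand_last) lt_um.
have wp : word p by apply/allP => g /(allP pe)/orP[]/eqP->.
have rv : reduced v.
  split=> // v' wv' ev'; rewrite -(leq_add2r (size p)) svp -size_cat.
  apply: mu => [|x]; first by rewrite word_cat wv'.
  by rewrite arefl_seq_cat ev' -arefl_seq_cat evp.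
(* A descent of [v] at [e] or [f] could be shifted into [p], against the minimality of [v]; so the
   induction hypothesis applies to [v] and both letters. *)
have posv h : (h == e) || (h == f) -> pos (srefl_seq v h).
  move=> hef; have hE : h \in E by case/orP: hef => /eqP->.
  apply: IHm => // v' wv' ev'; rewrite leqNgt; apply/negP => lt_v'.
  have ehp x : arefl_seq (v' ++ h :: p) x = arefl_seq u x.
    rewrite arefl_seq_cat ev' -cats1 arefl_seq_cat /= areflK; last exact: good_simple.
    by rewrite -arefl_seq_cat evp.
  suff: cand (size v') by move/minj; rewrite -sv leqNgt lt_v'.
  exists v', (h :: p); split=> //=; first by rewrite hef.
  apply/eqP; rewrite eqn_leq addnS -addSn -{1}svp leq_add2r lt_v' /=.
  rewrite addSn -addnS -[(size p).+1]/(size (h :: p)) -size_cat; apply: mu ehp.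
  by rewrite word_cat wv' /= hE.
have suv x : srefl_seq u x = srefl_seq v (srefl_seq p x).
  rewrite -srefl_seq_cat; apply/esym; apply: arefl_seq_srefl evp _; last exact: word_goods.
  by apply: word_goods; rewrite word_cat wv.
rewrite suv; have [[al [be ->]]|[p1 [g [p2 [ep eg]]]]] := rank2_word eE fE ef pe.
  have rv' := goods_roots (word_goods wv).
  rewrite srefl_seqD // !srefl_seqMz //.
  by apply: posD; apply: posMz => //; apply: posv; rewrite eqxx ?orbT.
(* Here the exchange produces a word for u e that is shorter than [u], which the hypothesis
   excludes. *)
have wp' : word (v ++ p1 ++ p2).
  by move: wp; rewrite ep !word_cat wv /= => /and3P[-> _ ->].
have /(longer _ wp') : arefl_seq (v ++ p1 ++ p2) =1 arefl_seq (rcons u e).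
  move=> x; rewrite arefl_seq_cat -(word_exchange _ eE eg); last by rewrite -ep.
  by rewrite -ep -!cats1 !arefl_seq_cat -evp arefl_seq_cat.
by rewrite -svp ep !size_cat /= !addnS ltnn.
Qed.

(** Either [e] does not shorten the reduced word and [reduced_pos] applies, or a shorter word v' for
    u e satisfies that criterion and s_u e = - s_{v'} e. *)
Lemma word_signs u e : word u -> e \in E ->
  pos (srefl_seq u e) \/ pos (- srefl_seq u e).
Proof.
move=> wu eE; have [v [[wv mv] evu]] := reduced_exists wu.
have suv := arefl_seq_srefl (word_goods wv) (word_goods wu) evu.
rewrite -suv; case: (pselect (forall v', word v' ->
    arefl_seq v' =1 arefl_seq (rcons v e) -> (size v <= size v')%N)) => [lv|nlv].
  by left; apply: reduced_pos.
have [v' [rv' ev' ltv']] : exists v',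
    [/\ reduced v', arefl_seq v' =1 arefl_seq (rcons v e) & (size v' < size v)%N].
  have [v1 [wv1 ev1 lt1]] : exists v1,
      [/\ word v1, arefl_seq v1 =1 arefl_seq (rcons v e) & (size v1 < size v)%N].
    apply: contrapT => nv; apply: nlv => v1 wv1 ev1; rewrite leqNgt.
    by apply/negP => lt1; apply: nv; exists v1.
  have [v2 [rv2 ev2]] := reduced_exists wv1; exists v2; split=> //.
    by move=> x; rewrite ev2.
  by apply: leq_ltn_trans lt1; case: rv2 => _; apply.
have [wv' mv'] := rv'.
have ev'e x : arefl_seq (rcons v' e) x = arefl_seq v x.
  rewrite -cats1 arefl_seq_cat ev' -cats1 arefl_seq_cat /= areflK //.
  exact: good_simple.
have p' : pos (srefl_seq v' e).
  apply: reduced_pos => // v2 wv2 ev2; apply: leq_trans (ltnW ltv') _.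
  by apply: mv => // x; rewrite ev2 ev'e.
right; rewrite -srefl_seqN; last exact/goods_roots/word_goods.
rewrite -(srefl_self (simple_root eE)).
suff <- : srefl_seq v' e = srefl_seq v (srefl e e) by [].
have := @arefl_seq_srefl v' (rcons v e) (word_goods wv') _ ev' e.
rewrite -cats1 srefl_seq_cat; apply; apply: word_goods.
by rewrite cats1 word_rcons eE.
Qed.

(** Along a reduced word the displacement is a sum of positive roots, one for each letter, because
    simple roots have [coht] equal to 1. *)
Lemma displ_pos u : word u -> pos (displ u).
Proof.
have [m] := ubnP (size u); elim: m u => // m IHm u; rewrite ltnS => le_um wu.
have [v [[wv mv] evu]] := reduced_exists wu.
have : (size v <= m)%N by apply: leq_trans le_um; apply: mv.
rewrite /displ -evu -/(displ v) {u evu le_um wu}.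
case/lastP: v wv mv => [|v e] wv mv lt_vm; first exact: pos0.
have [wv' eE] : word v /\ e \in E by move: wv; rewrite word_rcons => /andP[].
rewrite size_rcons in lt_vm.
rewrite displ_rcons; [|exact: word_goods|exact: good_simple].
apply: posD; last exact: IHm.
rewrite coht_simple // mulr1z; apply: reduced_pos => //; last first.
  by move=> v' wv'' /(mv _ wv''); rewrite size_rcons => /ltnW.
split=> // v' wv'' ev'; rewrite -ltnS -(size_rcons v e) -(size_rcons v' e); apply: mv.
  by rewrite word_rcons eE.
by move=> x; rewrite -!cats1 !arefl_seq_cat ev'.
Qed.

End GCLattice.

(** * Hurwitz transitivity *)

Section RealRoots.
Variable L : gcLattice.
Implicit Types (a b e f g x y z : L) (u v p A B F G J P S : seq L) (k : int).
Notation E := (gc_seq L).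
Notation n := (size E).

Lemma word_roots u : word u -> all_roots u.
Proof. by move/word_goods/goods_roots. Qed.

Lemma word_rev u : word u -> word (rev u).
Proof. by rewrite /word all_rev. Qed.

Lemma weylP (w : L -> L) : weyl w <-> exists2 u, word u & w = srefl_seq u.
Proof.
split=> [|[u wu ->]].
  move/(_ [set w | exists2 u, word u & w = srefl_seq u]); apply; split=> [|_ [e eE <-]]; last first.
    by exists [:: e]; [rewrite /word /= andbT|].
  split.
  - move=> _ [u wu ->]; have ru := word_roots wu.
    split=> [x y||x y]; [exact: srefl_seqD| |exact: symform_srefl_seq].
    by exists (srefl_seq (rev u)); [apply: srefl_seq_revK|apply: srefl_seqK].
  - by exists [::].
  - move=> _ _ [u wu ->] [v wv ->]; exists (u ++ v); first by rewrite word_cat wu.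
    by apply/funext => x; rewrite srefl_seq_cat.
  - move=> _ v [u wu ->] uK vK; exists (rev u); first exact: word_rev.
    apply/funext => x; rewrite -{2}(vK x) srefl_seq_revK //; exact: word_roots.
move=> H [[_ H1 Hm _] HE]; elim: u wu => //= e u IHu /andP[eE /IHu Hu].
by apply: Hm => //; apply: HE; exists e.
Qed.

Lemma real_rootP x : real_root x <-> exists u e, [/\ word u, e \in E & x = srefl_seq u e].
Proof.
split=> [[w [e [/weylP[u wu ->] eE ->]]]|[u [e [wu eE ->]]]]; first by exists u, e.
by exists (srefl_seq u), e; split=> //; apply/weylP; exists u.
Qed.

Lemma real_simple e : e \in E -> real_root e.
Proof. by move=> eE; apply/real_rootP; exists [::], e. Qed.

Lemma real_good a : real_root a -> good a.
Proof.
case/real_rootP=> u [e [wu eE ->]].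
by apply: good_srefl_seq; [apply: word_goods|apply: good_simple].
Qed.

Lemma real_is_root a : real_root a -> is_root a.
Proof. by move/real_good/good_root. Qed.

Lemma real_signs a : real_root a -> pos a \/ pos (- a).
Proof. by case/real_rootP=> u [e [wu eE ->]]; apply: word_signs. Qed.

Lemma real_srefl a b : real_root a -> real_root b -> real_root (srefl a b).
Proof.
case/real_rootP=> u [e [wu eE ->]] /real_rootP[v [f [wv fE ->]]].
apply/real_rootP; exists (u ++ e :: rev u ++ v), f; split=> //.
  by rewrite word_cat wu /= eE word_cat word_rev.
have ru := word_roots wu; rewrite srefl_seq_cat /= srefl_seq_cat -srefl_seq_conj //.
  by rewrite srefl_seqK.
exact: simple_root.
Qed.

Lemma real_opp a : real_root a -> real_root (- a).
Proof.
by move=> ra; rewrite -srefl_self; [apply: real_srefl|apply: real_is_root].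
Qed.

Definition reals A := forall a, a \in A -> real_root a.

Lemma reals_cons a A : reals (a :: A) <-> real_root a /\ reals A.
Proof.
split=> [gA|[ga gA] b].
  by split=> [|b bA]; apply: gA; rewrite inE ?eqxx ?bA ?orbT.
by rewrite inE => /predU1P[->|/gA].
Qed.

Lemma reals_cat A B : reals (A ++ B) <-> reals A /\ reals B.
Proof.
split=> [gA|[gA gB] b].
  by split=> b bA; apply: gA; rewrite mem_cat bA ?orbT.
by rewrite mem_cat => /orP[/gA|/gB].
Qed.

Lemma reals_simple : reals E.
Proof. by move=> e; apply: real_simple. Qed.

Lemma reals_rev A : reals A -> reals (rev A).
Proof. by move=> gA a; rewrite mem_rev; apply: gA. Qed.

Lemma reals_goods A : reals A -> goods A.
Proof. by move=> rA a /rA/real_good. Qed.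

Lemma reals_roots A : reals A -> all_roots A.
Proof. by move=> rA a /rA/real_is_root. Qed.

Lemma real_srefl_seq A b : reals A -> real_root b -> real_root (srefl_seq A b).
Proof.
by elim: A => //= a A IHA /reals_cons[ra /IHA rA] /rA; apply: real_srefl.
Qed.

Lemma reals_bo A B : reals A -> braid_orbit A B -> reals B.
Proof.
move=> rA; move: B; apply: (@bo_ind L A reals) => // [P x y S _|P x y S _|P x S].
- move/reals_cat=> [rP /reals_cons[rx /reals_cons[ry rS]]].
  apply/reals_cat; split=> //; apply/reals_cons; split=> //.
  by apply/reals_cons; split=> //; apply: real_srefl.
- move/reals_cat=> [rP /reals_cons[rx /reals_cons[ry rS]]].
  apply/reals_cat; split=> //; apply/reals_cons; split; first exact: real_srefl.
  exact/reals_cons.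
- move/reals_cat=> [rP /reals_cons[rx rS]].
  by apply/reals_cat; split=> //; apply/reals_cons; split=> //; apply: real_opp.
Qed.

Lemma reals_word A : reals A -> exists2 u, word u & arefl_seq u =1 arefl_seq A.
Proof.
elim: A => [|a A IHA]; first by exists [::].
case/reals_cons=> /real_rootP[u [e [wu eE ea]]] /IHA[v wv ev].
exists (u ++ e :: rev u ++ v) => [|x].
  by rewrite word_cat wu /= eE word_cat word_rev.
have gu := word_goods wu.
rewrite arefl_seq_cat /= arefl_seq_cat -arefl_seq_conj //; last exact: good_simple.
by rewrite -ea ev arefl_seqK.
Qed.

Lemma displ_pos_real A : reals A -> pos (displ A).
Proof.
by move=> /reals_word[u wu eu]; rewrite /displ -eu; apply: displ_pos.
Qed.

(* An affine map of the group with trivial linear part is a translation by a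
   vector which is positive together with its opposite. *)
Lemma affine_faithful A B : reals A -> reals B ->
  srefl_seq A =1 srefl_seq B -> arefl_seq A =1 arefl_seq B.
Proof.
move=> rA rB eAB; pose U := A ++ rev B.
have rU : reals U by apply/reals_cat; split=> //; apply: reals_rev.
have gU := reals_goods rU; have gB := reals_goods rB.
have sU x : srefl_seq U x = x.
  by rewrite srefl_seq_cat eAB srefl_seqK //; apply: reals_roots.
have aU x : arefl_seq U x = x + displ U by rewrite arefl_seqE // sU.
have dU : displ (rev U) = - displ U.
  apply/eqP; rewrite -addr_eq0 -[X in _ == X](arefl_seq_revK gU) aU add0r addrC.
  rewrite [X in _ == X]arefl_seqE; last exact: goods_rev.
  by rewrite -[X in srefl_seq _ X]sU srefl_seq_revK //; apply: goods_roots.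
have dU0 : displ U = 0.
  by apply: pos_anti; [|rewrite -dU]; apply: displ_pos_real => //; apply: reals_rev.
move=> x; have := aU (arefl_seq B x).
by rewrite dU0 addr0 /U arefl_seq_cat arefl_seq_revK.
Qed.

(** There is no torsion, so the two multiples may be compared after multiplication by <a, a> k1 k2,
    where proportionality can be used. *)
Lemma srefl_proportional a b k1 k2 : is_root a -> is_root b -> k1 != 0 -> k2 != 0 ->
  a *~ k1 = b *~ k2 -> srefl a =1 srefl b.
Proof.
move=> ra rb k1n k2n eab x; rewrite !sreflE; congr (x - _).
apply/eqP; rewrite -subr_eq0; apply/eqP.
have d0 := root_neq0 ra.
apply: (@mulrz_inj_lattice _ _ (bform a a * k1 * k2)); first by rewrite !mulf_neq0.
have e1 : root_coef a x * bform a a * k1 = root_coef b x * bform b b * k2.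
  rewrite !root_coefE // /symform.
  by rewrite !mulrDl; congr (_ + _); [rewrite -!bformMzr eab|rewrite -!bformMzl eab].
have e2 : bform a a * k1 * k1 = bform b b * k2 * k2.
  by rewrite -bformMzl -bformMzr eab !bformE.
rewrite mulrzBl -!mulrzA.
have -> : root_coef a x * (bform a a * k1 * k2) = root_coef b x * (bform b b * k2 * k2).
  by rewrite !mulrA e1.
rewrite -e2 ; have -> : root_coef b x * (bform a a * k1 * k2) =
  k2 * (root_coef b x * bform a a * k1) by ring.
have -> : root_coef b x * (bform a a * k1 * k1) =
  k1 * (root_coef b x * bform a a * k1) by ring.
by rewrite !mulrzA eab subrr.
Qed.

Lemma displ2 a b : good a -> good b ->
  displ [:: a; b] = a *~ (coht a - coht b * root_coef a b) + b *~ coht b.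
Proof.
move=> ga gb; rewrite -[[:: a; b]]/(rcons [:: a] b) displ_rcons //; last first.
  by apply/goods_cons.
rewrite displ1 /=; last exact: good_root.
rewrite sreflE mulrzBl -mulrzA mulrzBr [coht b * _]mulrC.
by rewrite addrC addrA [in RHS]addrAC.
Qed.

(* If neither move lowers the peak, the two inequalities combine with the
   positivity of the displacements of s_a s_b and of s_b s_a to a contradiction. *)
Lemma peak P a b : reals P -> real_root a -> real_root b ->
  pos a -> pos b -> pos (srefl_seq P a) -> pos (- srefl_seq (rcons P a) b) ->
  ~ (srefl a =1 srefl b) ->
  rho (displ (rcons P b)) < rho (displ (rcons P a)) \/
  rho (displ (rcons P (srefl a b))) < rho (displ (rcons P a)).
Proof.
move=> rP ra rb pa pb pPa nPb nab; apply: contrapT => nlow.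
have [ga gb] := (real_good ra, real_good rb); have gP := reals_goods rP.
have [ra' rb'] := (good_root ga, good_root gb).
have rP' := goods_roots gP.
rewrite -cats1 srefl_seq_cat /= in nPb.
have rab : real_root (srefl a b) by apply: real_srefl.
have gab := real_good rab.
have nz x : real_root x -> x != 0 by move/real_is_root/root_nz.
have p0 : 0 < rho a by apply: rho_gt0 => //; apply: nz.
have q0 : 0 < rho b by apply: rho_gt0 => //; apply: nz.
have A0 : 0 < rho (srefl_seq P a).
  by apply: rho_gt0 => //; apply: nz; apply: real_srefl_seq.
have B0 : 0 < - rho (srefl_seq P (srefl a b)).
  by rewrite -rhoN; apply: rho_gt0 => //; rewrite oppr_eq0; apply: nz; apply: real_srefl_seq.
have [da0 db0] := (root_gt0 ra', root_gt0 rb').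
have ca0 : 0 < coht a by rewrite -(pmulr_lgt0 _ da0) cohtE.
have cb0 : 0 < coht b by rewrite -(pmulr_lgt0 _ db0) cohtE.
have pD x y : real_root x -> real_root y -> pos (displ [:: x; y]).
  by move=> rx ry; apply: displ_pos_real => z; rewrite !inE => /orP[]/eqP->.
have pD1 := pD a b ra rb; have pD2 := pD b a rb ra.
have cc : coht (srefl a b) = coht b - coht a * root_coef b a.
  apply: coht_uniq; first exact: good_root.
  rewrite bform_srefl // rho_srefl -!cohtE // mulrBl -!mulrA root_coefE // symformC.
  by rewrite -(root_coefE b ra'); ring.
have Pb : rho (srefl_seq P b) =
    rho (srefl_seq P (srefl a b)) + rho (srefl_seq P a) * root_coef a b.
  by rewrite -rhoMz -srefl_seqMz // -rhoD -srefl_seqD // sreflE subrK.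
move: nlow; rewrite !displ_rcons // !rhoD !rhoMz !ltrD2r cc Pb.
set A := rho (srefl_seq P a) in A0 *; set B := rho (srefl_seq P _) in B0 *.
rewrite displ2 // in pD1; rewrite displ2 // in pD2.
set r := root_coef a b in pD1 *; set r' := root_coef b a in pD2 *.
set ca := coht a in ca0 pD1 pD2 *; set cb := coht b in cb0 pD1 pD2 *.
move=> nlow.
have h1 : A * ca <= (B + A * r) * cb by rewrite leNgt; apply/negP => h; apply: nlow; left.
have h2 : A * ca <= B * (cb - ca * r') by rewrite leNgt; apply/negP => h; apply: nlow; right.
have g1 := rho_ge0 pD1; have g2 := rho_ge0 pD2.
have g10 : rho (a *~ (ca - cb * r) + b *~ cb) = 0.
  apply/eqP; rewrite eq_le g1 andbT.
  have k1 : A * (ca - cb * r) - B * cb <= 0 by lia.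
  have k2 : A * ca - B * (cb - ca * r') <= 0 by lia.
  move: g1 g2; rewrite !rhoD !rhoMz.
  set p := rho a in p0 *; set q := rho b in q0 *; move=> g1 g2.
  have m1 : p * ca * (A * (ca - cb * r) - B * cb) <= 0 by apply: mulr_ge0_le0 => //; apply/ltW/mulr_gt0.
  have m2 : q * cb * (A * ca - B * (cb - ca * r')) <= 0 by apply: mulr_ge0_le0 => //; apply/ltW/mulr_gt0.
  rewrite -(pmulr_rle0 _ (mulr_gt0 ca0 A0)).
  have m3 : 0 <= cb * (- B) * (q * (cb - ca * r') + p * ca) by apply: mulr_ge0 => //; apply/ltW/mulr_gt0.
  (* On the right every summand is nonpositive, so the height of the displacement of s_a s_b,
     multiplied by a positive number, is nonpositive. *)
  have -> : ca * A * (p * (ca - cb * r) + q * cb) =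
     p * ca * (A * (ca - cb * r) - B * cb) + q * cb * (A * ca - B * (cb - ca * r'))
     - cb * (- B) * (q * (cb - ca * r') + p * ca) by ring.
  by move: m1 m2 m3; lia.
(* A positive vector of height 0 vanishes; a vanishing displacement makes [a] and [b] proportional
   and their reflections equal. *)
have D0 := rho_eq0 pD1 g10.
have eab : a *~ - (ca - cb * r) = b *~ cb.
  by apply/eqP; rewrite mulrNz eq_sym -addr_eq0 addrC; apply/eqP.
have m0 : - (ca - cb * r) != 0.
  apply/eqP => m0; rewrite m0 mulr0z in eab.
  have := mulrz_inj_lattice (lt0r_neq0 cb0) (esym eab).
  by apply/eqP/nz.
by apply: nab; apply: srefl_proportional eab => //; apply: lt0r_neq0.
Qed.

(** The accumulator is the affine map of the prefix already read, so the summands are the heights of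
    the displacements of the nonempty prefixes. *)
Fixpoint potf (w : L -> L) A : int :=
  if A is a :: A' then rho (w (arefl a 0)) + potf (w \o arefl a) A' else 0.

Definition pot A := potf id A.

Lemma potf_ext (w w' : L -> L) A : w =1 w' -> potf w A = potf w' A.
Proof.
elim: A w w' => //= a A IHA w w' eww; rewrite eww; congr (_ + _).
by apply: IHA => x /=; rewrite eww.
Qed.

Lemma potf_cat w A B : potf w (A ++ B) = potf w A + potf (w \o arefl_seq A) B.
Proof.
elim: A w => [|a A IHA] w /=; first by rewrite add0r; apply: potf_ext.
by rewrite IHA addrA; congr (_ + _); apply: potf_ext.
Qed.

(** A Hurwitz move changes a single partial displacement, the one between the two factors. *)
Lemma pot_swap P a b a' b' S : arefl_seq [:: a; b] =1 arefl_seq [:: a'; b'] ->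
  pot (P ++ a :: b :: S) - rho (displ (rcons P a)) =
  pot (P ++ a' :: b' :: S) - rho (displ (rcons P a')).
Proof.
move=> eab; rewrite /pot !potf_cat /= -!cats1 /displ !arefl_seq_cat /=.
have /= -> := eab 0.
have -> : potf (((id \o arefl_seq P) \o arefl a) \o arefl b) S =
    potf (((id \o arefl_seq P) \o arefl a') \o arefl b') S.
  by apply: potf_ext => x /=; have /= -> := eab x.
by ring.
Qed.

Lemma pot_ge0 A : reals A -> 0 <= pot A.
Proof.
elim/last_ind: A => [|A a IHA]; first by [].
rewrite -cats1 => /reals_cat[rA ra].
rewrite /pot potf_cat addr_ge0 //= ?IHA // addr0.
have := @displ_pos_real (A ++ [:: a]).
by rewrite /displ arefl_seq_cat /=; move=> H; apply/rho_ge0/H/reals_cat.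
Qed.

Definition posabs a := if `[< pos a >] then a else - a.

Lemma pos_posabs a : real_root a -> pos (posabs a).
Proof. by rewrite /posabs => /real_signs[]; case: asboolP. Qed.

Lemma bo_posabs F A : braid_orbit F A -> braid_orbit F (map posabs A).
Proof. exact: bo_sgn. Qed.

Lemma potf_posabs w A : goods A -> potf w (map posabs A) = potf w A.
Proof.
elim: A w => //= a A IHA w /goods_cons[ga gA]; rewrite IHA //.
have e x : arefl (posabs a) x = arefl a x.
  by rewrite /posabs; case: asboolP => // _; rewrite arefl_opp.
by rewrite e; congr (_ + _); apply: potf_ext => x /=; rewrite e.
Qed.

Lemma coord_srefl_seq_notin J e x : word J -> e \in E -> e \notin J ->
  coord (srefl_seq J x) (index e E) = coord x (index e E).
Proof.
move=> wJ eE; have lte : (index e E < n)%N by rewrite index_mem.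
elim: J wJ => //= g J IHJ /andP[gE wJ]; rewrite inE negb_or => /andP[eg eJ].
rewrite sreflE coordD // coordN // coordMz // IHJ //.
rewrite -{1}(nth_index 0 gE) coord_nth ?index_mem //.
suff /negPf-> : index e E != index g E by rewrite mul0r subr0.
by apply: contraNneq eg => eq_i; rewrite -(nth_index 0 eE) eq_i nth_index.
Qed.

(** The reflection in [e] alters the [e]-coordinate only, so a positive root that it makes negative
    is a multiple of [e]; being a root, it is [e] itself. *)
Lemma real_flip e x : e \in E -> real_root x -> pos x -> pos (- srefl e x) -> x = e.
Proof.
move=> eE rx px nx; have rx' := real_is_root rx.
have lte : (index e E < n)%N by rewrite index_mem.
have xe : x = e *~ coord x (index e E).
  apply: coord_inj => i lti; rewrite coordMz // -{1}(nth_index 0 eE) coord_nth //.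
  case: eqP => [->|/eqP nie]; rewrite ?mul1r ?mul0r //.
  apply/eqP; rewrite eq_le px // andbT.
  have := nx i lti; rewrite coordN // sreflE coordD // coordN // coordMz //.
  by rewrite -{1}(nth_index 0 eE) coord_nth // (negPf nie) mul0r subr0 oppr_ge0.
have c0 := px _ lte; move: (coord x _) xe c0 => c xe c0.
have d0 := root_gt0 (simple_root eE).
have [m em] := root_dvdl e rx'.
suff c1 : c = 1 by rewrite xe c1 mulr1z.
move: em; rewrite xe !bformE => em.
have cn0 : c != 0 by apply/eqP => cc; move: (root_nz rx'); rewrite xe cc mulr0z eqxx.
have /eqP : bform e e * c * (1 - m * c) = 0 by rewrite mulrBr mulr1 {1}em; ring.
rewrite !mulf_eq0 (gt_eqF d0) (negPf cn0) /= => /eqP mc.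
have : c \is a GRing.unit by apply/unitrP; exists m; rewrite mulrC; lia.
by case: c c0 {xe em cn0 mc} => [[|[|c]]|c].
Qed.

Lemma exchange J a : word J -> real_root a -> pos a -> pos (- srefl_seq J a) ->
  exists J1 e J2, J = J1 ++ e :: J2 /\ srefl_seq J2 a = e.
Proof.
move=> wJ ra pa; elim: J wJ => [_ /= na|e J IHJ /= /andP[eE wJ] nJ].
  by have /eqP := pos_anti pa na; rewrite (negPf (root_nz (real_is_root ra))).
have rJ : real_root (srefl_seq J a).
  by apply: real_srefl_seq ra => f fJ; apply/real_simple/(allP wJ).
have [pJ|nJa] := real_signs rJ.
  by exists [::], e, J; split=> //; apply: real_flip.
have [J1 [f [J2 [-> eJ2]]]] := IHJ wJ nJa.
by exists (e :: J1), f, J2.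
Qed.

(** The last entry [a] of an ascending factorisation is made negative by [J], so the exchange
    condition deletes a letter [e] of [J]; by induction the rest of [J] braids to the rest of [A],
    and moving [e] to the far right turns it into [a]. For empty [A], a nonempty product of distinct
    simple reflections is not the identity: it sends its last letter e to a vector with
    [e]-coordinate -1. *)
Lemma ascending_orbit J A : word J -> uniq J -> reals A -> (forall a, a \in A -> pos a) ->
  (forall P a S, A = P ++ a :: S -> pos (srefl_seq P a)) ->
  arefl_seq A =1 arefl_seq J -> braid_orbit J A.
Proof.
elim/last_ind: A J => [|A a IHA] J wJ uJ rA pA upA eAJ.
  case/lastP: J wJ uJ eAJ => [|J e]; first by move=> *; apply: BraidOrbit_id.
  rewrite word_rcons rcons_uniq => /andP[eE wJ] /andP[eJ uJ] eJ1.
  have wJe : word (rcons J e) by rewrite word_rcons eE.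
  have g0 : goods (Nil L) by [].
  have /(_ e) := arefl_seq_srefl g0 (word_goods wJe) eJ1.
  rewrite -cats1 srefl_seq_cat /= srefl_self; last exact: simple_root.
  rewrite srefl_seqN; last exact: word_roots.
  move/(congr1 (fun z => coord z (index e E))) => /=.
  have lte : (index e E < n)%N by rewrite index_mem.
  rewrite coordN // coord_srefl_seq_notin // -(nth_index 0 eE) coord_nth ?index_mem //.
    by rewrite nth_index // eqxx.
  by rewrite nth_index.
have [rA' ra] : reals A /\ real_root a.
  by move: rA; rewrite -cats1 => /reals_cat[? /reals_cons[]].
have ga := real_good ra; have gA := reals_goods rA'.
have pa : pos a by apply: pA; rewrite mem_rcons inE eqxx.
have up : pos (srefl_seq A a) by apply: (upA A a [::]); rewrite cats1.
have sAJ := arefl_seq_srefl (reals_goods rA) (word_goods wJ) eAJ.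
have nJ : pos (- srefl_seq J a).
  rewrite -sAJ -cats1 srefl_seq_cat /= srefl_self ?srefl_seqN ?opprK //.
    exact: goods_roots.
  exact: good_root.
have [J1 [e [J2 [eJ eJ2]]]] := exchange wJ ra pa nJ.
move: wJ uJ; rewrite eJ word_cat /= => /and3P[w1 eE w2].
rewrite uniq_catC cons_uniq => /andP[_]; rewrite uniq_catC => u12.
have w12 : word (J1 ++ J2) by rewrite word_cat w1.
have g2 := word_goods w2; have ge := good_simple eE.
have /(IHA _ w12 u12 rA') oA : arefl_seq A =1 arefl_seq (J1 ++ J2).
  move=> x; have := eAJ (arefl a x); rewrite -cats1 eJ !arefl_seq_cat /= areflK // => ->.
  by rewrite -eJ2 arefl_seq_conj // areflK.
have {}oA : braid_orbit (J1 ++ J2) A.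
  apply: oA => [b bA|P b S eA].
    by apply: pA; rewrite mem_rcons inE bA orbT.
  by apply: (upA P b (rcons S a)); rewrite eA rcons_cat.
have -> : a = srefl_seq (rev J2) e by rewrite -eJ2 srefl_seq_revK //; apply: word_roots.
rewrite -cats1; apply: bo_trans (bo_catl _ oA).
rewrite -catA -[e :: J2]cats0.
by apply: bo_move_right; [apply: word_roots|apply: simple_root].
Qed.

Lemma uniq_simple : uniq E.
Proof.
apply/(uniqP 0) => i j; rewrite !inE => lti ltj eij.
have := coord_nth ltj lti; rewrite eij coord_nth // eqxx.
by case: eqP => [->|].
Qed.

Lemma simple_word : word E.
Proof. exact/allP. Qed.

Theorem hurwitz_transitive A : reals A -> srefl_seq A =1 srefl_seq E ->
  (forall P a b S, braid_orbit A (P ++ a :: b :: S) -> ~ (srefl a =1 srefl b)) ->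
  braid_orbit E A.
Proof.
move=> rA eA nA; have rootA := reals_roots rA.
have [B oB minB] : exists2 B, braid_orbit A B & forall G, braid_orbit A G -> pot B <= pot G.
  have exm : exists m, `[< exists2 B, braid_orbit A B & pot B = m%:Z >].
    exists `|pot A|%N; apply/asboolP; exists A; first exact: BraidOrbit_id.
    by rewrite gez0_abs // pot_ge0.
  case: (ex_minnP exm) => m /asboolP[B oB eB] minm; exists B => // G oG.
  have g0 := pot_ge0 (reals_bo rA oG).
  rewrite eB -(gez0_abs g0) lez_nat; apply: minm; apply/asboolP.
  by exists G; rewrite // gez0_abs.
have rB := reals_bo rA oB.
(* The potential sees only the affine reflections, not the signs of the roots, so the minimiser may
   be taken with positive entries. *)
have minC G : braid_orbit A G -> pot (map posabs B) <= pot G.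
  by rewrite /pot potf_posabs; [apply: minB|apply: reals_goods].
have {oB} := bo_posabs oB; have pC b : b \in map posabs B -> pos b.
  by case/mapP=> c cB ->; apply/pos_posabs/rB.
move: (map posabs B) minC pC => C minC pC oC {B minB rB}.
have rC := reals_bo rA oC.
(* The first descent would follow an ascent, and one of the two moves at this peak would lower the
   potential. *)
have upC P a S : C = P ++ a :: S -> pos (srefl_seq P a).
  elim/last_ind: P a S => [|P a IHP] b S eC.
    by apply: pC; rewrite eC inE eqxx.
  rewrite -cats1 -catA /= in eC.
  have pa := IHP _ _ eC.
  have := rC; rewrite eC => /reals_cat[rP /reals_cons[ra /reals_cons[rb rS]]].
  have rPa : reals (rcons P a) by rewrite -cats1; apply/reals_cat; split=> //; apply/reals_cons.
  have [//|nb] := real_signs (real_srefl_seq rPa rb).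
  have [ga gb] := (real_good ra, real_good rb).
  have ab : ~ (srefl a =1 srefl b) by apply: (nA P a b S); rewrite -eC.
  have [pa' pb'] : pos a /\ pos b.
    by split; apply: pC; rewrite eC mem_cat !inE eqxx ?orbT.
  have [low|low] := peak rP ra rb pa' pb' pa nb ab.
    have /minC : braid_orbit A (P ++ b :: srefl b a :: S) by apply: bo_sigma; rewrite -eC.
    have /(pot_swap P S) : arefl_seq [:: a; b] =1 arefl_seq [:: b; srefl b a].
      move=> x /=; have := arefl_conj (arefl b x) ga gb; rewrite areflK // => ->.
      by rewrite areflK.
    by rewrite -eC; move: low; lia.
  have /minC : braid_orbit A (P ++ srefl a b :: a :: S) by apply: bo_sigmaV; rewrite -eC.
  have /(pot_swap P S) : arefl_seq [:: a; b] =1 arefl_seq [:: srefl a b; a].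
    by move=> x /=; rewrite arefl_conj.
  by rewrite -eC; move: low; lia.
have eC : arefl_seq C =1 arefl_seq E.
  apply: affine_faithful => //; first exact: reals_simple.
  by move=> x; rewrite (bo_srefl_seq rootA oC) eA.
apply: bo_trans (ascending_orbit simple_word uniq_simple rC pC upC eC) _.
exact: bo_sym.
Qed.

(** Neighbours a, b in an exceptional sequence have different reflections: if s_b a = - a, pairing
    with b on the left shows that the coefficient of b is 0, hence 2 a = 0. *)
Lemma complete_real_orbit C : exceptional C -> complete C -> reals C -> braid_orbit E C.
Proof.
move=> oC cC rC; apply: hurwitz_transitive => //.
  by apply: srefl_seq_complete => //; [apply: gc_exceptional|apply: gc_complete].
move=> P a b S oG eab.
have := exceptional_bo oC oG => /exceptional_cat[_ /exceptional_cons[ra /exceptional_cons[rb _ _] aE] _].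
have ba : bform b a = 0 by apply: aE; rewrite inE eqxx.
have := eab a; rewrite srefl_self // sreflE => /eqP; rewrite -subr_eq0 => /eqP e0.
have : bform b (- a - (a - b *~ root_coef b a)) = bform b a * (-2) + bform b b * root_coef b a.
  by rewrite !bformE; ring.
rewrite e0 bform0r ba mul0r add0r => /esym/eqP; rewrite mulf_eq0 (negPf (root_neq0 rb)) /=.
move/eqP=> c0; move: e0; rewrite c0 mulr0z subr0 -opprD -mulr2n => /eqP.
rewrite oppr_eq0 => /eqP a2.
have : a *~ 2 = 0 by rewrite -[2]/(2%:Z) -pmulrn.
by move/(mulrz_inj_lattice (isT : (2 : int) != 0))/eqP; rewrite (negPf (root_nz ra)).
Qed.

(* In a shortest factorisation no two neighbours can be cancelled. *)
Lemma shortest_orbit A : reals A -> srefl_seq A =1 srefl_seq E ->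
  (forall B, reals B -> srefl_seq B =1 srefl_seq E -> (size A <= size B)%N) ->
  braid_orbit E A.
Proof.
move=> rA eA minA; apply: hurwitz_transitive => // P a b S oG eab.
have := reals_bo rA oG => /reals_cat[rP /reals_cons[ra /reals_cons[rb rS]]].
have : (size A <= size (P ++ S))%N.
  apply: minA => [|x]; first exact/reals_cat.
  rewrite -eA -(bo_srefl_seq (reals_roots rA) oG) !srefl_seq_cat /= eab sreflK //.
  exact: real_is_root.
by rewrite -(bo_size oG) !size_cat /= !addnS ltnNge leqnSn.
Qed.

(** A shortest factorisation lies in the orbit of [E] and therefore has exactly n entries. *)
Lemma cox_length_ge A : reals A -> srefl_seq A =1 srefl_seq E -> (n <= size A)%N.
Proof.
have [m] := ubnP (size A); elim: m A => // m IHm A; rewrite ltnS => le_Am rA eA.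
case: (pselect (forall B, reals B -> srefl_seq B =1 srefl_seq E -> (size A <= size B)%N)).
  by move/(shortest_orbit rA eA)/bo_size->.
move=> nmin; have [B [rB eB ltB]] : exists B,
    [/\ reals B, srefl_seq B =1 srefl_seq E & (size B < size A)%N].
  apply: contrapT => nB; apply: nmin => B rB eB; rewrite leqNgt.
  by apply/negP => ltB; apply: nB; exists B.
exact: leq_trans (IHm B (leq_trans ltB le_Am) rB eB) (ltnW ltB).
Qed.

Lemma cox_factorization_orbit A : reals A -> srefl_seq A =1 srefl_seq E ->
  (size A <= n)%N -> braid_orbit E A.
Proof.
move=> rA eA leA; apply: shortest_orbit => // B rB eB.
exact: leq_trans leA (cox_length_ge rB eB).
Qed.

End RealRoots.

(** * Hereditary categories, numerically *)

Section Perpendicular.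
Variable L : bilLattice.
Implicit Types (x y z : L) (A B C E : seq L).

(** The Gram matrix of an exceptional sequence is triangular with nonzero diagonal, so the form
    stays non-degenerate on the span, on either side. *)
Lemma spn_perpl E x : exceptional E -> spn E x -> (forall e, e \in E -> bform x e = 0) -> x = 0.
Proof.
elim: E x => [//|a E IHE] x /exceptional_cons[ra oE aE] /= [k xE] xe.
have := spn_bform0l aE xE; rewrite !bformE xe ?inE ?eqxx // => /eqP.
rewrite sub0r oppr_eq0 mulf_eq0 (negPf (root_neq0 ra)) /= => /eqP k0.
rewrite k0 mulr0z subr0 in xE.
by apply: IHE => // e eE; apply: xe; rewrite inE eE orbT.
Qed.

Lemma spn_perpr E x : exceptional E -> spn E x -> (forall e, e \in E -> bform e x = 0) -> x = 0.
Proof.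
elim: E x => [//|a E IHE] x /exceptional_cons[ra oE aE] /= [k xE] xe.
have xk : x - a *~ k = 0.
  apply: IHE => // e eE; rewrite !bformE aE // mul0r subr0.
  by apply: xe; rewrite inE eE orbT.
have := xe a (mem_head _ _); move/eqP: xk; rewrite subr_eq0 => /eqP->.
by rewrite bformMzr => /eqP; rewrite mulf_eq0 (negPf (root_neq0 ra)) /= => /eqP->.
Qed.

(** In the decomposition along [A], [C] and [B], triangularity lets the conditions on [x] pass to
    its components in the spans of [A] and [B], which then vanish. *)
Lemma perp_middle A C B x : exceptional (A ++ C ++ B) -> complete (A ++ C ++ B) ->
  (forall a, a \in A -> bform x a = 0) -> (forall b, b \in B -> bform b x = 0) ->
  spn C x.
Proof.
move=> /exceptional_cat[oA oCB ACB] /completeP/(_ x)/spn_cat[y [z [yA zCB xyz]]] xA Bx.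
have /exceptional_cat[oC oB CB] := oCB.
have y0 : y = 0.
  apply: spn_perpl yA _ => // a aA; have := xA a aA; rewrite xyz !bformE.
  rewrite [bform z a](_ : _ = 0) ?addr0 //; apply: spn_bform0l zCB => e eCB.
  exact: ACB.
have := zCB => /spn_cat[u [v [uC vB zuv]]].
have v0 : v = 0.
  apply: spn_perpr vB _ => // b bB; have := Bx b bB; rewrite xyz y0 add0r zuv !bformE.
  rewrite [bform b u](_ : _ = 0) ?add0r //; apply: spn_bform0r uC => e eC.
  exact: CB.
by rewrite xyz y0 add0r zuv v0 addr0.
Qed.

Definition bilLattice_op : bilLattice :=
  @BilLattice L (fun x y => bform y x) (fun x y z => bformDr z x y)
    (fun x y z => bformDl y z x) (@bform_nondegr L) (@bform_nondegl L).

End Perpendicular.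

(* The numerical shadow of a hereditary abelian category with finite-dimensional
   Hom and Ext spaces: [hdim M N] is the dimension of Hom(M, N) and
   [edim M N = hdim M N - <M, N>] that of Ext(M, N). *)
Section HereditaryCategory.
Variable L : bilLattice.

Record hcat_data := HCatData {
  hmod :> Type;
  cls : hmod -> L;
  hdim : hmod -> hmod -> int;
  ses : hmod -> hmod -> hmod -> Prop;
  ht : L -> int
}.

Variable C : hcat_data.
Implicit Types (M N K X Y Z I Q R W : C).

Definition edim M N : int := hdim M N - bform (cls M) (cls N).

(** Nonzero endomorphisms are injective. An endomorphism is recorded by its image [I], which is a
    quotient and a subobject of [X] at the same time. *)
Definition brick X := forall K I Q, ses K X I -> ses I X Q -> cls I <> 0 -> cls K = 0.

Definition multiple_of Y (k : nat) Z := cls Z = cls Y *~ k /\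
  forall N, hdim Z N = hdim Y N * k%:Z /\ hdim N Z = hdim N Y * k%:Z.

(** Heredity enters through [ses_edim_quo] and [ses_edim_sub], the right exactness of Ext. The
    approximations are the universal maps to or from a power of a brick, with k the rank of Hom over
    its endomorphism division ring; the extensions are single steps towards a universal
    extension. *)
Record hereditary : Prop := Hereditary {
  htD : forall x y, ht C (x + y) = ht C x + ht C y;
  ht_ge0 : forall M, 0 <= ht C (cls M);
  ht_eq0 : forall M, ht C (cls M) = 0 -> cls M = 0;
  hdim_ge0 : forall M N, 0 <= hdim M N;
  edim_ge0 : forall M N, 0 <= edim M N;
  hdim_cls0 : forall M N, cls M = 0 -> hdim M N = 0 /\ hdim N M = 0;
  hdim_id : forall M, cls M <> 0 -> 0 < hdim M M;
  ses_cls : forall K X I, ses K X I -> cls X = cls K + cls I;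
  ses_hdim_sub : forall K X I N, ses K X I -> hdim N K <= hdim N X;
  ses_hdim_quo : forall K X I N, ses K X I -> hdim I N <= hdim X N;
  ses_hdim_midr : forall K X I N, ses K X I -> hdim N X <= hdim N K + hdim N I;
  ses_hdim_midl : forall K X I N, ses K X I -> hdim X N <= hdim K N + hdim I N;
  ses_edim_quo : forall K X I N, ses K X I -> edim N I <= edim N X;
  ses_edim_sub : forall K X I N, ses K X I -> edim K N <= edim X N;
  factorisation : forall X Y, 0 < hdim X Y ->
    exists K I Q, [/\ ses K X I, ses I Y Q & cls I <> 0];
  left_approximation : forall X Y, brick Y ->
    exists k Z K I Q, [/\ ses K X I, ses I Z Q, multiple_of Y k Z,
      hdim Q Y = 0 & hdim X Y = hdim Y Y * k%:Z];
  right_approximation : forall X Y, brick X ->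
    exists k Z K I Q, [/\ ses K Z I, ses I Y Q, multiple_of X k Z,
      hdim X K = 0 & hdim X Y = hdim X X * k%:Z];
  left_extension : forall X Y, brick Y -> hdim X Y = 0 -> 0 < edim X Y ->
    exists R, ses Y R X /\ hdim R Y = 0;
  right_extension : forall X Y, brick X -> hdim X Y = 0 -> 0 < edim X Y ->
    exists R, ses Y R X /\ hdim X R = 0
}.

End HereditaryCategory.

(** * The opposite category *)

Section Dual.
Variables (L : bilLattice) (C : hcat_data L).

Definition hcat_op : hcat_data (bilLattice_op L) :=
  @HCatData (bilLattice_op L) C (@cls L C : C -> bilLattice_op L)
    (fun M N => hdim N M) (fun K X I => ses I X K) (ht C).

(** Kernel and cokernel of an endomorphism have the same class, so one is zero exactly when the
    other is. *)
Lemma brick_op (hC : hereditary C) (X : C) : brick (X : hcat_op) <-> brick X.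
Proof.
split=> bX K I Q sKXI sIXQ I0.
  have := bX Q I K sIXQ sKXI I0; have := ses_cls hC sIXQ; rewrite (ses_cls hC sKXI) => e1 e2.
  move: e1; rewrite /= in e2; rewrite e2 addr0 => /eqP.
  by rewrite -subr_eq0 addrK => /eqP.
have := bX Q I K sIXQ sKXI I0; have := ses_cls hC sIXQ; rewrite (ses_cls hC sKXI) => e1 e2.
by move: e1; rewrite e2 add0r => /eqP; rewrite -subr_eq0 addrAC subrr add0r => /eqP.
Qed.

Lemma hereditary_op : hereditary C -> hereditary hcat_op.
Proof.
move=> hC; split=> /=.
- exact: htD hC.
- exact: ht_ge0 hC.
- exact: ht_eq0 hC.
- by move=> M N; apply: hdim_ge0 hC _ _.
- by move=> M N; apply: (edim_ge0 hC).
- by move=> M N M0; have [] := hdim_cls0 hC N M0.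
- exact: hdim_id hC.
- by move=> K X I s; rewrite (ses_cls hC s) addrC.
- by move=> K X I N; apply: (ses_hdim_quo hC).
- by move=> K X I N; apply: (ses_hdim_sub hC).
- by move=> K X I N s; rewrite addrC; apply: (ses_hdim_midl hC).
- by move=> K X I N s; rewrite addrC; apply: (ses_hdim_midr hC).
- by move=> K X I N; apply: (ses_edim_sub hC).
- by move=> K X I N; apply: (ses_edim_quo hC).
- by move=> X Y /(factorisation hC)[K [I [Q [s1 s2 I0]]]]; exists Q, I, K.
- move=> X Y /(brick_op hC)/(right_approximation hC X)[k [Z [K [I [Q [s1 s2 [mZ mN] h1 h2]]]]]].
  by exists k, Z, Q, I, K; split=> //; split=> // N; have [] := mN N.
- move=> X Y /(brick_op hC)/(left_approximation hC Y)[k [Z [K [I [Q [s1 s2 [mZ mN] h1 h2]]]]]].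
  by exists k, Z, Q, I, K; split=> //; split=> // N; have [] := mN N.
- by move=> X Y /(brick_op hC)/(right_extension hC); apply.
- by move=> X Y /(brick_op hC)/(left_extension hC); apply.
Qed.

End Dual.

(** * Mutation of exceptional sequences of modules *)

Section Mutation.
Variables (L : bilLattice) (C : hcat_data L) (hC : hereditary C).
Implicit Types (M N K X Y Z I Q R W : C) (Xs Ys As Bs : seq C).

Definition hvan X Y := hdim Y X == 0.
Definition rigid X := hdim X X == bform (cls X) (cls X).

(** A complete exceptional sequence of modules: from right to left both Hom and the form vanish,
    hence so does Ext, and [rigid] says that Ext(X, X) = 0. *)
Definition mseq Xs :=
  [/\ exceptional (map (@cls L C) Xs), complete (map (@cls L C) Xs),
      pairwise hvan Xs & all rigid Xs].

Lemma ht0 : ht C 0 = 0.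
Proof. by apply: (addrI (ht C 0)); rewrite -(htD hC) !addr0. Qed.

Lemma htN x : ht C (- x) = - ht C x.
Proof. by apply: (addrI (ht C x)); rewrite -(htD hC) !subrr ht0. Qed.

Lemma htMz x k : ht C (x *~ k) = ht C x * k.
Proof.
have Hn (n : nat) : ht C (x *+ n) = ht C x * n%:Z.
  elim: n => [|n IHn]; first by rewrite mulr0n ht0 mulr0.
  by rewrite mulrS (htD hC) IHn -addn1 PoszD; ring.
case: k => n; first by rewrite -pmulrn Hn.
by rewrite NegzE mulrNz htN -pmulrn Hn mulrN.
Qed.

Lemma ht_gt0 M : cls M <> 0 -> 0 < ht C (cls M).
Proof.
move=> M0; rewrite lt0r (ht_ge0 hC) andbT; apply/eqP => h0.
exact/M0/(ht_eq0 hC).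
Qed.

(** Once Hom vanishes, the vanishing of the form is that of Ext; these are the modules left
    perpendicular to [As] and right perpendicular to [Bs]. *)
Definition perp As Bs M :=
  all (fun W => (hdim M W == 0) && (bform (cls M) (cls W) == 0)) As &&
  all (fun W => (hdim W M == 0) && (bform (cls W) (cls M) == 0)) Bs.

(** Towards [As], Hom vanishes on [I] as a quotient of [X], and Ext vanishes on [I] as a subobject
    of [Z]; additivity of the form carries this to [K] and [Q]. The conditions for [Bs] are dual. So
    the perpendicular category is abelian. *)
Lemma perp_image As Bs K X I Z Q : ses K X I -> ses I Z Q ->
  perp As Bs X -> perp As Bs Z -> [/\ perp As Bs K, perp As Bs I & perp As Bs Q].
Proof.
move=> s1 s2 /andP[XA XB] /andP[ZA ZB].
have [cX cZ] := (ses_cls hC s1, ses_cls hC s2).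
have pA W : (hdim X W == 0) && (bform (cls X) (cls W) == 0) ->
    (hdim Z W == 0) && (bform (cls Z) (cls W) == 0) ->
  [/\ (hdim K W == 0) && (bform (cls K) (cls W) == 0),
      (hdim I W == 0) && (bform (cls I) (cls W) == 0)
    & (hdim Q W == 0) && (bform (cls Q) (cls W) == 0)].
  move=> /andP[/eqP h1 /eqP x1] /andP[/eqP h2 /eqP x2].
  have := (ses_hdim_quo hC W s1, ses_hdim_quo hC W s2, ses_edim_sub hC W s1,
           ses_edim_sub hC W s2); rewrite /edim.
  have := (hdim_ge0 hC K W, hdim_ge0 hC I W, hdim_ge0 hC Q W).
  have := (edim_ge0 hC K W, edim_ge0 hC I W, edim_ge0 hC Q W); rewrite /edim.
  move: h1 x1 h2 x2; rewrite cX cZ !bformDl => h1 x1 h2 x2.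
  by move=> [[a1 a2] a3] [[b1 b2] b3] [[[c1 c2] c3] c4]; split; apply/andP; split; apply/eqP; lia.
have pB W : (hdim W X == 0) && (bform (cls W) (cls X) == 0) ->
    (hdim W Z == 0) && (bform (cls W) (cls Z) == 0) ->
  [/\ (hdim W K == 0) && (bform (cls W) (cls K) == 0),
      (hdim W I == 0) && (bform (cls W) (cls I) == 0)
    & (hdim W Q == 0) && (bform (cls W) (cls Q) == 0)].
  move=> /andP[/eqP h1 /eqP x1] /andP[/eqP h2 /eqP x2].
  have := (ses_hdim_sub hC W s1, ses_hdim_sub hC W s2, ses_edim_quo hC W s1,
           ses_edim_quo hC W s2); rewrite /edim.
  have := (hdim_ge0 hC W K, hdim_ge0 hC W I, hdim_ge0 hC W Q).
  have := (edim_ge0 hC W K, edim_ge0 hC W I, edim_ge0 hC W Q); rewrite /edim.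
  move: h1 x1 h2 x2; rewrite cX cZ !bformDr => h1 x1 h2 x2.
  by move=> [[a1 a2] a3] [[b1 b2] b3] [[[c1 c2] c3] c4]; split; apply/andP; split; apply/eqP; lia.
by split; apply/andP; split;
  [elim: As {XB ZB} XA ZA | elim: Bs {XA ZA} XB ZB | elim: As {XB ZB} XA ZA
  |elim: Bs {XA ZA} XB ZB | elim: As {XB ZB} XA ZA | elim: Bs {XA ZA} XB ZB] => //= W Ws IH
  /andP[p1 /IH{}IH] /andP[p2 /IH->]; rewrite andbT; first [case: (pA W p1 p2)|case: (pB W p1 p2)].
Qed.

Lemma perp_spn As Ys Bs M : exceptional (map (@cls L C) (As ++ Ys ++ Bs)) ->
  complete (map (@cls L C) (As ++ Ys ++ Bs)) -> perp As Bs M ->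
  spn (map (@cls L C) Ys) (cls M).
Proof.
rewrite !map_cat => oE cE /andP[pA pB]; apply: perp_middle oE cE _ _ => x.
  by elim: As pA => //= W As IH /andP[/andP[_ /eqP p] /IH{}IH]; rewrite inE => /predU1P[->|].
by elim: Bs pB => //= W Bs IH /andP[/andP[_ /eqP p] /IH{}IH]; rewrite inE => /predU1P[->|].
Qed.

Lemma mseq_root As X Bs : mseq (As ++ X :: Bs) -> is_root (cls X).
Proof.
by case=> + _ _ _; rewrite map_cat => /exceptional_cat[_ /exceptional_cons[]].
Qed.

Lemma mseq_perp As Ys Bs : mseq (As ++ Ys ++ Bs) -> all (perp As Bs) Ys.
Proof.
case; rewrite !map_cat => /exceptional_cat[_ oYB oA] _.
have /exceptional_cat[_ _ oY] := oYB.
rewrite !pairwise_cat => /and3P[]; rewrite allrel_catr => /andP[hAY _] _ /and3P[hYB _ _] _.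
elim: Ys {oYB} oA oY hAY hYB => //= Y Ys IH oA oY.
rewrite allrel_consr allrel_consl => /andP[hAY hAYs] /andP[hYB hYsB].
rewrite IH // => [|a b aA bY|a b aA bY]; last 2 first.
- by apply: oA; rewrite ?inE ?bY ?orbT.
- by apply: oY; rewrite ?inE ?aA ?orbT.
rewrite andbT; apply/andP; split.
  elim: As {IH hAYs} oA hAY => //= W As IH oA /andP[/eqP-> hAY].
  rewrite eqxx oA ?inE ?eqxx //= IH // => a b aA; apply: oA; by rewrite inE aA orbT.
elim: Bs {IH hYsB oA} oY hYB => //= W Bs IH oY /andP[/eqP-> hYB].
rewrite eqxx oY ?inE ?eqxx //= IH // => a b aA bB; apply: oY => //; by rewrite inE bB orbT.
Qed.

(** Kernel and image stay in a perpendicular category whose classes are multiples of that of [X]; by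
    heights the two multiples are nonnegative with sum 1, and that of the image is positive. *)
Lemma brick_of_perp As X Bs : exceptional (map (@cls L C) (As ++ X :: Bs)) ->
  complete (map (@cls L C) (As ++ X :: Bs)) -> perp As Bs X -> brick X.
Proof.
move=> oE cE pX K I Q s1 s2 I0.
have [pK pI _] := perp_image s1 s2 pX pX.
have /= [k] := perp_spn (Ys := [:: X]) oE cE pK; have /= [l] := perp_spn (Ys := [:: X]) oE cE pI.
move=> /eqP; rewrite subr_eq0 => /eqP eI /eqP; rewrite subr_eq0 => /eqP eK.
have rX : is_root (cls X) by move: oE; rewrite map_cat => /exceptional_cat[_ /exceptional_cons[]].
have X0 : cls X <> 0.
  by move=> X0; have := root_gt0 rX; rewrite X0 bform0l ltxx.
have := ht_gt0 X0; have := ht_ge0 hC K; have := ht_gt0 I0.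
have := congr1 (ht C) (ses_cls hC s1); rewrite (htD hC) eI eK !htMz => e1 e2 e3 e4.
have kl : k + l = 1.
  by apply: (mulfI (lt0r_neq0 e4)); rewrite mulrDr mulr1 -e1.
have l0 : 0 < l by rewrite -(pmulr_rgt0 _ e4).
have k0 : 0 <= k by rewrite -(pmulr_rge0 _ e4).
by have -> : k = 0 by [lia]; rewrite mulr0z.
Qed.

Lemma mseq_brick As X Bs : mseq (As ++ X :: Bs) -> brick X.
Proof.
move=> ms; have [oE cE _ _] := ms; apply: brick_of_perp oE cE _.
by have := @mseq_perp As [:: X] Bs ms; rewrite /= andbT.
Qed.

(** Each extension by [Y] lowers dim Ext(R, Y) by <y, y>, so the process ends with Ext(R, Y) = 0.
    The last clause remembers that [Y] is a subobject of [R] unless no step was made. *)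
Lemma extension_iter X Y : brick Y -> is_root (cls Y) -> hdim X Y = 0 ->
  exists R (j : nat), [/\ cls R = cls X + cls Y *~ j, hdim R Y = 0 /\ edim R Y = 0,
    forall W, hdim W Y = 0 -> hdim W R <= hdim W X,
    forall W, hdim Y W = 0 -> hdim R W <= hdim X W
  & R = X \/ exists N, ses Y R N].
Proof.
move=> bY rY; have [m] := ubnP `|edim X Y|%N; elim: m X => // m IHm X ltm h0.
have e0 := edim_ge0 hC X Y.
case: (eqVneq (edim X Y) 0) => [eXY|eXY].
  by exists X, 0%N; split=> //; [rewrite mulr0z addr0|left].
have epos : 0 < edim X Y by rewrite lt0r eXY.
have [R1 [s1 h1]] := left_extension hC bY h0 epos.
have c1 := ses_cls hC s1.
have e1 : edim R1 Y = edim X Y - bform (cls Y) (cls Y).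
  by rewrite /edim h1 h0 c1 bformDl; ring.
have d0 := root_gt0 rY; have e10 := edim_ge0 hC R1 Y.
have lt1 : (`|edim R1 Y| < m)%N.
  by rewrite -ltnS; apply: leq_trans ltm; rewrite ltnS; move: e10; rewrite e1; lia.
have [R [j [cR hR upR dnR ER]]] := IHm R1 lt1 h1.
exists R, j.+1; split=> //.
- rewrite cR c1 -[j.+1]add1n PoszD mulrzDr mulr1z addrA; congr (_ + _).
  exact: addrC.
- move=> W hW; apply: le_trans (upR W hW) _.
  by have := ses_hdim_midr hC W s1; rewrite hW add0r.
- move=> W hW; apply: le_trans (dnR W hW) _.
  by have := ses_hdim_midl hC W s1; rewrite hW add0r.
- by right; case: ER => [->|//]; exists X.
Qed.

(* Write [Q] = a r with r = s_y x; then dim Hom(I, X) = - a <x, x> lies between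
   0 and dim End(X) = <x, x>, so that a is 0 or -1. *)
Lemma left_approximation_mono_or_epi As X Y Bs k Z K I Q : mseq (As ++ X :: Y :: Bs) ->
  (0 < k)%N -> ses K X I -> ses I Z Q -> multiple_of Y k Z ->
  hdim Q Y = 0 -> hdim X Y = hdim Y Y * k%:Z ->
  [/\ edim X Y = 0, hdim K Y = 0, edim Q Y = 0, edim K X = 0 &
  (cls Q = 0 /\ cls K = srefl (cls Y) (cls X)) \/
    (cls K = 0 /\ cls Q = - srefl (cls Y) (cls X))].
Proof.
move=> ms k0 s1 s2 [cZ mZ] hQY hXY.
have [oE cE pw rg] := ms.
have /= /and3P[pX pY _] := mseq_perp (Ys := [:: X; Y]) ms.
have rX := mseq_root ms.
have rY : is_root (cls Y) by apply: (@mseq_root (As ++ [:: X]) Y Bs); rewrite -catA.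
move: pw rg; rewrite pairwise_cat all_cat /= => /and3P[_ _ /andP[/andP[/eqP hYX _] _]].
move=> /and4P[_ /eqP rgX /eqP rgY _].
have yx : bform (cls Y) (cls X) = 0.
  move: oE; rewrite map_cat => /exceptional_cat[_ /exceptional_cons[_ _ hy] _].
  by apply: hy; rewrite /= inE eqxx.
set d := bform (cls X) (cls X) in rgX *; set d' := bform (cls Y) (cls Y) in rgY.
have d0 : 0 < d by apply: root_gt0.
have d0' : 0 < d' by apply: root_gt0.
have pZ : perp As Bs Z.
  have [pA pB] := andP pY; apply/andP; split.
    apply: sub_all pA => W /andP[/eqP h /eqP b]; have [-> _] := mZ W.
    by rewrite cZ bformMzl h b !mul0r eqxx.
  apply: sub_all pB => W /andP[/eqP h /eqP b]; have [_ ->] := mZ W.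
  by rewrite cZ bformMzr h b !mul0r eqxx.
have [pK pI pQ] := perp_image s1 s2 pX pZ.
have [cX cZ'] := (ses_cls hC s1, ses_cls hC s2).
have [mZY mYZ] := mZ Y; have [mZX mXZ] := mZ X.
have eXX : edim X X = 0 by rewrite /edim rgX subrr.
have eZX : edim Z X = 0 by rewrite /edim mZX hYX cZ bformMzl yx; ring.
have eZZ : edim Z Z = 0.
  by rewrite /edim (mZ Z).1 mYZ rgY cZ !bformE -/d'; ring.
have eXZ' : edim X Z = edim X Y * k%:Z by rewrite /edim mXZ cZ bformMzr; ring.
(* Hom(Y^k, Y) -> Hom(I, Y) -> Hom(X, Y) are isomorphisms *)
have hIY := ses_hdim_quo hC Y s1; have eIY0 := edim_ge0 hC I Y.
have eQY0 := edim_ge0 hC Q Y.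
have yI : bform (cls I) (cls Y) = d' * k%:Z - bform (cls Q) (cls Y).
  have := congr1 (fun z => bform z (cls Y)) cZ'; rewrite cZ bformMzl bformDl -/d'; lia.
have eQY : edim Q Y = 0.
  move: hIY eIY0 eQY0; rewrite /edim hQY hXY rgY yI; lia.
have hIY' : bform (cls I) (cls Y) = d' * k%:Z.
  by rewrite yI; move: eQY; rewrite /edim hQY; lia.
have eKY := ses_edim_sub hC Y s1.
have hKY : hdim K Y = 0.
  have h0 := hdim_ge0 hC K Y; move: eKY; rewrite /edim cX bformDl hXY rgY hIY'; lia.
have eKX : edim K X = 0.
  by have := ses_edim_sub hC X s1; have := edim_ge0 hC K X; rewrite eXX; lia.
have eIX : edim I X = 0.
  by have := ses_edim_sub hC X s2; have := edim_ge0 hC I X; rewrite eZX; lia.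
have oE' : exceptional (map (@cls L C) (As ++ [:: X; Y] ++ Bs)) by [].
have [a [l]] := perp_spn oE' cE pQ; move/eqP; rewrite subr_eq0 subr_eq => /eqP eQ.
have t0 := root_coefE (cls X) rY; rewrite /symform yx addr0 -/d' in t0.
have qy : bform (cls Q) (cls Y) = 0 by move: eQY; rewrite /edim hQY; lia.
(* In the plane of x and y, the classes left orthogonal to y are the multiples of s_y x. *)
have eQr : cls Q = srefl (cls Y) (cls X) *~ a.
  rewrite sreflE mulrzBl -mulrzA eQ addrC; congr (_ + _); rewrite -mulrNz; congr (_ *~ _).
  apply: (mulfI (lt0r_neq0 d0')); move: qy; rewrite eQ !bformE -/d' => qy.
  have -> : d' * (- (root_coef (cls Y) (cls X) * a)) = - (root_coef (cls Y) (cls X) * d') * a by ring.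
  by rewrite t0; lia.
have rx : bform (srefl (cls Y) (cls X)) (cls X) = d.
  by rewrite sreflE !bformE yx mul0r subr0.
have ix : bform (cls I) (cls X) = - (a * d).
  have := congr1 (fun z => bform z (cls X)) cZ'.
  by rewrite cZ bformMzl bformDl yx mul0r eQr bformMzl rx; lia.
have hIX : hdim I X = - (a * d) by move: eIX; rewrite /edim ix; lia.
have hIXX := ses_hdim_quo hC X s1; rewrite rgX hIX in hIXX.
have hIX0 := hdim_ge0 hC I X; rewrite hIX in hIX0.
have a0 : a <= 0 by rewrite -(pmulr_lle0 _ d0) -oppr_ge0.
have a1 : -1 <= a.
  rewrite leNgt; apply/negP => a1; have : (- a) * d <= 1 * d by rewrite mul1r mulNr.
  by rewrite ler_pM2r //; lia.
(* For a = 0 the universal map is onto, with kernel of class s_y x; for a = -1 it is injective, with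
   cokernel of class - s_y x. *)
have [a00|a01] : a = 0 \/ a = -1 by lia.
  have Q0 : cls Q = 0 by rewrite eQr a00 mulr0z.
  have eXI : edim X I = 0.
    by have := ses_edim_quo hC X s1; have := edim_ge0 hC X I; rewrite eXX; lia.
  have hXQ : hdim X Q = 0 by have [] := hdim_cls0 hC X Q0.
  have eXZ : edim X Z = 0.
    have := ses_hdim_midr hC X s2; have := edim_ge0 hC X Z; move: eXI.
    by rewrite /edim cZ' Q0 addr0 hXQ; lia.
  have eXY : edim X Y = 0.
    by move: eXZ; rewrite eXZ' => /eqP; rewrite mulf_eq0 eqz_nat (gtn_eqF k0) orbF => /eqP.
  split=> //; left; split=> //.
  rewrite sreflE (_ : root_coef (cls Y) (cls X) = k) //; last first.
    apply: (mulIf (lt0r_neq0 d0')); rewrite t0.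
    by move: eXY; rewrite /edim hXY rgY; lia.
  by rewrite -cZ cZ' Q0 addr0 cX addrK.
have eQ1 : cls Q = - srefl (cls Y) (cls X) by rewrite eQr a01 mulrN1z.
have cK : cls K = (cls Y) *~ (root_coef (cls Y) (cls X) - k%:Z).
  have : cls K = (cls X) - ((cls Y) *~ k - cls Q) by rewrite -cZ cZ' addrK cX addrK.
  rewrite eQ1 sreflE => ->; rewrite opprK mulrzBr.
  by rewrite opprD opprB addrCA [cls X + _]addrC subrK addrC.
(* The class of [K] is a multiple of y; dim Ext(X, Y) bounds the coefficient above by 0, and the
   height of [K] bounds it below by 0. *)
have hk : root_coef (cls Y) (cls X) - k%:Z <= 0.
  rewrite -(pmulr_lle0 _ d0') mulrBl t0.
  by have := edim_ge0 hC X Y; rewrite /edim hXY rgY; lia.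
have y0 : (cls Y) <> 0 by move=> y0; move: d0'; rewrite /d' y0 bform0l ltxx.
have hty := ht_gt0 y0.
have : 0 <= root_coef (cls Y) (cls X) - k%:Z.
  by rewrite -(pmulr_rge0 _ hty) -htMz -cK (ht_ge0 hC).
move=> hk'; have kk : root_coef (cls Y) (cls X) - k%:Z = 0 by lia.
have eXY : edim X Y = 0.
  rewrite /edim hXY rgY -t0; have -> : root_coef (cls Y) (cls X) = k by lia.
  by ring.
split=> //.
by right; split=> //; rewrite cK kk mulr0z.
Qed.

End Mutation.

Section MutationMoves.
Variables (L : bilLattice) (C : hcat_data L) (hC : hereditary C).
Implicit Types (M N K X Y Z I Q R W : C) (Xs Ys As Bs : seq C).

Lemma perp_multiple As Bs Y k Z : multiple_of Y k Z -> perp As Bs Y -> perp As Bs Z.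
Proof.
move=> [cZ mZ] /andP[pA pB]; apply/andP; split.
  apply: sub_all pA => W /andP[/eqP h /eqP b]; have [-> _] := mZ W.
  by rewrite cZ bformMzl h b !mul0r eqxx.
apply: sub_all pB => W /andP[/eqP h /eqP b]; have [_ ->] := mZ W.
by rewrite cZ bformMzr h b !mul0r eqxx.
Qed.

Lemma mseq_replace As X Y Bs R : mseq (As ++ X :: Y :: Bs) ->
  cls R = srefl (cls Y) (cls X) \/ cls R = - srefl (cls Y) (cls X) ->
  hdim R Y = 0 -> hdim R R = bform (cls R) (cls R) -> perp As Bs R ->
  mseq (As ++ Y :: R :: Bs).
Proof.
move=> ms cR hRY rR pR; have [oE cE] := ms.
rewrite !pairwise_cat !all_cat /= !allrel_consr.
move=> /and3P[/and3P[aX aY aB] pA /and3P[/andP[_ hX] hY pB]] /and4P[rA rX rY rB].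
have oB : braid_orbit (map (@cls L C) (As ++ X :: Y :: Bs))
                      (map (@cls L C) (As ++ Y :: R :: Bs)).
  rewrite !map_cat /=; case: cR => ->; first exact/bo_sigma/BraidOrbit_id.
  have o1 := bo_sigma (BraidOrbit_id (map (@cls L C) As ++ [:: cls X, cls Y & map (@cls L C) Bs])).
  apply: bo_trans o1 _; rewrite -[cls Y :: _ :: _]cat1s -[cls Y :: - _ :: _]cat1s !catA.
  exact: bo_opp.
have [pRA pRB] := andP pR.
split; first exact: exceptional_bo oB.
- by apply: complete_bo oB => //; apply: exceptional_roots.
- rewrite pairwise_cat /= allrel_consr allrel_consr aY aB pA hY pB /hvan hRY eqxx /= !andbT.
  apply/andP; split; first by apply: sub_all pRA => W /andP[].
  by apply: sub_all pRB => W /andP[].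
- by rewrite all_cat /= rA rY rB /rigid rR eqxx.
Qed.

Lemma mseq_pair As X Y Bs : mseq (As ++ X :: Y :: Bs) ->
  [/\ is_root (cls X), is_root (cls Y), brick Y, perp As Bs X /\ perp As Bs Y
    & [/\ hdim Y X = 0, bform (cls Y) (cls X) = 0,
      hdim X X = bform (cls X) (cls X) & hdim Y Y = bform (cls Y) (cls Y)]].
Proof.
move=> ms; have ms' : mseq ((As ++ [:: X]) ++ Y :: Bs) by rewrite -catA.
have /= /and3P[pX pY _] := mseq_perp (Ys := [:: X; Y]) ms.
split=> //; [exact: mseq_root ms|exact: mseq_root ms'|exact: mseq_brick ms'|].
have [oE _] := ms; rewrite pairwise_cat all_cat /= => /and3P[_ _ /andP[/andP[/eqP hYX _] _]].
move=> /and4P[_ /eqP rgX /eqP rgY _]; split=> //.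
move: oE; rewrite map_cat => /exceptional_cat[_ /exceptional_cons[_ _ hy] _].
by apply: hy; rewrite /= inE eqxx.
Qed.

(** The new module is the end of the iterated extension if Hom(X, Y) = 0, and otherwise the kernel
    or the cokernel of the universal map; only the cokernel carries the minus sign. *)
Lemma mutation_right As X Y Bs : mseq (As ++ X :: Y :: Bs) ->
  exists R, (cls R = srefl (cls Y) (cls X) \/ cls R = - srefl (cls Y) (cls X)) /\
    mseq (As ++ Y :: R :: Bs).
Proof.
move=> ms; have [rX rY bY [pX pY] [hYX yx rgX rgY]] := mseq_pair ms.
have [h0|hn0] := eqVneq (hdim X Y) 0.
  have [R [j [cR [hR eR] upR dnR _]]] := extension_iter hC bY rY h0.
  have cR' : cls R = srefl (cls Y) (cls X).
    rewrite cR sreflE (@root_coef_uniq _ _ _ (- j%:Z)) ?mulrNz ?opprK //.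
    move: eR; rewrite /edim hR cR bformDl bformMzl /symform yx; lia.
  exists R; split; first by left.
  apply: (mseq_replace ms _ hR); first by left.
    have := edim_ge0 hC R R; have := upR R hR; have := dnR X hYX.
    by rewrite /edim cR' bform_srefl // rgX; lia.
  have [[pXA pXB] [pYA pYB]] := (andP pX, andP pY); apply/andP; split.
    elim: As pXA pYA {ms pX pY} => //= W As IH /andP[/andP[/eqP h1 /eqP x1] /IH{}IH].
    move=> /andP[/andP[/eqP h2 /eqP x2] /IH->]; rewrite andbT cR bformDl bformMzl x1 x2 mul0r eqxx andbT.
    by apply/eqP/le_anti; rewrite (hdim_ge0 hC) andbT -h1 dnR.
  elim: Bs pXB pYB {ms pX pY} => //= W Bs IH /andP[/andP[/eqP h1 /eqP x1] /IH{}IH].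
  move=> /andP[/andP[/eqP h2 /eqP x2] /IH->]; rewrite andbT cR bformDr bformMzr x1 x2 mul0r eqxx andbT.
  by apply/eqP/le_anti; rewrite (hdim_ge0 hC) andbT -h1 upR.
have [k [Z [K [I [Q [s1 s2 mZ hQY hXY]]]]]] := left_approximation hC X bY.
have k0 : (0 < k)%N by case: k mZ hXY => // _; rewrite mulr0 => /eqP; rewrite (negPf hn0).
have [eXY hKY eQY eKX cases] := left_approximation_mono_or_epi hC ms k0 s1 s2 mZ hQY hXY.
have [pK _ pQ] := perp_image hC s1 s2 pX (perp_multiple mZ pY).
have [[Q0 cK]|[K0 cQ]] := cases.
  exists K; split; first by left.
  apply: (mseq_replace ms _ hKY _ pK); first by left.
  have := edim_ge0 hC K K; have := ses_hdim_sub hC K s1.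
  have hKX : hdim K X = bform (cls X) (cls X).
    move: eKX; rewrite /edim cK sreflE !bformE yx mul0r subr0; lia.
  by rewrite hKX /edim cK bform_srefl //; lia.
exists Q; split; first by right.
apply: (mseq_replace ms _ hQY _ pQ); first by right.
have [cZ mN] := mZ; have := ses_edim_quo hC Q s2; have := edim_ge0 hC Q Q.
have -> : edim Q Z = edim Q Y * k%:Z by rewrite /edim (mN Q).2 cZ bformMzr; ring.
by rewrite eQY mul0r /edim; lia.
Qed.

(* Happel and Ringel: a nonzero map between members is mono or epi. *)
Lemma mseq_adjacent_hom As X Y Bs : mseq (As ++ X :: Y :: Bs) -> 0 < hdim X Y ->
  edim X Y = 0 /\
  ((forall N, edim Y N = 0 -> edim X N = 0) \/ (forall N, edim N X = 0 -> edim N Y = 0)).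
Proof.
move=> ms h0; have [rX rY bY [pX pY] [hYX yx rgX rgY]] := mseq_pair ms.
have [k [Z [K [I [Q [s1 s2 mZ hQY hXY]]]]]] := left_approximation hC X bY.
have k0 : (0 < k)%N by case: k mZ hXY h0 => // _ ->; rewrite mulr0 ltxx.
have [eXY hKY eQY eKX cases] := left_approximation_mono_or_epi hC ms k0 s1 s2 mZ hQY hXY.
have [cZ mN] := mZ; have [cX cZ'] := (ses_cls hC s1, ses_cls hC s2).
split=> //; case: cases => [[Q0 _]|[K0 _]]; [right|left] => N eN.
  have hNQ : hdim N Q = 0 by have [] := hdim_cls0 hC N Q0.
  have : edim N Z = edim N Y * k%:Z by rewrite /edim (mN N).2 cZ bformMzr; ring.
  have := ses_hdim_midr hC N s2; have := ses_edim_quo hC N s1.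
  have := edim_ge0 hC N Z; rewrite eN hNQ /edim cZ' Q0 !addr0 => e1 e2 e3 e4.
  have /eqP : (hdim N Y - bform (cls N) (cls Y)) * k%:Z = 0 by rewrite -e4; lia.
  by rewrite mulf_eq0 eqz_nat (gtn_eqF k0) orbF => /eqP.
have hKN : hdim K N = 0 by have [] := hdim_cls0 hC N K0.
have : edim Z N = edim Y N * k%:Z by rewrite /edim (mN N).1 cZ bformMzl; ring.
have := ses_hdim_midl hC N s1; have := ses_edim_sub hC N s2.
have := edim_ge0 hC X N; rewrite eN mul0r hKN /edim cX K0 !add0r => e1 e2 e3 e4.
by apply/le_anti; rewrite e1 andbT; lia.
Qed.

End MutationMoves.

Section DualMutation.
Variables (L : bilLattice) (C : hcat_data L) (hC : hereditary C).
Implicit Types (M N K X Y Z I Q R W : C) (Xs Ys As Bs : seq C).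

Lemma is_root_op (a : L) : is_root (a : bilLattice_op L) <-> is_root a.
Proof. by split=> -[a0 ra]; split=> // x; have [? ?] := ra x. Qed.

Lemma symform_op (x y : L) : symform (x : bilLattice_op L) y = symform x y.
Proof. exact: addrC. Qed.

Lemma srefl_op (a x : L) : srefl (a : bilLattice_op L) x = srefl a x.
Proof. by rewrite /srefl !symform_op. Qed.

Lemma exceptional_op (E : seq L) : exceptional E ->
  exceptional (rev E : seq (bilLattice_op L)).
Proof.
move=> oE; elim: E oE => [|a E IHE]; first by move=> _; apply: exceptional_nil.
case/exceptional_cons=> ra oE aE; rewrite rev_cons -cats1; apply/exceptional_cat.
split; [exact: IHE|apply/exceptional_cons; split=> //|].
- exact/is_root_op.
- by move=> e f; rewrite mem_rev => eE; rewrite inE => /eqP->; apply: aE.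
Qed.

Lemma complete_op (E : seq L) : complete E -> complete (rev E : seq (bilLattice_op L)).
Proof.
move/completeP=> cE; apply/completeP => x.
apply: (@spn_sub (bilLattice_op L) E) (cE x) => a aE.
by apply: spn_mem; rewrite mem_rev.
Qed.

Lemma pairwise_rev T (r : rel T) (s : seq T) :
  pairwise r (rev s) = pairwise (fun x y => r y x) s.
Proof.
elim: s => //= x s IHs; rewrite rev_cons -cats1 pairwise_cat IHs /= !andbT allrel1r.
by rewrite all_rev.
Qed.

Lemma mseq_op Xs : mseq Xs -> mseq (rev Xs : seq (hcat_op C)).
Proof.
case=> oE cE pw rg; split.
- by rewrite map_rev; apply: exceptional_op.
- by rewrite map_rev; apply: complete_op.
- by rewrite pairwise_rev.
- by rewrite all_rev.
Qed.

End DualMutation.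

Section DualMutationMoves.
Variables (L : bilLattice) (C : hcat_data L) (hC : hereditary C).
Implicit Types (M N K X Y Z I Q R W : C) (Xs Ys As Bs : seq C).

Lemma mseq_op_inv Xs : mseq (rev Xs : seq (hcat_op C)) -> mseq Xs.
Proof.
by move=> /mseq_op; rewrite revK => -[oE cE pw rg]; split.
Qed.

Lemma mutation_left As X Y Bs : mseq (As ++ X :: Y :: Bs) ->
  exists R, (cls R = srefl (cls X) (cls Y) \/ cls R = - srefl (cls X) (cls Y)) /\
    mseq (As ++ R :: X :: Bs).
Proof.
move=> /mseq_op; rewrite rev_cat !rev_cons -!cats1 -!catA /=.
move=> /(mutation_right (hereditary_op hC))[R [cR msR]]; exists R; split.
  by rewrite !srefl_op in cR.
by apply: mseq_op_inv; rewrite rev_cat !rev_cons -!cats1 -!catA.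
Qed.

(** Left mutations move the members in between to the left of [X], which makes [X] and [Y] adjacent
    without changing them. *)
Lemma mseq_hom As X Bs Y Cs : mseq (As ++ X :: Bs ++ Y :: Cs) -> 0 < hdim X Y ->
  edim X Y = 0 /\
  ((forall N, edim Y N = 0 -> edim X N = 0) \/ (forall N, edim N X = 0 -> edim N Y = 0)).
Proof.
elim: Bs As => [|B Bs IHB] As /=; first exact: mseq_adjacent_hom.
move/mutation_left=> [R [_ ms]] h0.
by apply: (IHB (As ++ [:: R])) => //; rewrite -catA.
Qed.

End DualMutationMoves.

(** * Filtrations of perpendicular categories *)

Section Filtrations.
Variables (L : bilLattice) (C : hcat_data L) (hC : hereditary C).
Implicit Types (M N K X Y Z I Q R W : C) (Xs Ys As Bs : seq C).

(** The bottom layer [I] is the quotient of a member by a module of class 0; this plays the part of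
    a copy of that member, as isomorphisms are not recorded in the numerical setting. *)
Inductive filtered Xs : C -> Prop :=
| Filtered0 M : cls M = 0 -> filtered Xs M
| FilteredS As X Bs K I M N : Xs = As ++ X :: Bs -> cls K = 0 -> ses K X I ->
    ses I M N -> filtered Xs N -> filtered Xs M.

Lemma filtered_hom0 Xs M W : filtered Xs M -> all (fun X => hdim X W == 0) Xs ->
  hdim M W = 0.
Proof.
elim=> {M} [M M0|As X Bs K I M N -> K0 s1 s2 _ IH] hX.
  by have [] := hdim_cls0 hC W M0.
have {}IH := IH hX; move: hX; rewrite all_cat /= => /and3P[_ /eqP hX _].
have := ses_hdim_midl hC W s2; have := ses_hdim_quo hC W s1; have := hdim_ge0 hC M W.
by rewrite hX IH; lia.
Qed.

Lemma filtered_cls Xs M (P : L -> Prop) : P 0 -> (forall x y, P x -> P y -> P (x + y)) ->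
  (forall As X Bs, Xs = As ++ X :: Bs -> P (cls X)) -> filtered Xs M -> P (cls M).
Proof.
move=> P0 PD PX; elim=> {M} [M ->|As X Bs K I M N eX K0 s1 s2 _ IH] //.
rewrite (ses_cls hC s2); apply: PD => //.
by have := PX _ _ _ eX; rewrite (ses_cls hC s1) K0 add0r.
Qed.

Lemma filtered_rcons Xs X M : filtered Xs M -> filtered (rcons Xs X) M.
Proof.
elim=> {M} [M M0|As Y Bs K I M N -> K0 s1 s2 _ IH]; first exact: Filtered0.
by apply: (FilteredS (As := As) (Bs := rcons Bs X)) s1 s2 IH; rewrite // rcons_cat.
Qed.

(** The composite of a nonzero map X -> K with the inclusion of [K] is a nonzero endomorphism of
    [X], with image [I']. Composition lies outside the numerical laws, so this consequence is
    assumed separately. *)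
Hypothesis image_in_kernel : forall K X I, ses K X I -> 0 < hdim X K ->
  exists K' I' Q' Q'', [/\ ses K' X I', ses I' K Q', ses I' X Q'' & cls I' <> 0].

(** A nonzero map X -> K would be an injective endomorphism of [X]; then [K] would have at least the
    height of [X] and [I] would vanish. *)
Lemma brick_hom_kernel X K I : brick X -> ses K X I -> cls I <> 0 -> hdim X K = 0.
Proof.
move=> bX s I0; apply/eqP; rewrite eq_le (hdim_ge0 hC) andbT leNgt.
apply/negP => /(image_in_kernel s)[K' [I' [Q' [Q'' [s1 s2 s3 I'0]]]]].
have K'0 := bX _ _ _ s1 s3 I'0.
have := ses_cls hC s; rewrite (ses_cls hC s1) K'0 add0r (ses_cls hC s2) -addrA => /eqP.
rewrite -subr_eq0 opprD addrA subrr add0r oppr_eq0 => /eqP/(congr1 (ht C)).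
rewrite (htD hC) (ht0 hC) => e0; apply/I0/(ht_eq0 hC).
by have := ht_ge0 hC Q'; have := ht_ge0 hC I; lia.
Qed.

(** By induction on [Xs]. A nonzero map from the last member X to [M] turns out to be injective up
    to class 0, and splitting off its image lowers the height; modules without maps from X are
    filtered by the remaining members. *)
Lemma perp_filtered Xs Ys M : mseq (Xs ++ Ys) ->
  pairwise (fun X X' => hdim X X' == 0) Xs -> perp [::] Ys M -> filtered Xs M.
Proof.
elim/last_ind: Xs Ys M => [|Xs X IHXs] Ys M ms hX pM.
  have [oE cE _ _] := ms; apply: Filtered0.
  exact: (perp_spn (As := [::]) (Ys := [::]) oE cE pM).
rewrite cat_rcons in ms; rewrite -cats1 pairwise_cat allrel1r /= andbT in hX.
have [hXsX hXs] := andP hX.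
have bX := mseq_brick hC ms; have rX := mseq_root ms.
have [_ _ _ /eqP rgX] : [/\ True, True, True & rigid X].
  by split=> //; case: ms => _ _ _; rewrite all_cat /= => /and3P[].
have pX : perp [::] Ys X.
  have := @mseq_perp _ _ Xs [:: X] Ys ms; rewrite /= andbT => /andP[_ pB].
  by rewrite /perp /= pB.
(* Extending [N] by copies of [X] on top, until Ext(X, R) vanishes as well, produces a module [R] to
   which the induction hypothesis applies. *)
have phase1 N : hdim X N = 0 -> perp [::] Ys N -> filtered Xs N.
  move=> hXN pN.
  have bX' : brick (X : hcat_op C) by apply/brick_op.
  have rX' : is_root (cls (X : hcat_op C)) by apply/is_root_op.
  have [R [j [cR [hR eR] upR dnR ER]]] :=
    extension_iter (hereditary_op hC) bX' rX' (hXN : hdim (N : hcat_op C) X = 0).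
  have pR : perp [::] (X :: Ys) R.
    rewrite /perp /= [hdim X R](hR : hdim X R = 0) eqxx.
    have -> : bform (cls X) (cls R) = 0.
      by move: eR hR; rewrite /edim /=; lia.
    rewrite eqxx /=; elim: Ys pN pX {ms pM} => //= Y Ys IH.
    move=> /andP[_ /andP[/andP[/eqP h1 /eqP x1] pN]] /andP[_ /andP[/andP[/eqP h2 /eqP x2] pX]].
    have h3 : hdim Y R = 0.
      by apply/le_anti; rewrite (hdim_ge0 hC) andbT -h1; apply: dnR.
    rewrite h3 eqxx /=; apply/andP; split; last exact: IH.
    by rewrite cR bformDr bformMzr x1 x2 mul0r.
  have fR := IHXs _ _ ms hXs pR; have hRX := filtered_hom0 fR hXsX.
  (* If any extension was made, [X] would be a quotient of [R], against Hom(R, X) = 0; so [R] is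
     [N]. *)
  case: ER => [eRN|[N' sN']]; first by rewrite -eRN.
  have := ses_hdim_quo hC X (sN' : @ses L C N' R X); rewrite hRX rgX => le0.
  by have := root_gt0 rX; lia.
have [m] := ubnP `|ht C (cls M)|%N; elim: m M pM => // m IHm M pM; rewrite ltnS => ltm.
have [h0|hn0] := eqVneq (hdim X M) 0; first exact/filtered_rcons/phase1.
have h0 : 0 < hdim X M by rewrite lt0r hn0 (hdim_ge0 hC).
have [K [I [Q [s1 s2 I0]]]] := factorisation hC h0.
have [pK pI pQ] := perp_image hC s1 s2 pX pM.
have hXK := brick_hom_kernel bX s1 I0.
have fK := phase1 K hXK pK.
(* A bottom layer of [K] would give a nonzero map from another member to [X], against
   Hom-orthogonality. *)
have K0 : cls K = 0.
  have ms' := ms; case: fK s1 => // As X' Bs K1 I1 N N1 eXs K10 s3 s4 _ s1.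
  move: ms' hXsX; rewrite eXs -catA /= all_cat /= => ms' /and3P[_ /eqP hX'X _].
  have rX' := mseq_root ms'.
  have X'0 : cls X' <> 0 by move=> X'0; have := root_gt0 rX'; rewrite X'0 bform0l ltxx.
  have I10 : cls I1 <> 0 by have := ses_cls hC s3; rewrite K10 add0r => <-.
  have := ses_hdim_quo hC I1 s3; have := hdim_id hC I10.
  have := ses_hdim_sub hC X' s4; have := ses_hdim_sub hC X' s1.
  have := ses_hdim_sub hC I1 s4; have := ses_hdim_sub hC I1 s1.
  have := ses_hdim_quo hC X s3; rewrite hX'X; lia.
apply: (FilteredS (As := Xs) (Bs := [::]) _ K0 s1 s2); first by rewrite cats1.
apply: IHm => //; apply: leq_trans ltm.
have := congr1 (ht C) (ses_cls hC s2); rewrite (htD hC) => e1.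
have := ht_gt0 hC I0; have := ht_ge0 hC Q; have := ht_ge0 hC M; lia.
Qed.

(** Let I be the image of a nonzero map Y -> M. Rigidity of Y gives Ext(Y, I) = 0, so <Y, I> is the
    dimension of Hom(Y, I) and positive; but Hom(Y', I) embeds in Hom(Y', M) = 0, so <Y', I> is at
    most 0. The two numbers are equal, although Y and Y' need not be isomorphic. *)
Lemma semistable_hom0 Y Y' M : rigid Y -> cls Y = cls Y' -> hdim Y' M = 0 ->
  bform (cls Y) (cls M) = 0 -> hdim Y M = 0.
Proof.
move=> /eqP rgY eY hY'M yM; apply/eqP; rewrite eq_le (hdim_ge0 hC) andbT leNgt.
apply/negP => /(factorisation hC)[K [I [Q [s1 s2 I0]]]].
have := ses_edim_quo hC Y s1; have := ses_hdim_sub hC Y' s2.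
have := edim_ge0 hC Y' I; have := edim_ge0 hC Y I.
have := ses_hdim_quo hC I s1; have := hdim_id hC I0.
rewrite /edim rgY hY'M eY; lia.
Qed.

Lemma semistable_perp Ys Ys' M : all (@rigid L C) Ys ->
  map (@cls L C) Ys = map (@cls L C) Ys' -> perp [::] Ys' M -> perp [::] Ys M.
Proof.
rewrite /perp /=; elim: Ys Ys' => [|Y Ys IH] [|Y' Ys'] //= /andP[rgY rgYs] [eY eYs].
move=> /andP[/andP[/eqP h /eqP x] p]; rewrite (IH _ rgYs eYs p) andbT.
have x' : bform (cls Y) (cls M) = 0 by rewrite eY.
by rewrite (semistable_hom0 rgY eY h x') x' !eqxx.
Qed.

(** Where Hom is nonzero, Ext vanishes by [mseq_hom], and the form would be positive. *)
Lemma mseq_hom_orthogonal As Xs Bs : mseq (As ++ Xs ++ Bs) ->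
  pairwise (fun X X' => bform (cls X) (cls X') <= 0) Xs ->
  pairwise (fun X X' => hdim X X' == 0) Xs.
Proof.
elim: Xs As => //= X Xs IH As ms /andP[oX oXs]; apply/andP; split; last first.
  by apply: (IH (rcons As X)); rewrite ?cat_rcons.
have H As' Xs' : mseq (As ++ X :: As' ++ Xs' ++ Bs) ->
    all (fun X' => bform (cls X) (cls X') <= 0) Xs' -> all (fun X' => hdim X X' == 0) Xs'.
  elim: Xs' As' => //= X' Xs' IH' As' ms' /andP[oX' oXs'].
  rewrite (IH' (rcons As' X')) ?cat_rcons // andbT.
  rewrite eq_le (hdim_ge0 hC) andbT leNgt; apply/negP => h0.
  by have [e0 _] := mseq_hom hC ms' h0; move: e0 h0; rewrite /edim; lia.
exact: (H [::]).
Qed.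

(** The modules of [Xs'] are perpendicular to [Ys'], hence to [Ys], hence filtered by [Xs]. The
    additive predicate [P] will be membership in the monoid generated by the classes of [Xs]. *)
Lemma orthogonal_cone Xs Ys Xs' Ys' (P : L -> Prop) : mseq (Xs ++ Ys) -> mseq (Xs' ++ Ys') ->
  map (@cls L C) Ys = map (@cls L C) Ys' ->
  pairwise (fun X X' => bform (cls X) (cls X') <= 0) Xs ->
  P 0 -> (forall x y, P x -> P y -> P (x + y)) ->
  (forall x, x \in map (@cls L C) Xs -> P x) ->
  forall x, x \in map (@cls L C) Xs' -> P x.
Proof.
move=> ms ms' eYs oX P0 PD PX.
have hX := mseq_hom_orthogonal (As := [::]) ms oX.
have rgY : all (@rigid L C) Ys by case: ms => _ _ _; rewrite all_cat => /andP[].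
have H X' : perp [::] Ys' X' -> P (cls X').
  move=> /(semistable_perp rgY eYs)/(perp_filtered ms hX).
  apply: filtered_cls => // As X Bs eXs; apply: PX.
  by rewrite eXs map_cat mem_cat /= inE eqxx orbT.
have := mseq_perp (As := [::]) (Ys := Xs') (Bs := Ys') ms'.
elim: Xs' {ms'} => //= X' Xs' IH /andP[p1 p2] x.
by rewrite inE => /predU1P[->|]; [apply: H|apply: IH].
Qed.

End Filtrations.

(** * Representations of species *)

Section LinearAlgebra.
Variable F : fieldType.

Definition linear_closed_prop (vT : vectType F) (P : vT -> Prop) :=
  P 0 /\ forall a u v, P u -> P v -> P (a *: u + v).

(** A subspace of maximal dimension among those inside [P] exhausts [P]. *)
Lemma vspace_exists (vT : vectType F) (P : vT -> Prop) : linear_closed_prop P ->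
  exists U : {vspace vT}, forall v, v \in U <-> P v.
Proof.
move=> [P0 PD].
pose good m := `[< exists2 U : {vspace vT}, (forall v, v \in U -> P v) & \dim U = m >].
have ex0 : exists m, good m.
  by exists 0%N; apply/asboolP; exists 0%VS; rewrite ?dimv0 // => v; rewrite memv0 => /eqP->.
have ub m : good m -> (m <= dim vT)%N.
  by move=> /asboolP[U _ <-]; rewrite -dimvf dimvS // subvf.
case: (ex_maxnP ex0 ub) => m /asboolP[U UP dU] maxm.
exists U => v; split=> [/UP //|Pv].
have : good (\dim (<[v]> + U)%VS).
  apply/asboolP; exists (<[v]> + U)%VS => // w /memv_addP[_ /vlineP[a ->]] [u uU ->].
  by apply: PD => //; apply: UP.
move/maxm; rewrite -dU => le_dim.
have /eqP -> : U == (<[v]> + U)%VS by rewrite eqEdim addvSr.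
exact/(subvP (addvSl _ _))/memv_line.
Qed.

Definition vsp (vT : vectType F) (P : vT -> Prop) : {vspace vT} :=
  xget 0%VS [set U : {vspace vT} | forall v, v \in U <-> P v].

Lemma vspE (vT : vectType F) (P : vT -> Prop) v : linear_closed_prop P -> v \in vsp P <-> P v.
Proof. by move=> /vspace_exists[U UP]; rewrite /vsp; case: xgetP => [V _ /(_ v)|/(_ U)]. Qed.

Lemma lin_hom (A B : vectType F) (f : A -> B) : (forall a, {morph f : u v / a *: u + v}) ->
  exists g : 'Hom(A, B), g =1 f.
Proof.
move=> flin.
pose fL : {linear A -> B} := HB.pack f (GRing.isLinear.Build F A B *:%R f flin).
by exists (linfun fL) => v; rewrite lfunE.
Qed.

Lemma dim_iso (A B : vectType F) (f : A -> B) (U : {vspace A}) (W : {vspace B}) :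
  (forall a, {morph f : u v / a *: u + v}) -> (forall u, u \in U -> f u \in W) ->
  (forall u, u \in U -> f u = 0 -> u = 0) ->
  (forall w, w \in W -> exists2 u, u \in U & f u = w) -> \dim U = \dim W.
Proof.
move=> /lin_hom[g gf] fUW finj fsurj.
have <- : (g @: U)%VS = W.
  apply/eqP; rewrite eqEsubv; apply/andP; split; apply/subvP => w.
    by case/memv_imgP=> u uU ->; rewrite gf fUW.
  by case/fsurj=> u uU <-; rewrite -gf memv_img.
rewrite limg_dim_eq //; apply/eqP; rewrite -subv0; apply/subvP => u.
by rewrite memv_cap memv_ker gf memv0 => /andP[uU /eqP/(finj _ uU)->].
Qed.

(** The map induced from U / U' to W / W' is onto; the dimensions are arranged so that nothing is
    subtracted. *)
Lemma codim_le (A B : vectType F) (f : A -> B) (U U' : {vspace A}) (W W' : {vspace B}) :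
  (forall a, {morph f : u v / a *: u + v}) ->
  (forall w, w \in W -> exists2 u, u \in U & f u = w) ->
  (forall u, u \in U' -> f u \in W') -> (U' <= U)%VS ->
  (\dim W + \dim U' <= \dim U + \dim W')%N.
Proof.
move=> /lin_hom[g gf] fsurj fUW' sU'U.
have leW : (\dim W <= \dim (g @: U))%N.
  by apply/dimvS/subvP => w /fsurj[u uU <-]; rewrite -gf memv_img.
have leW' : (\dim (g @: U') <= \dim W')%N.
  by apply/dimvS/subvP => w /memv_imgP[u uU' ->]; rewrite gf fUW'.
have leK : (\dim (U' :&: lker g) <= \dim (U :&: lker g))%N by rewrite dimvS // capvS.
have := limg_ker_dim g U; have := limg_ker_dim g U'; lia.
Qed.

Lemma dim_ker_img (A B : vectType F) (f : A -> B) (U : {vspace A}) :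
  (forall a, {morph f : u v / a *: u + v}) ->
  exists (K : {vspace A}) (W : {vspace B}), [/\ forall u, u \in K <-> u \in U /\ f u = 0,
    forall w, w \in W <-> exists2 u, u \in U & f u = w & (\dim K + \dim W = \dim U)%N].
Proof.
move=> /lin_hom[g gf]; exists (U :&: lker g)%VS, (g @: U)%VS; split.
- by move=> u; rewrite memv_cap memv_ker gf; split=> [/andP[uU /eqP fu]|[uU fu]]; rewrite ?uU ?fu ?eqxx.
- move=> w; split=> [/memv_imgP[u uU ->]|[u uU <-]]; first by exists u.
  by rewrite -gf memv_img.
- exact: limg_ker_dim.
Qed.

Lemma dim_ffun (A : finType) (vT : vectType F) (U : A -> {vspace vT})
    (V : {vspace {ffun A -> vT}}) :
  (forall c : {ffun A -> vT}, c \in V <-> forall a, c a \in U a) ->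
  \dim V = (\sum_a \dim (U a))%N.
Proof.
suff H s : uniq s -> forall V : {vspace {ffun A -> vT}},
    (forall c : {ffun A -> vT}, c \in V <-> forall a, if a \in s then c a \in U a else c a == 0) ->
    \dim V = (\sum_(a <- s) \dim (U a))%N.
  move=> VE; rewrite (H _ (index_enum_uniq A) V) // => c; split=> [/VE cU a|cU].
    by rewrite mem_index_enum.
  by apply/VE => a; have := cU a; rewrite mem_index_enum.
elim: s => [|a s IHs] /= => [_ {}V VE|/andP[as' us] {}V VE].
  rewrite big_nil; apply/eqP; rewrite dimv_eq0 -subv0; apply/subvP => c /VE c0.
  by rewrite memv0; apply/eqP/ffunP => a; rewrite (eqP (c0 a)) ffunE.
rewrite big_cons.
have ev_lin b : {morph (fun c : {ffun A -> vT} => c a) : u v / b *: u + v}.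
  by move=> u v; rewrite !ffunE.
have [K [W [KE WE <-]]] := dim_ker_img V ev_lin.
rewrite addnC; congr (_ + _)%N.
  congr (\dim _); apply/eqP; rewrite eqEsubv; apply/andP; split; apply/subvP => w.
    by case/WE=> c /VE/(_ a) + <-; rewrite inE eqxx.
  move=> wU; apply/WE; exists [ffun b => if b == a then w else 0]; last by rewrite ffunE eqxx.
  apply/VE => b; rewrite inE ffunE; case: eqP => [->//|_] /=.
  by case: (b \in s); rewrite ?mem0v.
apply: IHs => // c; split=> [/KE[/VE cU c0] b|cU].
  by have := cU b; rewrite inE; case: eqP => [-> _|//]; rewrite (negPf as') c0.
have ca : c a = 0 by apply/eqP; have := cU a; rewrite (negPf as').
apply/KE; split=> //; apply/VE => b; rewrite inE; case: eqP => [->|_ /=]; last exact: cU.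
by rewrite ca mem0v.
Qed.

(** Splitting of an idempotent, by its rank factorisation. *)
Lemma idem_factor m (e : 'M[F]_m) : e *m e = e ->
  exists r (x : 'M[F]_(m, r)) (u : 'M[F]_(r, m)), [/\ x *m u = e, u *m x = 1%:M & r = \rank e].
Proof.
move=> ee; suff H r (x : 'M_(m, r)) (u : 'M_(r, m)) : row_full x -> row_free u ->
    x *m u = e -> u *m x = 1%:M.
  exists (\rank e), (col_base e), (row_base e); split=> //; first exact: mulmx_base.
  by apply: H; [apply: col_base_full|apply: row_base_free|apply: mulmx_base].
move=> fx fu xu; apply: (row_free_inj fu); rewrite mul1mx.
have := congr1 (mulmx (pinvmx x)) ee.
by rewrite -xu !mulmxA (mulVpmx fx) !mul1mx.
Qed.

End LinearAlgebra.

(** Compare 2-adic valuations. *)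
Lemma dvdn_pow2_root (g m : nat) (x : rat) : x ^+ g = 2 ^+ m -> (g %| m)%N.
Proof.
case: (posnP g) => [->|g0].
  rewrite expr0 dvd0n; case: m => // m /eqP.
  by rewrite eq_sym gt_eqF // exprn_egt1.
move=> xg; have x0 : x != 0.
  by apply/eqP => x0; move/eqP: xg; rewrite x0 expr0n gtn_eqF //= eq_sym expf_eq0 andbF.
have h : (`|numq x| ^ g = 2 ^ m * `|denq x| ^ g)%N.
  have: (numq x ^+ g)%:~R = (2 ^+ m * denq x ^+ g)%:~R :> rat.
    rewrite rmorphM !rmorphXn /= -xg -{2}(divq_num_den x) -exprMn mulfVK //.
    by rewrite intr_eq0 denq_neq0.
  by move/intr_inj/(congr1 absz); rewrite abszM !abszX.
have d0 : (0 < `|denq x|)%N by rewrite absz_gt0 denq_neq0.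
have n0 : (0 < `|numq x|)%N by rewrite absz_gt0 numq_eq0.
have := congr1 (logn 2) h; rewrite lognM ?expn_gt0 ?d0 // pfactorK // !lognX.
move=> e; have -> : m = (g * logn 2 `|numq x| - g * logn 2 `|denq x|)%N by rewrite e addnK.
by rewrite dvdn_sub // dvdn_mulr.
Qed.

(** * Spaces over Q(2^(1/g)) as rational spaces with a g-th root of 2 *)

Section Commutant.
Implicit Types (m g : nat).

(** Determinants give det(S)^g = 2^m. This replaces the theory of the field extension: the dimension
    of a space over Q(2^(1/g)) is a multiple of g. *)
Lemma sqr2_dvd m g (S : 'M[rat]_m) : S ^+ g = 2%:M -> (g %| m)%N.
Proof.
move=> Sg; apply: (@dvdn_pow2_root _ _ (\det S)).
rewrite -[RHS]det_scalar -Sg; elim: g {Sg} => [|g IHg]; first by rewrite expr0 det1.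
by rewrite !exprS -mulmxE det_mulmx IHg.
Qed.

Lemma stable_rank_dvd m g (S : 'M[rat]_m) k (U : 'M[rat]_(k, m)) : S ^+ g = 2%:M ->
  (U *m S <= U)%MS -> (g %| \rank U)%N.
Proof.
move=> Sg US; pose u := row_base U; pose S' := u *m S *m pinvmx u.
have uS : S' *m u = u *m S.
  by rewrite mulmxKpV // (eqmxMr S (eq_row_base U)) eq_row_base.
apply: (@sqr2_dvd _ _ S').
have uSk k' : S' ^+ k' *m u = u *m S ^+ k'.
  elim: k' => [|k' IHk]; first by rewrite !expr0 mul1mx mulmx1.
  by rewrite !exprSr -!mulmxE -mulmxA uS mulmxA IHk mulmxA.
apply: (row_free_inj (row_base_free U)); rewrite uSk Sg.
by rewrite mul_mx_scalar mul_scalar_mx.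
Qed.

(** Its row space is the span of the rows of [P] over Q(2^(1/g)) once S^g = 2. *)
Definition cyc m a g (S : 'M[rat]_m) (P : 'M[rat]_(a, m)) := (\mxcol_(j < g) (P *m S ^+ j)).

Lemma sub_cyc m a g (S : 'M[rat]_m) (P : 'M[rat]_(a, m)) (j : nat) : S ^+ g = 2%:M ->
  (0 < g)%N -> (P *m S ^+ j <= cyc g S P)%MS.
Proof.
move=> Sg g0; rewrite (divn_eq j g) exprD mulnC exprM Sg.
have -> : 2%:M ^+ (j %/ g) = (2 ^+ (j %/ g))%:M :> 'M[rat]_m.
  by elim: (j %/ g)%N => [|i IHi]; rewrite ?expr0 // !exprS IHi -mulmxE -scalar_mxM.
rewrite -mulmxE mul_scalar_mx -scalemxAr; apply: scalemx_sub.
by rewrite eqmx_col (sumsmx_sup (Ordinal (ltn_pmod j g0))) // genmxE.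
Qed.

Lemma cyc_stable m a g (S : 'M[rat]_m) (P : 'M[rat]_(a, m)) : S ^+ g = 2%:M ->
  (0 < g)%N -> (cyc g S P *m S <= cyc g S P)%MS.
Proof.
move=> Sg g0; rewrite mxcol_mul eqmx_col; apply/sumsmx_subP => j _.
by rewrite genmxE -mulmxA mulmxE -exprSr sub_cyc.
Qed.

(** A basis over Q(2^(1/g)) is a maximal independent [P]. For a row v outside the span, the span of
    v has rank g and meets that of [P] in a stable subspace of rank less than g; ranks of stable
    subspaces are multiples of g, so the intersection is 0 and [P] could be enlarged. *)
Lemma cyc_basis m g (S : 'M[rat]_m) : S ^+ g = 2%:M -> (0 < g)%N ->
  exists a (P : 'M[rat]_(a, m)), row_free (cyc g S P) /\ row_full (cyc g S P) /\ (a * g)%N = m.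
Proof.
move=> Sg g0.
have rowsE a : (\sum_(j < g) a)%N = (a * g)%N by rewrite sum_nat_const card_ord mulnC.
pose good a := `[< exists P : 'M[rat]_(a, m), \rank (cyc g S P) = (a * g)%N >].
have ex0 : exists a, good a.
  exists 0%N; apply/asboolP; exists 0; apply/eqP; rewrite -leqn0.
  by rewrite (leq_trans (rank_leq_row _)) // rowsE.
have ub a : good a -> (a <= m)%N.
  move=> /asboolP[P rP]; apply: leq_trans (rank_leq_col (cyc g S P)).
  by rewrite rP leq_pmulr.
case: (ex_maxnP ex0 ub) => a /asboolP[P rP] maxa; exists a, P.
have freeP : row_free (cyc g S P) by rewrite /row_free rP rowsE.
suff fullP : row_full (cyc g S P) by rewrite freeP fullP -rP (eqP fullP).
rewrite -sub1mx; apply/negPn/negP => /row_subPn[i].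
set v := row i _ => vP.
have vv : (v <= cyc g S v)%MS by have := sub_cyc v 0 Sg g0; rewrite expr0 mulmx1.
have rv : \rank (cyc g S v) = g.
  have dv := stable_rank_dvd Sg (cyc_stable v Sg g0).
  apply/eqP; rewrite eqn_leq (leq_trans (rank_leq_row _)) ?rowsE ?mul1n //=.
  apply: dvdn_leq dv; rewrite lt0n mxrank_eq0; apply: contraNneq vP => cv0.
  by move: vv; rewrite cv0 => /submx0null->; apply: sub0mx.
have cap0 : (cyc g S P :&: cyc g S v = 0)%MS.
  apply/eqP; rewrite -mxrank_eq0.
  have stab : ((cyc g S P :&: cyc g S v)%MS *m S <= cyc g S P :&: cyc g S v)%MS.
    rewrite sub_capmx; apply/andP; split.
      by apply: submx_trans (cyc_stable P Sg g0); apply: submxMr; apply: capmxSl.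
    by apply: submx_trans (cyc_stable v Sg g0); apply: submxMr; apply: capmxSr.
  have dv := stable_rank_dvd Sg stab.
  have : (\rank (cyc g S P :&: cyc g S v)%MS < g)%N.
    rewrite ltn_neqAle; apply/andP; split; last first.
      by apply: leq_trans (mxrankS (capmxSr _ _)) _; rewrite rv.
    apply: contraNneq vP => eqr.
    have [_] := mxrank_leqif_sup (capmxSr (cyc g S P) (cyc g S v)).
    rewrite eqr rv eqxx => /esym s2.
    exact: submx_trans vv (submx_trans s2 (capmxSl _ _)).
  by apply: contraTT => r0; rewrite -leqNgt dvdn_leq // lt0n.
suff : good a.+1 by move/maxa; rewrite ltnn.
apply/asboolP; rewrite -addn1; exists (col_mx P v).
have sub1 : (cyc g S P <= cyc g S (col_mx P v))%MS.
  rewrite {1}/cyc eqmx_col; apply/sumsmx_subP => j _; rewrite genmxE.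
  apply: submx_trans (sub_cyc _ j Sg g0); apply/submxMr.
  by rewrite -addsmxE addsmxSl.
have sub2 : (cyc g S v <= cyc g S (col_mx P v))%MS.
  rewrite {1}/cyc eqmx_col; apply/sumsmx_subP => j _; rewrite genmxE.
  apply: submx_trans (sub_cyc _ j Sg g0); apply/submxMr.
  by rewrite -addsmxE addsmxSr.
apply/eqP; rewrite eqn_leq (leq_trans (rank_leq_row _)) ?rowsE //=.
have : (cyc g S P + cyc g S v <= cyc g S (col_mx P v))%MS by rewrite addsmx_sub sub1.
by move/mxrankS; rewrite (mxrank_disjoint_sum cap0) rP rv mulnDl mul1n.
Qed.

Definition commutes m n (S : 'M[rat]_m) (S' : 'M[rat]_n) (c : 'M[rat]_(m, n)) :=
  S *m c = c *m S'.

Lemma commutes_closed m n (S : 'M[rat]_m) (S' : 'M[rat]_n) : linear_closed_prop (commutes S S').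
Proof.
split=> [|a u v]; rewrite /commutes ?mulmx0 ?mul0mx // => eu ev.
by rewrite mulmxDr mulmxDl -scalemxAr -scalemxAl eu ev.
Qed.

Lemma commutesX m n (S : 'M[rat]_m) (S' : 'M[rat]_n) c k :
  commutes S S' c -> commutes (S ^+ k) (S' ^+ k) c.
Proof.
rewrite /commutes => e; elim: k => [|k IHk]; first by rewrite !expr0 mul1mx mulmx1.
by rewrite !exprS -!mulmxE -mulmxA IHk !mulmxA e.
Qed.

(** The matrices are linear maps over Q(2^(1/g)) between spaces of dimensions m / g and n / g,
    freely determined by the images [P *m c] of a basis. *)
Lemma dim_commutes m n g (S : 'M[rat]_m) (S' : 'M[rat]_n) : (0 < g)%N ->
  S ^+ g = 2%:M -> S' ^+ g = 2%:M -> (\dim (vsp (commutes S S')) * g = m * n)%N.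
Proof.
move=> g0 Sg S'g; have [a [P [freeP [fullP eqm]]]] := cyc_basis Sg g0.
have cl := commutes_closed S S'.
suff -> : \dim (vsp (commutes S S')) = \dim {: 'M[rat]_(a, n)}.
  by rewrite dimvf dim_matrix -mulnA [(n * g)%N]mulnC mulnA eqm.
apply: (dim_iso (f := fun c => P *m c)) => [b u v|u _|u /(vspE _ cl) cu Pu|w _].
- by rewrite mulmxDr -scalemxAr.
- exact: memvf.
- have Q0 : cyc g S P *m u = 0.
    rewrite mxcol_mul -[RHS]mxcol0; apply: eq_mxcol => j.
    by rewrite -mulmxA (commutesX j cu) mulmxA Pu mul0mx.
  by rewrite -[u]mul1mx -(mulVpmx fullP) -mulmxA Q0 mulmx0.
pose R := \mxcol_(j < g) (w *m S' ^+ j); pose c := pinvmx (cyc g S P) *m R.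
have Qc : cyc g S P *m c = R by rewrite mulmxA mulmxVp // mul1mx.
have Pc (j : 'I_g) : P *m S ^+ j *m c = w *m S' ^+ j.
  by have := congr1 (fun M => submxcol M j) Qc; rewrite mxcol_mul !mxcolK.
(* Exponents from g on are reduced by S^g = 2 on both sides. *)
have Pc' j : P *m S ^+ j *m c = w *m S' ^+ j.
  rewrite (divn_eq j g) addnC !exprD mulnC !exprM Sg S'g.
  have sc k p : (2%:M : 'M[rat]_p) ^+ k = (2 ^+ k)%:M.
    by elim: k => [|k IHk]; rewrite ?expr0 // !exprS IHk -mulmxE -scalar_mxM.
  rewrite !sc -!mulmxE !mul_mx_scalar -!scalemxAr -scalemxAl.
  by congr (_ *: _); apply: (Pc (Ordinal (ltn_pmod j g0))).
exists c; last by have := Pc' 0%N; rewrite !expr0 !mulmx1.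
apply/(vspE _ cl); rewrite /commutes; move: c Pc' {Qc Pc} => c Pc.
have : cyc g S P *m (S *m c) = cyc g S P *m (c *m S').
  rewrite /cyc !mxcol_mul; apply: eq_mxcol => j.
  by rewrite !mulmxA -[P *m _ *m S]mulmxA mulmxE -exprSr !Pc -mulmxA mulmxE -exprSr.
move/(congr1 (mulmx (pinvmx (cyc g S P)))).
by rewrite !mulmxA (mulVpmx fullP) !mul1mx.
Qed.

Definition idem_commutes m n (e S : 'M[rat]_m) (e' S' : 'M[rat]_n) (c : 'M[rat]_(m, n)) :=
  [/\ e *m c = c, c *m e' = c & S *m c = c *m S'].

Lemma idem_commutes_closed m n (e S : 'M[rat]_m) (e' S' : 'M[rat]_n) :
  linear_closed_prop (idem_commutes e S e' S').
Proof.
split=> [|a u v]; first by split; rewrite ?mulmx0 ?mul0mx.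
case=> [u1 u2 u3] [v1 v2 v3].
by split; rewrite ?mulmxDr ?mulmxDl -?scalemxAr -?scalemxAl ?u1 ?u2 ?u3 ?v1 ?v2 ?v3.
Qed.

Lemma idem_power r m g (e S : 'M[rat]_m) (x : 'M[rat]_(m, r)) (u : 'M[rat]_(r, m)) :
  x *m u = e -> u *m x = 1%:M -> S *m e = e *m S -> S ^+ g *m e = 2 *: e ->
  (u *m S *m x) ^+ g = 2%:M.
Proof.
move=> xu ux Se Sge; have ue : u *m e = u by rewrite -xu mulmxA ux mul1mx.
have pw k : (u *m S *m x) ^+ k = u *m S ^+ k *m x.
  elim: k => [|k IHk]; first by rewrite !expr0 mulmx1 ux.
  rewrite exprSr IHk -mulmxE !mulmxA -[_ *m x *m u]mulmxA xu -[u *m _ *m e]mulmxA.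
  have -> : S ^+ k *m e = e *m S ^+ k.
    elim: k {IHk} => [|k IHk]; first by rewrite expr0 mul1mx mulmx1.
    by rewrite !exprSr -!mulmxE -mulmxA Se !mulmxA IHk.
  by rewrite !mulmxA ue -[u *m _ *m S]mulmxA mulmxE -exprSr.
have ex : e *m x = x by rewrite -xu -mulmxA ux mulmx1.
rewrite pw -[x in LHS]ex mulmxA -[u *m _ *m e]mulmxA Sge.
by rewrite -scalemxAr -scalemxAl ue ux scalemx1.
Qed.

(** Splitting both idempotents identifies the block with the matrices intertwining the compressions
    [u *m S *m x] and [u' *m S' *m x']. *)
Lemma dim_idem_commutes m n g (e S : 'M[rat]_m) (e' S' : 'M[rat]_n) : (0 < g)%N ->
  e *m e = e -> e' *m e' = e' -> S *m e = e *m S -> S' *m e' = e' *m S' ->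
  S ^+ g *m e = 2 *: e -> S' ^+ g *m e' = 2 *: e' ->
  (\dim (vsp (idem_commutes e S e' S')) * g = \rank e * \rank e')%N.
Proof.
move=> g0 ee ee' Se Se' Sge Sge'.
have [r [x [u [xu ux <-]]]] := idem_factor ee.
have [r' [x' [u' [xu' ux' <-]]]] := idem_factor ee'.
rewrite -(dim_commutes g0 (idem_power xu ux Se Sge) (idem_power xu' ux' Se' Sge')).
congr (_ * _)%N; have cl := idem_commutes_closed e S e' S'.
have cl' := commutes_closed (u *m S *m x) (u' *m S' *m x').
have ue : u *m e = u by rewrite -xu mulmxA ux mul1mx.
have ex : e *m x = x by rewrite -xu -mulmxA ux mulmx1.
have ue' : u' *m e' = u' by rewrite -xu' mulmxA ux' mul1mx.
have ex' : e' *m x' = x' by rewrite -xu' -mulmxA ux' mulmx1.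
apply: (dim_iso (f := fun c => u *m c *m x')) => [b c1 c2|c|c|w].
- by rewrite mulmxDr mulmxDl -scalemxAr -scalemxAl.
- move/(vspE _ cl)=> [c1 c2 c3]; apply/(vspE _ cl'); rewrite /commutes.
  have -> : u *m S *m x *m (u *m c *m x') = u *m (S *m c) *m x'.
    by rewrite !mulmxA -[_ *m x *m u]mulmxA xu -[u *m S *m e]mulmxA Se !mulmxA ue.
  rewrite c3 !mulmxA -[_ *m x' *m u']mulmxA xu' -[_ *m c *m e']mulmxA c2.
  by [].
- move/(vspE _ cl)=> [c1 c2 c3] f0.
  by rewrite -c2 -c1 -xu -xu' -!mulmxA [u *m _]mulmxA [_ *m (x' *m u')]mulmxA f0 mul0mx mulmx0.
move/(vspE _ cl')=> cw; exists (x *m w *m u').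
  apply/(vspE _ cl); split; first by rewrite !mulmxA ex.
    by rewrite -[_ *m u' *m e']mulmxA ue'.
  have e1 : S *m x = x *m (u *m S *m x).
    by rewrite !mulmxA xu -Se -mulmxA ex.
  have e2 : u' *m S' = (u' *m S' *m x') *m u'.
    by rewrite -[_ *m x' *m u']mulmxA xu' -mulmxA Se' mulmxA ue'.
  by rewrite !mulmxA e1 -[_ *m w]mulmxA cw -[RHS]mulmxA [in RHS]e2 !mulmxA.
by rewrite !mulmxA ux mul1mx -mulmxA ux' mulmx1.
Qed.

End Commutant.

Lemma dim_le (F : fieldType) (A B : vectType F) (f : A -> B) (U : {vspace A}) (W : {vspace B}) :
  (forall a, {morph f : u v / a *: u + v}) -> (forall u, u \in U -> f u \in W) ->
  (forall u, u \in U -> f u = 0 -> u = 0) -> (\dim U <= \dim W)%N.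
Proof.
move=> flin fUW finj; have [K [V [KE VE <-]]] := dim_ker_img U flin.
have -> : K = 0%VS.
  by apply/eqP; rewrite -subv0; apply/subvP => u /KE[uU /(finj _ uU)->]; apply: mem0v.
by rewrite dimv0; apply/dimvS/subvP => w /VE[u uU <-]; apply: fUW.
Qed.

(* Representations of the species over rat with vertex fields
   Q(2 ^ (1 / d i)): T acts on the i-th summand as a d i-th root of 2, and an
   arrow i -> j is linear over the intersection Q(2 ^ (1 / gcd (d i) (d j))).
   Row vectors are used, so that maps compose from left to right. *)
Section Species.
Variables (n : nat) (d : 'I_n -> nat) (B : nat).

(** Every ordered pair has [B] slots whatever the multiplicities are, so that the type of arrows is
    shared by a species and its opposite; slots that are not active have to act as 0. *)
Definition arrow : finType := ('I_n * 'I_n * 'I_B)%type.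

Section Representations.
Variable mu : 'I_n -> 'I_n -> nat.

Definition active (a : arrow) := (a.2 < mu a.1.1 a.1.2)%N.
Definition agcd (a : arrow) := gcdn (d a.1.1) (d a.1.2).

(** With g the gcd of the two degrees, both powers are g-th roots of 2 on their vertex spaces, so
    intertwining them is linearity over Q(2^(1/g)). *)
Definition arrow_ok m m' (e : 'I_n -> 'M[rat]_m) (T : 'M[rat]_m)
    (e' : 'I_n -> 'M[rat]_m') (T' : 'M[rat]_m') (a : arrow) (c : 'M[rat]_(m, m')) :=
  if active a then
    idem_commutes (e a.1.1) (T ^+ (d a.1.1 %/ agcd a)) (e' a.1.2) (T' ^+ (d a.1.2 %/ agcd a)) c
  else c = 0.

(** The vertex spaces are the images of orthogonal idempotents of a single space, which keeps all
    structure maps and morphisms plain matrices. *)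
Definition rep_law m (e : 'I_n -> 'M[rat]_m) (T : 'M[rat]_m) (r : arrow -> 'M[rat]_m) :=
  [/\ forall i j, e i *m e j = if i == j then e i else 0, \sum_i e i = 1%:M,
      forall i, T *m e i = e i *m T, forall i, T ^+ d i *m e i = 2 *: e i
    & forall a, arrow_ok e T e T a (r a)].

Record rep := Rep {
  rdim : nat;
  re : 'I_n -> 'M[rat]_rdim;
  rT : 'M[rat]_rdim;
  rr : arrow -> 'M[rat]_rdim;
  repP : rep_law re rT rr
}.

Implicit Types (M N K X Y Z I Q R : rep).

Definition hom0 M N (f : 'M[rat]_(rdim M, rdim N)) :=
  (forall i, re M i *m f = f *m re N i) /\ rT M *m f = f *m rT N.

Definition hom M N (f : 'M[rat]_(rdim M, rdim N)) :=
  hom0 f /\ forall a, rr M a *m f = f *m rr N a.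

Definition hom1 M N (c : {ffun arrow -> 'M[rat]_(rdim M, rdim N)}) :=
  forall a, arrow_ok (re M) (rT M) (re N) (rT N) a (c a).

Lemma hom0_closed M N : linear_closed_prop (@hom0 M N).
Proof.
split=> [|a u v [u1 u2] [v1 v2]]; first by split=> *; rewrite mulmx0 mul0mx.
by split=> *; rewrite mulmxDr mulmxDl -scalemxAr -scalemxAl ?u1 ?v1 ?u2 ?v2.
Qed.

Lemma hom_closed M N : linear_closed_prop (@hom M N).
Proof.
have [z0 c0] := hom0_closed M N.
split=> [|a u v [u0 u1] [v0 v1]]; split=> //; last 2 first.
- exact: c0.
- by move=> b; rewrite mulmxDr mulmxDl -scalemxAr -scalemxAl u1 v1.
by move=> a; rewrite mulmx0 mul0mx.
Qed.

Lemma arrow_ok_closed M N a : linear_closed_prop (arrow_ok (re M) (rT M) (re N) (rT N) a).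
Proof.
rewrite /arrow_ok; case: (active a); first exact: idem_commutes_closed.
by split=> // b u v -> ->; rewrite scaler0 addr0.
Qed.

Lemma hom1_closed M N : linear_closed_prop (@hom1 M N).
Proof.
split=> [a|b u v hu hv a]; first by rewrite ffunE; case: (arrow_ok_closed M N a).
by rewrite !ffunE; case: (arrow_ok_closed M N a) => _; apply.
Qed.

Definition hdim_rep M N := \dim (vsp (@hom M N)).

Lemma hom_mul M N R (f : 'M_(rdim M, rdim N)) (g : 'M_(rdim N, rdim R)) :
  hom f -> hom g -> hom (f *m g : 'M_(rdim M, rdim R)).
Proof.
move=> [[f1 f2] f3] [[g1 g2] g3]; split; first split.
- by move=> i; rewrite mulmxA f1 -!mulmxA g1.
- by rewrite mulmxA f2 -!mulmxA g2.
- by move=> a; rewrite mulmxA f3 -!mulmxA g3.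
Qed.

Lemma hom_id M : @hom M M 1%:M.
Proof. by split; [split|]; move=> *; rewrite mulmx1 mul1mx. Qed.

(** [ro] and [s] split the sequence as vector spaces only; they are not morphisms of
    representations. *)
Record sesd K X I (io : 'M_(rdim K, rdim X)) (pi : 'M_(rdim X, rdim I))
    (ro : 'M_(rdim X, rdim K)) (s : 'M_(rdim I, rdim X)) : Prop := Sesd {
  ses_io : hom io; ses_pi : hom pi; ses_ioro : io *m ro = 1%:M; ses_spi : s *m pi = 1%:M;
  ses_iopi : io *m pi = 0; ses_split : ro *m io + pi *m s = 1%:M
}.

Definition rses K X I := exists io pi ro s, @sesd K X I io pi ro s.

Lemma arrow_ok_sub m m' k (e : 'I_n -> 'M[rat]_m) T (e' : 'I_n -> 'M[rat]_m') T'
    (e'' : 'I_n -> 'M[rat]_k) T'' (io : 'M_(k, m')) (ro : 'M_(m', k)) a c :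
  io *m ro = 1%:M -> (forall i, e'' i *m io = io *m e' i) -> T'' *m io = io *m T' ->
  arrow_ok e T e' T' a (c *m io) <-> arrow_ok e T e'' T'' a c.
Proof.
move=> ior he hT; rewrite /arrow_ok; case: (active a); last first.
  split=> [c0|->]; last by rewrite mul0mx.
  by rewrite -[c]mulmx1 -ior mulmxA c0 mul0mx.
have hTk k' : T'' ^+ k' *m io = io *m T' ^+ k' by apply: commutesX.
have canc (A A' : 'M_(m, k)) : A *m io = A' *m io -> A = A'.
  by move=> eA; rewrite -[A]mulmx1 -[A']mulmx1 -ior !mulmxA eA.
split=> [[c1 c2 c3]|[c1 c2 c3]]; split.
- by apply: canc; rewrite -mulmxA.
- by apply: canc; rewrite -mulmxA he mulmxA c2.
- by apply: canc; rewrite -[RHS]mulmxA hTk mulmxA -c3 mulmxA.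
- by rewrite mulmxA c1.
- by rewrite -mulmxA -he mulmxA c2.
- by rewrite mulmxA c3 -!mulmxA hTk.
Qed.

Lemma arrow_ok_quo m m' k (e : 'I_n -> 'M[rat]_m) T (e' : 'I_n -> 'M[rat]_m') T'
    (e'' : 'I_n -> 'M[rat]_k) T'' (pi : 'M_(m, k)) (s : 'M_(k, m)) a c :
  s *m pi = 1%:M -> (forall i, e i *m pi = pi *m e'' i) -> T *m pi = pi *m T'' ->
  arrow_ok e T e' T' a (pi *m c) <-> arrow_ok e'' T'' e' T' a c.
Proof.
move=> ior he hT; rewrite /arrow_ok; case: (active a); last first.
  split=> [c0|->]; last by rewrite mulmx0.
  by rewrite -[c]mul1mx -ior -mulmxA c0 mulmx0.
have hTk k' : T ^+ k' *m pi = pi *m T'' ^+ k' by apply: commutesX.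
have canc (A A' : 'M_(k, m')) : pi *m A = pi *m A' -> A = A'.
  by move=> eA; rewrite -[A]mul1mx -[A']mul1mx -ior -!mulmxA eA.
split=> [[c1 c2 c3]|[c1 c2 c3]]; split.
- by apply: canc; rewrite mulmxA -he -mulmxA c1.
- by apply: canc; rewrite mulmxA.
- by apply: canc; rewrite mulmxA -hTk -mulmxA c3 mulmxA.
- by rewrite mulmxA he -mulmxA c1.
- by rewrite -mulmxA c2.
- by rewrite mulmxA hTk -!mulmxA c3.
Qed.

Lemma rep_law_sub X k (e : 'I_n -> 'M[rat]_k) T r (io : 'M_(k, rdim X)) ro :
  io *m ro = 1%:M -> (forall i, e i *m io = io *m re X i) -> T *m io = io *m rT X ->
  (forall a, r a *m io = io *m rr X a) -> rep_law e T r.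
Proof.
move=> ior he hT hr; have [x1 x2 x3 x4 x5] := repP X.
have canc (A A' : 'M_k) : A *m io = A' *m io -> A = A'.
  by move=> eA; rewrite -[A]mulmx1 -[A']mulmx1 -ior !mulmxA eA.
have hTk k' : T ^+ k' *m io = io *m rT X ^+ k' by apply: commutesX.
split.
- move=> i j; apply: canc; rewrite -mulmxA he mulmxA he -mulmxA x1.
  by case: eqP => _; rewrite ?he // mulmx0 mul0mx.
- apply: canc; rewrite mulmx_suml mul1mx -[RHS]mulmx1 -x2 mulmx_sumr.
  by apply: eq_bigr => i _.
- by move=> i; apply: canc; rewrite -!mulmxA hT he !mulmxA hT he -!mulmxA x3.
- by move=> i; apply: canc; rewrite -mulmxA he mulmxA hTk -mulmxA x4 -scalemxAl he scalemxAr.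
- move=> a; apply/(arrow_ok_sub _ _ _ _ ior he hT); rewrite hr.
  have := x5 a; rewrite /arrow_ok; case: (active a) => [[c1 c2 c3]|->]; last by rewrite mulmx0.
  by split; rewrite ?mulmxA ?he ?hTk -?mulmxA ?c1 ?c2 ?c3.
Qed.

Lemma rep_law_quo X k (e : 'I_n -> 'M[rat]_k) T r (pi : 'M_(rdim X, k)) s :
  s *m pi = 1%:M -> (forall i, re X i *m pi = pi *m e i) -> rT X *m pi = pi *m T ->
  (forall a, rr X a *m pi = pi *m r a) -> rep_law e T r.
Proof.
move=> ior he hT hr; have [x1 x2 x3 x4 x5] := repP X.
have canc (A A' : 'M_k) : pi *m A = pi *m A' -> A = A'.
  by move=> eA; rewrite -[A]mul1mx -[A']mul1mx -ior -!mulmxA eA.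
have hTk k' : rT X ^+ k' *m pi = pi *m T ^+ k' by apply: commutesX.
split.
- move=> i j; apply: canc; rewrite mulmxA -he -mulmxA -he mulmxA x1.
  by case: eqP => _; rewrite ?he // mulmx0 mul0mx.
- apply: canc; rewrite mulmx_sumr mulmx1 -[RHS]mul1mx -x2 mulmx_suml.
  by apply: eq_bigr => i _.
- by move=> i; apply: canc; rewrite !mulmxA -hT -he -!mulmxA -hT -he !mulmxA x3.
- by move=> i; apply: canc; rewrite mulmxA -hTk -mulmxA -he mulmxA x4 -scalemxAr -he scalemxAl.
- move=> a; apply/(arrow_ok_quo _ _ _ _ ior he hT); rewrite -hr.
  have := x5 a; rewrite /arrow_ok; case: (active a) => [[c1 c2 c3]|->]; last by rewrite mul0mx.
  by split; rewrite -?mulmxA -?he -?hTk ?mulmxA ?c1 ?c2 ?c3.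
Qed.

(** The cokernel lives on the image of the idempotent 1 - ro io; its structure maps are the
    compressions of those of [X]. *)
Lemma mono_ses K X (io : 'M_(rdim K, rdim X)) ro : hom io -> io *m ro = 1%:M ->
  exists Q pi s, @sesd K X Q io pi ro s.
Proof.
move=> hio ior; have [[h1 h2] h3] := hio; pose p := 1%:M - ro *m io.
have iop : io *m p = 0 by rewrite mulmxBr mulmx1 mulmxA ior mul1mx subrr.
have pp : p *m p = p by rewrite {1}/p mulmxBl mul1mx -mulmxA iop mulmx0 subr0.
have [r [x [u [xu ux _]]]] := idem_factor pp.
have iox : io *m x = 0.
  have iox0 : io *m x *m u = 0 by rewrite -mulmxA xu iop.
  by rewrite -[LHS]mulmx1 -ux mulmxA iox0 mul0mx.
have stab (O : 'M_(rdim X)) (O' : 'M_(rdim K)) : O' *m io = io *m O -> O *m x = x *m (u *m O *m x).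
  move=> hO; rewrite !mulmxA xu /p mulmxBl mul1mx mulmxBl -[ro *m io *m O]mulmxA -hO.
  by rewrite -!mulmxA iox !mulmx0 subr0.
have law := rep_law_quo (e := fun i => u *m re X i *m x) (T := u *m rT X *m x)
  (r := fun a => u *m rr X a *m x) ux (fun i => stab _ _ (h1 i)) (stab _ _ h2)
  (fun a => stab _ _ (h3 a)).
exists (Rep law), x, u; split=> //=.
- by split; [split|]; move=> *; apply: stab; first [exact: h1|exact: h2|exact: h3].
- by rewrite xu /p addrC subrK.
Qed.

Lemma epi_ses X I (pi : 'M_(rdim X, rdim I)) s : hom pi -> s *m pi = 1%:M ->
  exists K io ro, @sesd K X I io pi ro s.
Proof.
move=> hpi spi; have [[h1 h2] h3] := hpi; pose p := 1%:M - pi *m s.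
have ppi : p *m pi = 0 by rewrite mulmxBl mul1mx -mulmxA spi mulmx1 subrr.
have pp : p *m p = p by rewrite {2}/p mulmxBr mulmx1 mulmxA ppi mul0mx subr0.
have [r [x [u [xu ux _]]]] := idem_factor pp.
have upi : u *m pi = 0.
  have upi0 : x *m (u *m pi) = 0 by rewrite mulmxA xu ppi.
  by rewrite -[LHS]mul1mx -ux -mulmxA upi0 mulmx0.
have stab (O : 'M_(rdim X)) (O' : 'M_(rdim I)) : O *m pi = pi *m O' -> u *m O *m x *m u = u *m O.
  move=> hO; rewrite -mulmxA xu /p mulmxBr mulmx1 !mulmxA -[u *m O *m pi]mulmxA hO.
  by rewrite !mulmxA upi !mul0mx subr0.
have law := rep_law_sub (e := fun i => u *m re X i *m x) (T := u *m rT X *m x)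
  (r := fun a => u *m rr X a *m x) ux (fun i => stab _ _ (h1 i)) (stab _ _ h2)
  (fun a => stab _ _ (h3 a)).
exists (Rep law), u, x; split=> //=.
- split; [split|]; move=> *; apply: stab; first [exact: h1|exact: h2|exact: h3].
- by rewrite xu /p subrK.
Qed.

Lemma image_factor X Y (f : 'M_(rdim X, rdim Y)) : hom f ->
  exists K I Q io c ro s v pi ro' s', [/\ @sesd K X I io c ro s, @sesd I Y Q v pi ro' s',
    c *m v = f & rdim I = \rank f].
Proof.
move=> hf; have [[h1 h2] h3] := hf.
have [r [c [v [c' [v' [cv c'c vv' er]]]]]] : exists r (c : 'M_(rdim X, r)) (v : 'M_(r, rdim Y)) c' v',
    [/\ c *m v = f, c' *m c = 1%:M, v *m v' = 1%:M & r = \rank f].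
  exists (\rank f), (col_base f), (row_base f), (pinvmx (col_base f)), (pinvmx (row_base f)).
  by rewrite mulmx_base mulVpmx ?col_base_full // mulmxVp ?row_base_free.
have vE : v = c' *m f by rewrite -cv mulmxA c'c mul1mx.
have stab (O : 'M_(rdim X)) (O' : 'M_(rdim Y)) : O *m f = f *m O' -> v *m O' *m v' *m v = v *m O'.
  move=> hO; have -> : v *m O' = c' *m O *m c *m v.
    by rewrite {1}vE -mulmxA -hO -cv !mulmxA.
  by rewrite -[_ *m v *m v']mulmxA vv' mulmx1.
have stab2 (O : 'M_(rdim X)) (O' : 'M_(rdim Y)) : O *m f = f *m O' -> O *m c = c *m (v *m O' *m v').
  by move=> hO; rewrite -[LHS]mulmx1 -vv' !mulmxA -[O *m c *m v]mulmxA cv hO.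
have law := rep_law_sub (e := fun i => v *m re Y i *m v') (T := v *m rT Y *m v')
  (r := fun a => v *m rr Y a *m v') vv' (fun i => stab _ _ (h1 i)) (stab _ _ h2)
  (fun a => stab _ _ (h3 a)).
pose I := Rep law.
have hv : @hom I Y v.
  split; [split|]; move=> *; apply: stab; first [exact: h1|exact: h2|exact: h3].
have hc : @hom X I c.
  split; [split|]; move=> *; apply: stab2; first [exact: h1|exact: h2|exact: h3].
have [K [io [ro s1]]] := epi_ses hc c'c.
have [Q [pi [s' s2]]] := mono_ses hv vv'.
by exists K, I, Q, io, c, ro, c', v, pi, v', s'.
Qed.

Lemma mxrank_idem m (e : 'M[rat]_m) : e *m e = e -> \tr e = (\rank e)%:R.
Proof.
by case/idem_factor=> r [x [u [xu ux <-]]]; rewrite -xu mxtrace_mulC ux mxtrace1.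
Qed.

Lemma re_idem M i : re M i *m re M i = re M i.
Proof. by have [-> _ _ _ _] := repP M; rewrite eqxx. Qed.

Lemma tr_re M i : \tr (re M i) = (\rank (re M i))%:R.
Proof. exact/mxrank_idem/re_idem. Qed.

(** Over the rationals the rank of an idempotent is its trace, and traces add along the linear
    splitting. *)
Lemma rank_re_ses K X I i : rses K X I ->
  \rank (re X i) = (\rank (re K i) + \rank (re I i))%N.
Proof.
move=> [io [pi [ro [s [[[i1 _] _] [[p1 _] _] ior spi iop spl]]]]].
apply/eqP; rewrite -(eqr_nat rat) natrD -!tr_re.
have t1 : \tr (re X i *m (ro *m io)) = \tr (re K i).
  by rewrite mulmxA mxtrace_mulC mulmxA -i1 -mulmxA ior mulmx1.
have t2 : \tr (re X i *m (pi *m s)) = \tr (re I i).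
  by rewrite mulmxA p1 mxtrace_mulC mulmxA spi mul1mx.
by rewrite -t1 -t2 -mxtraceD -mulmxDr spl mulmx1.
Qed.

Lemma rdim_rank M : rdim M = (\sum_i \rank (re M i))%N.
Proof.
apply/eqP; rewrite -(eqr_nat rat) -mxtrace1; have [_ <- _ _ _] := repP M.
rewrite raddf_sum /= natr_sum; apply/eqP; apply: eq_bigr => i _; exact: tr_re.
Qed.

Hypothesis d_gt0 : forall i, (0 < d i)%N.

Lemma dvdn_rank M i : (d i %| \rank (re M i))%N.
Proof.
have [_ _ x3 x4 _] := repP M.
have [r [x [u [xu ux <-]]]] := idem_factor (re_idem M i).
exact: sqr2_dvd (idem_power xu ux (x3 i) (x4 i)).
Qed.

(** The dimension of the i-th vertex space over its field, which has degree d i. *)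
Definition mult M i := (\rank (re M i) %/ d i)%N.

Lemma multE M i : (mult M i * d i)%N = \rank (re M i).
Proof. exact/divnK/dvdn_rank. Qed.

Lemma mult_ses K X I i : rses K X I -> mult X i = (mult K i + mult I i)%N.
Proof.
move=> s; apply/eqP; rewrite -(eqn_pmul2r (d_gt0 i)) mulnDl !multE.
exact/eqP/rank_re_ses.
Qed.

Lemma rdim_mult M : rdim M = (\sum_i mult M i * d i)%N.
Proof. by rewrite rdim_rank; apply: eq_bigr => i _; rewrite multE. Qed.

Lemma rdim_ses K X I : rses K X I -> rdim X = (rdim K + rdim I)%N.
Proof.
move=> s; rewrite !rdim_mult -big_split; apply: eq_bigr => i _.
by rewrite (mult_ses i s) mulnDl.
Qed.

Lemma rT_power M i k k' : (k * k')%N = d i -> (rT M ^+ k) ^+ k' *m re M i = 2 *: re M i.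
Proof. by have [_ _ _ x4 _] := repP M; rewrite -exprM => ->. Qed.

Lemma rT_powerC M i k : rT M ^+ k *m re M i = re M i *m rT M ^+ k.
Proof.
have [_ _ x3 _ _] := repP M; have e : commutes (re M i) (re M i) (rT M ^+ k); last first.
  exact: esym e.
rewrite /commutes; elim: k => [|k IHk]; first by rewrite expr0 mul1mx mulmx1.
by rewrite exprSr -mulmxE mulmxA IHk -!mulmxA x3.
Qed.

Lemma dim_block M N i j g p q : (p * g)%N = d i -> (q * g)%N = d j ->
  (\dim (vsp (idem_commutes (re M i) (rT M ^+ p) (re N j) (rT N ^+ q))) =
   p * q * g * mult M i * mult N j)%N.
Proof.
move=> pg qg.
have g0 : (0 < g)%N by have := d_gt0 i; rewrite -pg muln_gt0 => /andP[].
apply/eqP; rewrite -(eqn_pmul2r g0); apply/eqP.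
rewrite (dim_idem_commutes g0) ?rT_powerC ?rT_power ?re_idem // -!multE -pg -qg.
by ring.
Qed.

(** The maps linear over a field of degree gcd, between rational spaces of dimensions d_i m and d_j
    n, have dimension d_i m d_j n / gcd, that is, lcm times m n. *)
Definition h1num M N := (\sum_(a : arrow | active a)
  lcmn (d a.1.1) (d a.1.2) * mult M a.1.1 * mult N a.1.2)%N.
Definition h0num M N := (\sum_i d i * mult M i * mult N i)%N.

Lemma dim_hom1 M N : \dim (vsp (@hom1 M N)) = h1num M N.
Proof.
pose U a := vsp (arrow_ok (re M) (rT M) (re N) (rT N) a).
rewrite (dim_ffun (U := U)) => [|c]; last first.
  split=> [/(vspE _ (hom1_closed M N)) hc a|hc].
    exact/(vspE _ (arrow_ok_closed M N a)).
  by apply/(vspE _ (hom1_closed M N)) => a; apply/(vspE _ (arrow_ok_closed M N a)).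
rewrite /h1num [RHS]big_mkcond; apply: eq_bigr => a _; case: ifP => act.
  have -> : U a = vsp (idem_commutes (re M a.1.1) (rT M ^+ (d a.1.1 %/ agcd a))
                        (re N a.1.2) (rT N ^+ (d a.1.2 %/ agcd a))).
    by rewrite /U /arrow_ok act.
  rewrite (@dim_block _ _ _ _ (agcd a)) ?divnK ?dvdn_gcdl ?dvdn_gcdr //.
  congr (_ * _ * _)%N; have g0 : (0 < agcd a)%N by rewrite gcdn_gt0 d_gt0.
  apply/eqP; rewrite -(eqn_pmul2r g0) muln_lcm_gcd -mulnA mulnACA !divnK //;
  by rewrite ?dvdn_gcdl ?dvdn_gcdr.
apply/eqP; rewrite dimv_eq0 -subv0; apply/subvP => c.
by move/(vspE _ (arrow_ok_closed M N a)); rewrite /arrow_ok act => ->; apply: mem0v.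
Qed.

Lemma dim_hom0 M N : \dim (vsp (@hom0 M N)) = h0num M N.
Proof.
have [m1 m2 m3 _ _] := repP M; have [n1 n2 n3 _ _] := repP N.
pose U i := vsp (idem_commutes (re M i) (rT M ^+ 1) (re N i) (rT N ^+ 1)).
pose P (c : {ffun 'I_n -> 'M[rat]_(rdim M, rdim N)}) := forall i, c i \in U i.
have Pcl : linear_closed_prop P.
  by split=> [i|a u v hu hv i]; rewrite ffunE ?mem0v // !ffunE memvD ?memvZ ?hu ?hv.
have -> : \dim (vsp (@hom0 M N)) = \dim (vsp P).
  apply: (dim_iso (f := fun f => [ffun i => re M i *m f])) => [a u v|u|u _ u0|c].
  - by apply/ffunP => i; rewrite !ffunE mulmxDr -scalemxAr.
  - move/(vspE _ (hom0_closed M N))=> [u1 u2]; apply/(vspE _ Pcl) => i; rewrite ffunE.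
    apply/(vspE _ (idem_commutes_closed _ _ _ _)); rewrite !expr1; split.
    + by rewrite mulmxA re_idem.
    + by rewrite u1 -mulmxA re_idem.
    + by rewrite mulmxA m3 -!mulmxA u2.
  - rewrite -[u]mul1mx -m2 mulmx_suml big1 // => i _.
    by have := congr1 (fun c : {ffun _ -> _} => c i) u0; rewrite !ffunE.
  move/(vspE _ Pcl)=> cU; have {}cU i := cU i.
  have cE i : idem_commutes (re M i) (rT M) (re N i) (rT N) (c i).
    by have := cU i; rewrite -[rT M]expr1 -[rT N]expr1 => /(vspE _ (idem_commutes_closed _ _ _ _)).
  have ec i j : re M i *m c j = if i == j then c i else 0.
    have [c1 _ _] := cE j; rewrite -c1 mulmxA m1; case: eqP => [->|_]; last by rewrite mul0mx.
    by rewrite c1.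
  have ec' i j : c j *m re N i = if i == j then c i else 0.
    have [_ c1 _] := cE j; rewrite -c1 -mulmxA n1 eq_sym; case: eqP => [->|_]; last by rewrite mulmx0.
    by rewrite c1.
  exists (\sum_i c i).
    apply/(vspE _ (hom0_closed M N)); split=> [i|].
      by rewrite mulmx_sumr mulmx_suml; apply: eq_bigr => j _; rewrite ec ec'.
    by rewrite mulmx_sumr mulmx_suml; apply: eq_bigr => j _; case: (cE j).
  apply/ffunP => i; rewrite ffunE mulmx_sumr (bigD1 i) //= ec eqxx big1 ?addr0 // => j.
  by rewrite ec eq_sym => /negPf->.
rewrite (dim_ffun (U := U)) => [|c]; last by split=> /(vspE _ Pcl).
by apply: eq_bigr => i _; rewrite (@dim_block _ _ _ _ (d i)) ?mul1n.
Qed.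

(* Hom(M, N) and Ext(M, N) are the kernel and the cokernel of delta. *)
Definition delta M N (f : 'M_(rdim M, rdim N)) : {ffun arrow -> 'M[rat]_(rdim M, rdim N)} :=
  [ffun a => rr M a *m f - f *m rr N a].

Lemma delta_lin M N a : {morph (@delta M N) : u v / a *: u + v}.
Proof.
move=> u v; apply/ffunP => b; rewrite !ffunE mulmxDr mulmxDl -scalemxAr -scalemxAl.
by rewrite scalerBr opprD addrACA.
Qed.

Lemma delta_hom1 M N f : @hom0 M N f -> hom1 (delta f).
Proof.
move=> [f1 f2] a; rewrite ffunE.
have fk k : rT M ^+ k *m f = f *m rT N ^+ k by apply: commutesX.
have [_ _ _ _ /(_ a)] := repP M; have [_ _ _ _ /(_ a)] := repP N.
rewrite /arrow_ok; case: (active a) => [[n1 n2 n3] [m1 m2 m3]|-> ->]; last first.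
  by rewrite mulmx0 mul0mx subrr.
split; rewrite ?mulmxBr ?mulmxBl; congr (_ - _).
- by rewrite mulmxA m1.
- by rewrite mulmxA f1 -mulmxA n1.
- by rewrite -mulmxA -f1 mulmxA m2.
- by rewrite -mulmxA n2.
- by rewrite mulmxA m3 -!mulmxA fk.
- by rewrite mulmxA fk -!mulmxA n3.
Qed.

Lemma hom_delta M N f : @hom M N f <-> @hom0 M N f /\ delta f = 0.
Proof.
split=> [[f0 f1]|[f0 f1]]; split=> //; last move=> a.
  by apply/ffunP => a; rewrite !ffunE f1 subrr.
by have := congr1 (fun c : {ffun _ -> _} => c a) f1; rewrite !ffunE => /eqP; rewrite subr_eq0 => /eqP.
Qed.

Definition bnd M N c := exists2 f, @hom0 M N f & delta f = c.

Lemma bnd_closed M N : linear_closed_prop (@bnd M N).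
Proof.
have [z c] := hom0_closed M N; split=> [|a u v [f f0 <-] [g g0 <-]].
  exists 0 => //; apply/ffunP => a; rewrite !ffunE mulmx0 mul0mx subrr //.
by exists (a *: f + g); [apply: c|rewrite delta_lin].
Qed.

Definition edim_rep M N := (\dim (vsp (@hom1 M N)) - \dim (vsp (@bnd M N)))%N.

Lemma bnd_sub M N : (vsp (@bnd M N) <= vsp (@hom1 M N))%VS.
Proof.
apply/subvP => c /(vspE _ (bnd_closed M N))[f f0 <-].
exact/(vspE _ (hom1_closed M N))/delta_hom1.
Qed.

(** Rank-nullity for [delta], arranged without subtraction. *)
Lemma euler M N : (hdim_rep M N + h1num M N = h0num M N + edim_rep M N)%N.
Proof.
have := dimvS (bnd_sub M N).
have [K [W [KE WE]]] := dim_ker_img (vsp (@hom0 M N)) (@delta_lin M N).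
have -> : K = vsp (@hom M N).
  apply/eqP; rewrite eqEsubv; apply/andP; split; apply/subvP => f.
    move/KE=> [/(vspE _ (hom0_closed M N)) f0 f1].
    exact/(vspE _ (hom_closed M N))/hom_delta.
  move/(vspE _ (hom_closed M N))/hom_delta=> [f0 f1]; apply/KE.
  by split=> //; apply/(vspE _ (hom0_closed M N)).
have -> : W = vsp (@bnd M N).
  apply/eqP; rewrite eqEsubv; apply/andP; split; apply/subvP => c.
    move/WE=> [f /(vspE _ (hom0_closed M N)) f0 <-].
    by apply/(vspE _ (bnd_closed M N)); exists f.
  move/(vspE _ (bnd_closed M N))=> [f f0 <-]; apply/WE; exists f => //.
  exact/(vspE _ (hom0_closed M N)).
rewrite /edim_rep /hdim_rep dim_hom0 dim_hom1; lia.
Qed.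

End Representations.
End Species.

(** * Duality by transposition *)

Section DualRepresentation.
Variables (n : nat) (d : 'I_n -> nat) (B : nat) (mu : 'I_n -> 'I_n -> nat).
Hypothesis d_gt0 : forall i, (0 < d i)%N.

Definition muT (nu : 'I_n -> 'I_n -> nat) : 'I_n -> 'I_n -> nat := fun i j => nu j i.
Definition arrT (a : arrow n B) : arrow n B := ((a.1.2, a.1.1), a.2).

Lemma arrTK : involutive arrT. Proof. by move=> [[i j] l]. Qed.

Lemma trmx_exp m (A : 'M[rat]_m) k : (A ^+ k)^T = A^T ^+ k.
Proof.
elim: k => [|k IHk]; first by rewrite !expr0 trmx1.
by rewrite exprS exprSr -!mulmxE trmx_mul IHk.
Qed.

Lemma arrow_ok_dual nu m m' (e : 'I_n -> 'M[rat]_m) T (e' : 'I_n -> 'M[rat]_m') T' a c :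
  arrow_ok d nu e T e' T' (arrT a) c ->
  arrow_ok d (muT nu) (fun i => (e' i)^T) T'^T (fun i => (e i)^T) T^T a c^T.
Proof.
have ag : agcd d (arrT a) = agcd d a by apply: gcdnC.
rewrite /arrow_ok /active /muT ag; case: ifP => [_|_ ->]; last by rewrite trmx0.
case=> c1 c2 c3; split.
- by rewrite -trmx_mul c2.
- by rewrite -trmx_mul c1.
- by rewrite -!trmx_exp -!trmx_mul c3.
Qed.

Lemma dual_law nu (M : rep d B nu) :
  rep_law d (muT nu) (fun i => (re M i)^T) (rT M)^T (fun a => (rr M (arrT a))^T).
Proof.
have [m1 m2 m3 m4 m5] := repP M; split.
- by move=> i j; rewrite -trmx_mul m1 eq_sym; case: eqP => [->|_]; rewrite ?trmx0.
- by rewrite -[LHS]raddf_sum /= m2 trmx1.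
- by move=> i; rewrite -!trmx_mul m3.
- by move=> i; rewrite -trmx_exp -trmx_mul -linearZ /= -m4; congr (_^T); apply: esym; apply: rT_powerC.
- by move=> a; apply/arrow_ok_dual/m5.
Qed.

Definition dual nu (M : rep d B nu) : rep d B (muT nu) := Rep (dual_law M).

Lemma dualK nu (M : rep d B nu) : dual (dual M) = M.
Proof.
case: M => m e T r law; rewrite /dual /=.
have ee : (fun i => ((e i)^T)^T) = e by apply: funext => i; rewrite trmxK.
have er : (fun a => ((r (arrT (arrT a)))^T)^T) = r.
  by apply: funext => a; rewrite trmxK arrTK.
move: (dual_law _) => /=; rewrite ee er trmxK => law'.
by congr Rep; apply: Prop_irrelevance.
Qed.

Lemma hom_dual nu (M N : rep d B nu) (f : 'M_(rdim M, rdim N)) :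
  @hom _ _ _ _ (dual N) (dual M) f^T <-> hom f.
Proof.
split=> -[[f1 f2] f3]; split; [split=> [i|]|move=> a|split=> [i|]|move=> a] => /=;
  rewrite -?trmx_mul ?f1 ?f2 ?f3 //; apply: trmx_inj; rewrite !trmx_mul.
- exact/esym/f1.
- exact/esym/f2.
- by have := f3 (arrT a); rewrite /= arrTK => ->.
Qed.

Lemma hdim_dual nu (M N : rep d B nu) : hdim_rep (dual N) (dual M) = hdim_rep M N.
Proof.
apply/esym; apply: (dim_iso (f := @trmx rat (rdim M) (rdim N))) => [a u v|f|f _|f].
- by rewrite linearP.
- by move=> /(vspE _ (hom_closed M N))/hom_dual/(vspE _ (hom_closed (dual N) (dual M))).
- by move/(congr1 trmx); rewrite trmxK trmx0.
move/(vspE _ (hom_closed (dual N) (dual M))) => hf.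
exists f^T; last by rewrite trmxK.
by apply/(vspE _ (hom_closed M N))/hom_dual; rewrite trmxK.
Qed.

Lemma sesd_dual nu (K X I : rep d B nu) io pi ro s : @sesd _ _ _ _ K X I io pi ro s ->
  @sesd _ _ _ _ (dual I) (dual X) (dual K) pi^T io^T s^T ro^T.
Proof.
case=> h1 h2 h3 h4 h5 h6; split.
- exact/hom_dual.
- exact/hom_dual.
- by rewrite -trmx_mul h4 trmx1.
- by rewrite -trmx_mul h3 trmx1.
- by rewrite -trmx_mul h5 trmx0.
- by rewrite -!trmx_mul -linearD /= addrC h6 trmx1.
Qed.

Lemma rses_dual nu (K X I : rep d B nu) : rses K X I -> rses (dual I) (dual X) (dual K).
Proof. by move=> [io [pi [ro [s h]]]]; exists pi^T, io^T, s^T, ro^T; apply: sesd_dual. Qed.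

Lemma mult_dual nu (M : rep d B nu) i : mult (dual M) i = mult M i.
Proof. by rewrite /mult /= mxrank_tr. Qed.

(** The dimensions of Hom and the two counts in [euler] are preserved, so that of Ext is as well; no
    cocycle has to be transposed. *)
Lemma edim_dual (M N : rep d B mu) : edim_rep (dual N) (dual M) = edim_rep M N.
Proof.
have := euler d_gt0 M N; have := euler d_gt0 (dual N) (dual M); rewrite hdim_dual.
have -> : h0num (dual N) (dual M) = h0num M N.
  by apply: eq_bigr => i _; rewrite !mult_dual mulnAC.
have -> : h1num (dual N) (dual M) = h1num M N.
  rewrite [RHS](reindex_inj (inv_inj arrTK)); apply: eq_bigr => a _.
  by rewrite !mult_dual lcmnC mulnAC.
by lia.
Qed.

End DualRepresentation.

(** * Exactness of Hom and Ext *)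

Section Exactness.
Variables (n : nat) (d : 'I_n -> nat) (B : nat) (mu : 'I_n -> 'I_n -> nat).
Hypothesis d_gt0 : forall i, (0 < d i)%N.
Implicit Types (M N K X Y Z I Q R : rep d B mu).

Lemma hom_hdim M N f : @hom _ _ _ _ M N f -> f <> 0 -> (0 < hdim_rep M N)%N.
Proof.
move=> hf f0; rewrite lt0n dimv_eq0; apply/eqP => v0; apply: f0.
by apply/eqP; rewrite -memv0 -v0; apply/(vspE _ (hom_closed M N)).
Qed.

Lemma hdim_hom M N : (0 < hdim_rep M N)%N -> exists2 f, @hom _ _ _ _ M N f & f <> 0.
Proof.
rewrite lt0n dimv_eq0 -vpick0 => /eqP p0; exists (vpick (vsp (@hom _ _ _ _ M N))) => //.
by apply/(vspE _ (hom_closed M N)); apply: memv_pick.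
Qed.

Lemma hdim_sub K X I N : rses K X I -> (hdim_rep N K <= hdim_rep N X)%N.
Proof.
move=> [io [pi [ro [s [hi hp ior spi iop spl]]]]].
apply: (dim_le (f := fun f : 'M_(rdim N, rdim K) => f *m io)) => [a u v|f|f _ f0].
- by rewrite mulmxDl -scalemxAl.
- move=> /(vspE _ (hom_closed N K)) hf; apply/(vspE _ (hom_closed N X)); exact: hom_mul.
- by rewrite -[f]mulmx1 -ior mulmxA f0 mul0mx.
Qed.

Lemma hom_kernel K X I N io pi ro s f : @sesd _ _ _ _ K X I io pi ro s -> @hom _ _ _ _ N X f ->
  f *m pi = 0 -> exists2 g, @hom _ _ _ _ N K g & g *m io = f.
Proof.
move=> [hi hp ior spi iop spl] [[f1 f2] f3] f0.
have fE : f = f *m ro *m io.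
  by rewrite -[LHS]mulmx1 -spl mulmxDr !mulmxA f0 mul0mx addr0.
have cio (u v : 'M_(rdim N, rdim K)) : u *m io = v *m io -> u = v.
  by move=> e; rewrite -[u]mulmx1 -[v]mulmx1 -ior !mulmxA e.
have [[i1 i2] i3] := hi.
have fro : f *m (ro *m io) = f by rewrite mulmxA -fE.
exists (f *m ro); last by rewrite -fE.
split; [split=> [i|]|move=> a]; apply: cio; rewrite -!mulmxA ?fro.
- by rewrite i1 f1 !mulmxA -fE.
- by rewrite i2 f2 !mulmxA -fE.
- by rewrite i3 f3 !mulmxA -fE.
Qed.

Lemma hdim_midr K X I N : rses K X I -> (hdim_rep N X <= hdim_rep N K + hdim_rep N I)%N.
Proof.
move=> [io [pi [ro [s h]]]]; have [hi hp ior spi iop spl] := h.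
have pl a : {morph (fun f : 'M_(rdim N, rdim X) => f *m pi) : u v / a *: u + v}.
  by move=> u v; rewrite mulmxDl -scalemxAl.
have [V [W [VE WE]]] := dim_ker_img (vsp (@hom _ _ _ _ N X)) pl.
rewrite /hdim_rep => <-; apply: leq_add.
  apply: (dim_le (f := fun f => f *m ro)) => [a u v|f|f].
  - by rewrite mulmxDl -scalemxAl.
  - move/VE=> [/(vspE _ (hom_closed N X)) hf /(hom_kernel h hf)[g hg <-]].
    by rewrite -mulmxA ior mulmx1; apply/(vspE _ (hom_closed N K)).
  by move=> /VE[_ fp] fr; rewrite -[f]mulmx1 -spl mulmxDr !mulmxA fp fr !mul0mx addr0.
apply/dimvS/subvP => w /WE[f /(vspE _ (hom_closed N X)) hf <-].
exact/(vspE _ (hom_closed N I))/hom_mul.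
Qed.

Lemma hdim_split K X I N io pi ro s : @sesd _ _ _ _ K X I io pi ro s -> hom s ->
  hdim_rep N X = (hdim_rep N K + hdim_rep N I)%N.
Proof.
move=> h hs; have [hi hp ior spi iop spl] := h.
apply/eqP; rewrite eqn_leq hdim_midr /=; last by exists io, pi, ro, s.
have pl a : {morph (fun f : 'M_(rdim N, rdim X) => f *m pi) : u v / a *: u + v}.
  by move=> u v; rewrite mulmxDl -scalemxAl.
have [V [W [VE WE]]] := dim_ker_img (vsp (@hom _ _ _ _ N X)) pl.
rewrite /hdim_rep => <-; apply: leq_add.
  apply: (dim_le (f := fun f : 'M_(rdim N, rdim K) => f *m io)) => [a u v|f|f _ f0].
  - by rewrite mulmxDl -scalemxAl.
  - move=> /(vspE _ (hom_closed N K)) hf; apply/VE; rewrite -mulmxA iop mulmx0; split=> //.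
    exact/(vspE _ (hom_closed N X))/hom_mul.
  - by rewrite -[f]mulmx1 -ior mulmxA f0 mul0mx.
apply/dimvS/subvP => w /(vspE _ (hom_closed N I)) hw; apply/WE; exists (w *m s).
  exact/(vspE _ (hom_closed N X))/hom_mul.
by rewrite -mulmxA spi mulmx1.
Qed.

(** Composition with [pi] maps cocycles onto cocycles, by a count of dimensions, and boundaries to
    boundaries; hence it is onto on Ext. *)
Lemma edim_quo K X I N : rses K X I -> (edim_rep N I <= edim_rep N X)%N.
Proof.
move=> ss; have [io [pi [ro [s h]]]] := ss; have [hi hp ior spi iop spl] := h.
have [[p1 p2] p3] := hp; have [[i1 i2] i3] := hi.
pose F (c : {ffun arrow n B -> 'M[rat]_(rdim N, rdim X)}) := [ffun a => c a *m pi].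
have Fl a : {morph F : u v / a *: u + v}.
  by move=> u v; apply/ffunP => b; rewrite !ffunE mulmxDl -scalemxAl.
have F1 c : hom1 c -> @hom1 _ _ _ _ N I (F c).
  move=> hc a; rewrite ffunE; have := hc a; rewrite /arrow_ok; case: ifP => [_|_ ->]; last first.
    by rewrite mul0mx.
  have pk k : rT X ^+ k *m pi = pi *m rT I ^+ k by apply: commutesX.
  by case=> c1 c2 c3; split; rewrite ?mulmxA ?c1 ?c3 // -[in LHS]mulmxA -?p1 ?mulmxA ?c2 // -!mulmxA pk.
have Fd f : F (delta f) = @delta _ _ _ _ N I (f *m pi).
  apply/ffunP => a; rewrite !ffunE mulmxBl -!mulmxA; congr (_ - _).
  by rewrite p3.
have surj w : w \in vsp (@hom1 _ _ _ _ N I) -> exists2 u, u \in vsp (@hom1 _ _ _ _ N X) & F u = w.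
  have [V [W [VE WE dE]]] := dim_ker_img (vsp (@hom1 _ _ _ _ N X)) Fl.
  suff -> : vsp (@hom1 _ _ _ _ N I) = W by move/WE.
  apply/eqP; rewrite eq_sym eqEdim; apply/andP; split.
    apply/subvP => v /WE[u /(vspE _ (hom1_closed N X)) hu <-].
    exact/(vspE _ (hom1_closed N I))/F1.
  (* Cocycles killed by [pi] take values in [K], and [ro] recovers those values injectively. *)
  have leV : (\dim V <= h1num N K)%N.
    rewrite -dim_hom1 //.
    apply: (dim_le (f := fun c : {ffun arrow n B -> 'M[rat]_(rdim N, rdim X)} =>
                           [ffun a => c a *m ro])) => [a u v|c /VE[]|c /VE[_ c0] c1].
    - by apply/ffunP => b; rewrite !ffunE mulmxDl -scalemxAl.
    - move=> /(vspE _ (hom1_closed N X)) hc Fc; apply/(vspE _ (hom1_closed N K)) => a.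
      rewrite ffunE; have ca : c a = c a *m ro *m io.
        rewrite -[LHS]mulmx1 -spl mulmxDr !mulmxA.
        have := congr1 (fun c : {ffun _ -> _} => c a) Fc; rewrite !ffunE => ->.
        by rewrite mul0mx addr0.
      by have := hc a; rewrite {1}ca => /(arrow_ok_sub _ _ _ _ _ _ ior i1 i2).
    apply/ffunP => a; rewrite ffunE -[c a]mulmx1 -spl mulmxDr !mulmxA.
    have := congr1 (fun c : {ffun _ -> _} => c a) c0; rewrite !ffunE => ->.
    by have := congr1 (fun c : {ffun _ -> _} => c a) c1; rewrite !ffunE => ->; rewrite !mul0mx addr0.
  have eh : h1num N X = (h1num N K + h1num N I)%N.
    rewrite /h1num -big_split; apply: eq_bigr => a _ /=.
    by rewrite (mult_ses d_gt0 _ ss) mulnDr.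
  by move: dE; rewrite !dim_hom1 // eh; lia.
have := codim_le Fl surj (U' := vsp (@bnd _ _ _ _ N X)) (W' := vsp (@bnd _ _ _ _ N I)).
have h2 u : u \in vsp (@bnd _ _ _ _ N X) -> F u \in vsp (@bnd _ _ _ _ N I).
  move/(vspE _ (bnd_closed N X))=> [f [f1 f2] <-]; apply/(vspE _ (bnd_closed N I)).
  exists (f *m pi); last by rewrite Fd.
  by split=> [i|]; rewrite mulmxA ?f1 ?f2 -!mulmxA ?p1 ?p2.
move=> /(_ h2 (bnd_sub N X)); rewrite /edim_rep.
have := dimvS (bnd_sub N X); have := dimvS (bnd_sub N I); lia.
Qed.

Lemma rdim0_mx M N (f : 'M[rat]_(rdim M, rdim N)) : rdim M = 0%N \/ rdim N = 0%N -> f = 0.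
Proof. by move=> m0; apply/matrixP => i j; case: m0 => m0; [have: (i < 0)%N by rewrite -[X in (_ < X)%N]m0|have: (j < 0)%N by rewrite -[X in (_ < X)%N]m0]. Qed.

Lemma hdim_rdim0 M N : rdim M = 0%N \/ rdim N = 0%N -> hdim_rep M N = 0%N.
Proof.
move=> m0; apply/eqP; rewrite -leqn0 leqNgt; apply/negP => /hdim_hom[f _].
by rewrite (rdim0_mx f m0).
Qed.

Lemma hdim_id_gt0 M : rdim M <> 0%N -> (0 < hdim_rep M M)%N.
Proof.
move=> m0; apply: (hom_hdim (hom_id M)) => e1; apply: m0.
by rewrite -[LHS](mxrank1 rat (rdim M)) e1 mxrank0.
Qed.

Lemma rep_factorisation X Y : (0 < hdim_rep X Y)%N ->
  exists K I Q, [/\ rses K X I, rses I Y Q & rdim I <> 0%N].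
Proof.
case/hdim_hom=> f hf f0; have [K [I [Q [io [c [ro [s [v [pi [ro' [s' [s1 s2 _ rI]]]]]]]]]]]] := image_factor hf.
exists K, I, Q; split; [by exists io, c, ro, s|by exists v, pi, ro', s'|].
by rewrite rI => /eqP; rewrite mxrank_eq0 => /eqP.
Qed.

Lemma rep_image_in_kernel K X I : rses K X I -> (0 < hdim_rep X K)%N ->
  exists K' I' Q' Q'', [/\ rses K' X I', rses I' K Q', rses I' X Q'' & rdim I' <> 0%N].
Proof.
move=> [io [pi [ro [s [hi hp ior spi iop spl]]]]].
case/hdim_hom=> f hf f0.
have [K' [I' [Q' [io' [c [ro1 [s1 [v [pi' [ro' [s' [sd1 sd2 _ rI]]]]]]]]]]]] := image_factor hf.
have [hv _ vr _ _ _] := sd2.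
have [||Q'' [pi'' [s'' sd3]]] := @mono_ses _ _ _ _ I' X (v *m io) (ro *m ro').
- exact: hom_mul.
- by rewrite mulmxA -[v *m io *m ro]mulmxA ior mulmx1.
exists K', I', Q', Q''; split; [by exists io', c, ro1, s1|by exists v, pi', ro', s'| |].
  by exists (v *m io), pi'', (ro *m ro'), s''.
by rewrite rI => /eqP; rewrite mxrank_eq0 => /eqP.
Qed.

Definition rbrick Y := forall K I Q, rses K Y I -> rses I Y Q -> rdim I <> 0%N -> rdim K = 0%N.

Lemma rbrick_unit Y f : rbrick Y -> @hom _ _ _ _ Y Y f -> f <> 0 -> f \in unitmx.
Proof.
move=> bY hf f0; have [K [I [Q [io [c [ro [s [v [pi [ro' [s' [s1 s2 _ rI]]]]]]]]]]]] := image_factor hf.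
have h1 : rses K Y I by exists io, c, ro, s.
have h2 : rses I Y Q by exists v, pi, ro', s'.
have I0 : rdim I <> 0%N by rewrite rI => /eqP; rewrite mxrank_eq0 => /eqP.
have := rdim_ses d_gt0 h1; rewrite (bY _ _ _ h1 h2 I0) add0n rI => e.
by rewrite -row_free_unit /row_free -e.
Qed.

Lemma hom_inv Y f : @hom _ _ _ _ Y Y f -> f \in unitmx -> @hom _ _ _ _ Y Y (invmx f).
Proof.
move=> [[f1 f2] f3] uf.
have inv (A : 'M_(rdim Y)) : A *m f = f *m A -> A *m invmx f = invmx f *m A.
  by move=> e; rewrite -[LHS](mulKmx uf) [f *m _]mulmxA -e mulmxK.
by split; [split|] => *; apply: inv.
Qed.

End Exactness.

(** * Extensions, direct sums and approximations *)

Section Extensions.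
Variables (n : nat) (d : 'I_n -> nat) (B : nat) (mu : 'I_n -> 'I_n -> nat).
Hypothesis d_gt0 : forall i, (0 < d i)%N.
Implicit Types (M N K X Y Z I Q R : rep d B mu).

Definition blk p q (A : 'M[rat]_p) (A' : 'M[rat]_q) : 'M[rat]_(p + q) := block_mx A 0 0 A'.

Lemma blk_exp p q (A : 'M[rat]_p) (A' : 'M[rat]_q) k : blk A A' ^+ k = blk (A ^+ k) (A' ^+ k).
Proof.
elim: k => [|k IHk]; first by rewrite !expr0 /blk -scalar_mx_block.
by rewrite !exprS IHk -!mulmxE /blk mulmx_block !mulmx0 !mul0mx !addr0 !add0r.
Qed.

Lemma ext_law X Y c : @hom1 _ _ _ _ X Y c ->
  rep_law d mu (fun i => blk (re X i) (re Y i)) (blk (rT X) (rT Y))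
    (fun a => block_mx (rr X a) (c a) 0 (rr Y a)).
Proof.
move=> hc; have [x1 x2 x3 x4 x5] := repP X; have [y1 y2 y3 y4 y5] := repP Y.
split.
- move=> i j; rewrite /blk mulmx_block !mulmx0 !mul0mx !addr0 !add0r x1 y1.
  by case: eqP => // _; rewrite block_mx0.
- have bs (s : seq 'I_n) : \sum_(i <- s) blk (re X i) (re Y i) =
      blk (\sum_(i <- s) re X i) (\sum_(i <- s) re Y i).
    elim: s => [|i s IHs]; first by rewrite !big_nil /blk block_mx0.
    by rewrite !big_cons IHs /blk add_block_mx !addr0.
  by rewrite bs x2 y2 /blk -scalar_mx_block.
- by move=> i; rewrite /blk !mulmx_block !mulmx0 !mul0mx !addr0 !add0r x3 y3.
- move=> i; rewrite blk_exp /blk mulmx_block scale_block_mx !mulmx0 !mul0mx !addr0 !add0r.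
  by rewrite x4 y4 !scaler0.
move=> a; have := hc a; have := x5 a; have := y5 a; rewrite /arrow_ok.
case: (active mu a) => [[b1 b2 b3] [a1 a2 a3] [c1 c2 c3]|-> -> ->]; last exact: block_mx0.
by split; rewrite ?blk_exp /blk !mulmx_block !mulmx0 !mul0mx !addr0 !add0r
  ?a1 ?b1 ?c1 ?a2 ?b2 ?c2 ?a3 ?b3 ?c3.
Qed.

Definition ext X Y c (hc : @hom1 _ _ _ _ X Y c) : rep d B mu := Rep (ext_law hc).

Lemma ext_sesd X Y c (hc : @hom1 _ _ _ _ X Y c) :
  @sesd _ _ _ _ Y (ext hc) X (row_mx 0 1%:M) (col_mx 1%:M 0) (col_mx 0 1%:M) (row_mx 1%:M 0).
Proof.
split.
- by split; [split|] => /= *; rewrite ?mul_row_block mul_mx_row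
    !mulmx0 !mulmx1 !mul0mx !mul1mx ?addr0 !add0r.
- by split; [split|] => /= *; rewrite ?mul_block_col mul_col_mx
    !mulmx0 !mulmx1 !mul0mx !mul1mx ?addr0 ?add0r.
- by rewrite mul_row_col mulmx0 mulmx1 add0r.
- by rewrite mul_row_col mulmx0 mulmx1 addr0.
- by rewrite mul_row_col mul0mx mulmx0 addr0.
- rewrite !mul_col_row !mulmx0 !mul0mx !mulmx1 add_block_mx !addr0 !add0r.
  exact/esym/scalar_mx_block.
Qed.

Lemma edim_ext M N : (0 < edim_rep M N)%N -> exists2 c, @hom1 _ _ _ _ M N c & ~ @bnd _ _ _ _ M N c.
Proof.
move=> e0; apply: contrapT => nc.
have: (vsp (@hom1 _ _ _ _ M N) <= vsp (@bnd _ _ _ _ M N))%VS.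
  apply/subvP => c /(vspE _ (hom1_closed M N)) hc.
  apply: contrapT => nb; apply: nc; exists c => // bc.
  exact/nb/(vspE _ (bnd_closed M N)).
by move/dimvS; move: e0; rewrite /edim_rep; lia.
Qed.

(** Any nonsplit extension will do. A map from it to [Y] restricts to zero or to an automorphism of
    the brick [Y]: in the first case it factors through Hom(X, Y) = 0, in the second it splits the
    extension. *)
Lemma rep_left_extension X Y : rbrick Y -> hdim_rep X Y = 0%N -> (0 < edim_rep X Y)%N ->
  exists R, rses Y R X /\ hdim_rep R Y = 0%N.
Proof.
move=> bY hXY /edim_ext[c hc nc]; exists (ext hc).
have sd := ext_sesd hc; split; first by do 4 eexists; exact: sd.
apply/eqP; rewrite -leqn0 leqNgt; apply/negP => /hdim_hom[f hf f0].
have homXY g : @hom _ _ _ _ X Y g -> g = 0.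
  by move=> hg; apply: contrapT => /(hom_hdim hg); rewrite hXY.
have [hi hp _ _ _ _] := sd.
set io : 'M[rat]_(rdim Y, rdim X + rdim Y) := row_mx 0 1%:M in hi sd.
have hiof := hom_mul hi hf.
have fE (f' : 'M[rat]_(rdim X + rdim Y, rdim Y)) : f' = col_mx (usubmx f') (io *m f').
  by rewrite -[f' in io *m f']vsubmxK mul_row_col mul0mx mul1mx add0r vsubmxK.
case: (pselect (io *m f = 0)) => [iof0|iofn].
  apply: f0; rewrite [f]fE iof0 (homXY (usubmx f)) ?col_mx0 //.
  have [[f1 f2] f3] := hf; move: f1 f2 f3; rewrite [f]fE iof0 /= => f1 f2 f3.
  split; [split=> [i|]|move=> a].
  - have := f1 i; rewrite mul_block_col mul_col_mx !mulmx0 !mul0mx !addr0.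
    by case/eq_col_mx; rewrite col_mxKu.
  - have := f2; rewrite mul_block_col mul_col_mx !mulmx0 !mul0mx !addr0.
    by case/eq_col_mx; rewrite col_mxKu.
  - have := f3 a; rewrite mul_block_col mul_col_mx !mulmx0 !mul0mx !addr0.
    by case/eq_col_mx; rewrite col_mxKu.
have u := rbrick_unit d_gt0 bY hiof iofn.
have := hom_mul hf (hom_inv hiof u); set f' := f *m _ => hf'.
have iof' : io *m f' = 1%:M by rewrite mulmxA mulmxV.
(* The upper block of the retraction bounds the cocycle, up to sign. *)
apply: nc; exists (- usubmx f').
  have [[f1 f2] _] := hf'; split=> [i|].
    have := f1 i; rewrite [f']fE iof' /= mul_block_col mul_col_mx col_mxKu.
    by rewrite !mulmx1 !mul0mx addr0 => /eq_col_mx[e _]; rewrite mulmxN e mulNmx.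
  have := f2; rewrite [f']fE iof' /= mul_block_col mul_col_mx col_mxKu.
  by rewrite !mulmx1 !mul0mx addr0 => /eq_col_mx[e _]; rewrite mulmxN e mulNmx.
apply/ffunP => a; rewrite ffunE; have [_ /(_ a)] := hf'.
rewrite [f']fE iof' /= mul_block_col mul_col_mx col_mxKu mulmx1 => /eq_col_mx[e _].
by rewrite mulmxN mulNmx opprK -e addKr.
Qed.

(** The extension by the zero cocycle. The last clause pairs two maps from [N] and decomposes the
    composites with maps to [Y]; it serves to add one more copy of [Y] to an approximation. *)
Lemma direct_sum X Y : exists R, [/\ forall i, mult R i = (mult Y i + mult X i)%N,
  forall N, hdim_rep N R = (hdim_rep N Y + hdim_rep N X)%N,
  forall N, hdim_rep R N = (hdim_rep Y N + hdim_rep X N)%N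
  & forall N (f : 'M_(rdim N, rdim X)) (g : 'M_(rdim N, rdim Y)), hom f -> hom g ->
     exists2 h, @hom _ _ _ _ N R h & forall h', @hom _ _ _ _ R Y h' ->
       exists a b, [/\ @hom _ _ _ _ X Y a, @hom _ _ _ _ Y Y b, h *m h' = f *m a + g *m b
         & a = 0 -> b = 0 -> h' = 0]].
Proof.
have h0 : @hom1 _ _ _ _ X Y 0 by have [] := hom1_closed X Y.
have sd := ext_sesd h0; have [hi hp _ _ _ _] := sd.
have hs : @hom _ _ _ _ X (ext h0) (row_mx 1%:M 0).
  by split; [split|] => /= *; rewrite ?mul_row_block mul_mx_row ?ffunE
    !mulmx0 !mulmx1 !mul0mx !mul1mx ?addr0 ?add0r.
have hr : @hom _ _ _ _ (ext h0) Y (col_mx 0 1%:M).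
  by split; [split|] => /= *; rewrite ?mul_block_col mul_col_mx ?ffunE
    !mulmx0 !mulmx1 !mul0mx !mul1mx ?addr0 ?add0r.
exists (ext h0); split.
- by move=> i; apply: mult_ses => //; do 4 eexists; exact: sd.
- by move=> N; apply: hdim_split sd hs.
- move=> N; rewrite -hdim_dual addnC -!(hdim_dual _ N).
  apply: (hdim_split _ (sesd_dual sd)).
  exact/hom_dual.
move=> N f g hf hg; exists (row_mx f g).
  have [[f1 f2] f3] := hf; have [[g1 g2] g3] := hg.
  by split; [split|] => /= *; rewrite mul_row_block mul_mx_row ?ffunE !mulmx0 ?addr0 ?add0r
    ?f1 ?f2 ?f3 ?g1 ?g2 ?g3.
move=> h' hh'; exists (row_mx 1%:M 0 *m h'), (row_mx 0 1%:M *m h'); split.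
- exact: hom_mul hs hh'.
- exact: hom_mul hi hh'.
- by rewrite -{1}[h']vsubmxK mul_row_col -[h' in RHS]vsubmxK !mul_row_col !mul1mx !mul0mx addr0 add0r.
- by rewrite -[h']vsubmxK !mul_row_col !mul1mx !mul0mx addr0 add0r => -> ->; rewrite col_mx0.
Qed.

Lemma zero_rep : exists Z : rep d B mu, rdim Z = 0%N.
Proof.
have eq0 (A A' : 'M[rat]_0) : A = A' by rewrite [A]flatmx0 [A']flatmx0.
have law : rep_law d mu (fun=> 0 : 'M[rat]_0) 0 (fun _ : arrow n B => 0).
  split=> // a; rewrite /arrow_ok; case: active => //.
by exists (Rep law).
Qed.

Lemma mult_rdim0 M i : rdim M = 0%N -> mult M i = 0%N.
Proof.
move=> m0; rewrite /mult (_ : \rank _ = 0%N) ?div0n //; apply/eqP.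
by rewrite -leqn0 (leq_trans (rank_leq_row _)) // m0.
Qed.

Definition rmultiple Y (k : nat) Z := [/\ forall i, mult Z i = (mult Y i * k)%N,
  forall N, hdim_rep Z N = (hdim_rep Y N * k)%N & forall N, hdim_rep N Z = (hdim_rep N Y * k)%N].

(** The map to Y^k is chosen with k maximal such that its components are independent over End(Y),
    that is, no nonzero map Y^k -> Y kills it. Independence bounds k by dim Hom(X, Y). *)
Lemma rep_left_approximation X Y : rbrick Y ->
  exists k Z K I Q, [/\ rses K X I, rses I Z Q, rmultiple Y k Z,
      hdim_rep Q Y = 0%N & hdim_rep X Y = (hdim_rep Y Y * k)%N].
Proof.
move=> bY.
pose indep k Z f := [/\ rmultiple Y k Z, @hom _ _ _ _ X Z f &
  forall g, @hom _ _ _ _ Z Y g -> f *m g = 0 -> g = 0].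
have lef Z f (U : {vspace 'M[rat]_(rdim X, rdim Y)}) : @hom _ _ _ _ X Z f ->
    (forall g, @hom _ _ _ _ Z Y g -> f *m g = 0 -> g = 0) -> 
    (forall g, @hom _ _ _ _ Z Y g -> f *m g \in U) -> (hdim_rep Z Y <= \dim U)%N.
  move=> hf fi fU; apply: (dim_le (f := fun g : 'M_(rdim Z, rdim Y) => f *m g)) => [a u v|g|g].
  - by rewrite mulmxDr -scalemxAr.
  - by move=> /(vspE _ (hom_closed Z Y))/fU.
  - by move=> /(vspE _ (hom_closed Z Y))/fi; apply.
pose good k := `[< exists Z f, indep k Z f >].
have bound k Z f : indep k Z f -> (hdim_rep Y Y * k <= hdim_rep X Y)%N.
  case=> -[_ hZ _] hf fi; rewrite -hZ; apply: (lef _ f) => // g hg.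
  exact/(vspE _ (hom_closed X Y))/hom_mul.
(* For Y = 0 the bound on k is lost, and k = 0 with the zero module is taken. *)
have [Y0|Yn] := eqVneq (rdim Y) 0%N.
  have [Z Z0] := zero_rep.
  have zh : @hom _ _ _ _ X Z 0 by have [] := hom_closed X Z.
  have [K [I [Q [io [c [ro [s [v [pi [ro' [s' [s1 s2 _ rI]]]]]]]]]]]] := image_factor zh.
  exists 0%N, Z, K, I, Q; split; [by exists io, c, ro, s|by exists v, pi, ro', s'| | |].
  - split=> [i|N|N]; rewrite muln0 ?mult_rdim0 ?hdim_rdim0 //; [by left|by right].
  - by rewrite hdim_rdim0 //; right.
  - by rewrite muln0 hdim_rdim0 //; right.
have hY : (0 < hdim_rep Y Y)%N by apply: hdim_id_gt0; apply/eqP.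
have ex0 : exists k, good k.
  have [Z Z0] := zero_rep; exists 0%N; apply/asboolP; exists Z, 0; split.
  - split=> [i|N|N]; rewrite muln0 ?mult_rdim0 ?hdim_rdim0 //; [by left|by right].
  - by have [] := hom_closed X Z.
  - by move=> g _ _; apply: rdim0_mx; left.
have ub k : good k -> (k <= hdim_rep X Y)%N.
  by case/asboolP=> Z [f /bound]; apply: leq_trans; apply: leq_pmull.
case: (ex_maxnP ex0 ub) => k /asboolP[Z [f ind]] maxk.
have [mZ hf fi] := ind; have [mZ1 mZ2 mZ3] := mZ.
(* By maximality [h] is dependent on the components of [f]; the coefficient of [h] in a relation is
   a nonzero endomorphism of the brick, hence invertible. *)
have surj h : @hom _ _ _ _ X Y h -> exists2 g, @hom _ _ _ _ Z Y g & h = f *m g.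
  move=> hh; apply: contrapT => nh.
  have [R [R1 R2 R3 /(_ X f h hf hh)[u hu uP]]] := direct_sum Z Y.
  suff /maxk : good k.+1 by rewrite ltnn.
  apply/asboolP; exists R, u; split=> //.
    by split=> [i|N|N]; rewrite ?R1 ?R2 ?R3 ?mZ1 ?mZ2 ?mZ3 mulnS.
  move=> g /uP[a [b [ha hb -> ab0]]].
  case: (pselect (b = 0)) => [b0|bn].
    by rewrite b0 mulmx0 addr0 => /(fi _ ha) a0; apply: ab0.
  have ub' := rbrick_unit d_gt0 bY hb bn => /eqP; rewrite addrC addr_eq0 => /eqP hb'.
  case: nh; exists (- (a *m invmx b)).
    have := hom_mul ha (hom_inv hb ub').
    have [z c] := hom_closed Z Y; move=> w.
    by have := c (-1) _ _ w z; rewrite scaleN1r addr0.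
  by rewrite mulmxN mulmxA -mulNmx -hb' mulmxK.
have [K [I [Q [io [c [ro [s [v [pi [ro' [s' [s1 s2 cv rI]]]]]]]]]]]] := image_factor hf.
exists k, Z, K, I, Q; split=> //; [by exists io, c, ro, s|by exists v, pi, ro', s'| |].
  apply/eqP; rewrite -leqn0 leqNgt; apply/negP => /hdim_hom[g hg]; apply.
  have [hv hpi _ spi vpi _] := s2.
  have pg0 : pi *m g = 0.
    by apply: fi; [apply: hom_mul hpi hg|rewrite -cv mulmxA -[c *m v *m pi]mulmxA vpi mulmx0 mul0mx].
  by rewrite -[g]mul1mx -spi -mulmxA pg0 mulmx0.
apply/eqP; rewrite eqn_leq (bound _ _ _ ind) andbT -mZ2.
have fl a : {morph (fun g : 'M_(rdim Z, rdim Y) => f *m g) : x y / a *: x + y}.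
  by move=> x y; rewrite mulmxDr -scalemxAr.
have [V [W [VE WE]]] := dim_ker_img (vsp (@hom _ _ _ _ Z Y)) fl.
rewrite /hdim_rep => <-; apply: leq_trans (leq_addl _ _).
apply/dimvS/subvP => h /(vspE _ (hom_closed X Y))/surj[g hg ->].
by apply/WE; exists g => //; apply/(vspE _ (hom_closed Z Y)).
Qed.

End Extensions.

Section DualExtensions.
Variables (n : nat) (d : 'I_n -> nat) (B : nat) (mu : 'I_n -> 'I_n -> nat).
Hypothesis d_gt0 : forall i, (0 < d i)%N.
Implicit Types (M N K X Y Z I Q R : rep d B mu).

Lemma hdim_quo K X I N : rses K X I -> (hdim_rep I N <= hdim_rep X N)%N.
Proof. by move=> /rses_dual/(hdim_sub (dual N)); rewrite !hdim_dual. Qed.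

Lemma hdim_midl K X I N : rses K X I -> (hdim_rep X N <= hdim_rep K N + hdim_rep I N)%N.
Proof. by move=> /rses_dual/(hdim_midr (dual N)); rewrite !hdim_dual addnC. Qed.

Lemma edim_sub K X I N : rses K X I -> (edim_rep K N <= edim_rep X N)%N.
Proof. by move=> /rses_dual/(edim_quo d_gt0 (dual N)); rewrite !edim_dual. Qed.

Lemma rbrick_dual X : rbrick X -> rbrick (dual X).
Proof.
move=> bX K I Q s1 s2 I0.
have s1' := rses_dual s1; have s2' := rses_dual s2.
rewrite dualK in s1' s2'; have := rdim_ses d_gt0 s1; have := rdim_ses d_gt0 s2.
by have /= -> := bX _ _ _ s2' s1' I0; rewrite addn0 => ->; lia.
Qed.

Lemma rmultiple_dual (Y Z : rep d B (muT mu)) k :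
  rmultiple Y k Z -> @rmultiple _ _ _ mu (dual Y) k (dual Z).
Proof.
case=> h1 h2 h3; split=> [i|N|N]; first by rewrite !mult_dual.
- by rewrite -[N]dualK !hdim_dual h3.
- by rewrite -[N]dualK !hdim_dual h2.
Qed.

Lemma rep_right_approximation X Y : rbrick X ->
  exists k Z K I Q, [/\ rses K Z I, rses I Y Q, rmultiple X k Z,
      hdim_rep X K = 0%N & hdim_rep X Y = (hdim_rep X X * k)%N].
Proof.
move=> /rbrick_dual bX.
have [k [Z [K [I [Q [s1 s2 m h1 h2]]]]]] := rep_left_approximation d_gt0 (dual Y) bX.
exists k, (dual Z), (dual Q), (dual I), (dual K); split.
- exact: rses_dual.
- by have := rses_dual s1; rewrite dualK.
- by have := rmultiple_dual m; rewrite dualK.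
- by rewrite -[X]dualK hdim_dual.
- by rewrite !hdim_dual in h2.
Qed.

Lemma rep_right_extension X Y : rbrick X -> hdim_rep X Y = 0%N -> (0 < edim_rep X Y)%N ->
  exists R, rses Y R X /\ hdim_rep X R = 0%N.
Proof.
move=> /rbrick_dual bX hXY eXY.
have [||R [s h]] := @rep_left_extension _ _ _ _ d_gt0 (dual Y) (dual X) bX.
- by rewrite hdim_dual.
- by rewrite edim_dual.
exists (dual R); split; first by have := rses_dual s; rewrite !dualK.
by rewrite -[X]dualK hdim_dual.
Qed.

End DualExtensions.

(** * Simple representations *)

Section Simples.
Variables (n : nat) (d : 'I_n -> nat) (B : nat) (mu : 'I_n -> 'I_n -> nat).
Hypothesis d_gt0 : forall i, (0 < d i)%N.
Hypothesis mu_le : forall i j, (mu i j <= B)%N.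
Implicit Types (M N : rep d B mu).

(** The companion matrix of X^m - 2, by Cayley and Hamilton. *)
Lemma root_of_two m : (0 < m)%N -> exists T : 'M[rat]_m, T ^+ m = 2%:M.
Proof.
case: m => // m _; pose p : {poly rat} := 'X^(m.+1) - 2%:P.
have sp : (size p).-1 = m.+1 by rewrite size_XnsubC.
have pm : p \is monic by rewrite monicXnsubC.
have := companionmxK pm; move: (companionmx p); rewrite sp => T cT.
exists T; have := Cayley_Hamilton T; rewrite cT /p rmorphB rmorphXn /= horner_mx_X horner_mx_C.
by move/eqP; rewrite subr_eq0 => /eqP.
Qed.

Lemma simples_exist : exists S : 'I_n -> rep d B mu,
  (forall i j, mult (S i) j = (i == j)) /\ forall i j, i != j -> hdim_rep (S i) (S j) = 0%N.
Proof.
have [T TP] : exists T : forall i, 'M[rat]_(d i), forall i, T i ^+ d i = 2%:M.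
  exists (fun i => sval (cid (root_of_two (d_gt0 i)))) => i.
  exact: svalP (cid (root_of_two (d_gt0 i))).
pose ee i j : 'M[rat]_(d i) := if i == j then 1%:M else 0.
have law i : rep_law d mu (ee i) (T i) (fun _ : arrow n B => 0).
  split=> [j k|||j|a].
  - rewrite /ee; case: eqP => [->|_]; last by rewrite mul0mx if_same.
    by rewrite mul1mx.
  - by rewrite (bigD1 i) //= /ee eqxx big1 ?addr0 // => j; rewrite eq_sym => /negPf->.
  - by move=> j; rewrite /ee; case: eqP; rewrite ?mulmx0 ?mul0mx ?mulmx1 ?mul1mx.
  - rewrite /ee; case: eqP => [<-|_]; last by rewrite mulmx0 scaler0.
    by rewrite mulmx1 TP scalemx1.
  by rewrite /arrow_ok; case: ifP => // _; split; rewrite ?mulmx0 ?mul0mx.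
exists (fun i => Rep (law i)); split=> i j.
  rewrite /mult /= /ee; case: eqP => [<-|_]; first by rewrite mxrank1 divnn d_gt0.
  by rewrite mxrank0 div0n.
move=> ij; apply/eqP; rewrite -leqn0 leqNgt; apply/negP => /hdim_hom[f [[/(_ i) f1 _] _]]; apply.
by move: f1; rewrite /= /ee eqxx [j == i]eq_sym (negPf ij) mul1mx mulmx0.
Qed.

Lemma h1num_pair M N :
  h1num M N = (\sum_i \sum_j mu i j * (lcmn (d i) (d j) * mult M i * mult N j))%N.
Proof.
rewrite pair_bigA /= /h1num.
rewrite -(pair_big_dep xpredT (fun p l => active mu (p, l : 'I_B))
  (fun p _ => lcmn (d p.1) (d p.2) * mult M p.1 * mult N p.2)%N) /=.
apply: eq_bigr => p _; rewrite /active /=.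
by rewrite (big_ord_narrow (mu_le p.1 p.2)) sum_nat_const card_ord.
Qed.

Lemma edim_rep0 M N : h1num M N = 0%N -> edim_rep M N = 0%N.
Proof. by rewrite /edim_rep dim_hom1 // => ->. Qed.

End Simples.

(** * The species of a generalised Cartan lattice *)

Section GCHereditary.
Variable L : gcLattice.
Notation E := (gc_seq L).
Notation n := (size E).

Definition gd (i : 'I_n) : nat := `|bform E`_i E`_i|%N.
(** The number of arrows. The quotient is exact for i < j, as both e_i and e_j are roots, and each
    arrow contributes the lcm of the two degrees to the dimension of Ext between the simple
    modules. *)
Definition gmu (i j : 'I_n) : nat :=
  (if i < j then `|bform E`_i E`_j| %/ lcmn (gd i) (gd j) else 0)%N.
Definition gB : nat := (\max_i \max_j gmu i j)%N.

Lemma gdE (i : 'I_n) : bform E`_i E`_i = (gd i)%:Z.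
Proof.
have [r _] := gc_exceptional L; have [h _] := r E`_i (mem_nth 0 (ltn_ord i)).
by rewrite /gd; lia.
Qed.

Lemma gd_gt0 i : (0 < gd i)%N.
Proof.
have [r _] := gc_exceptional L; have [h _] := r E`_i (mem_nth 0 (ltn_ord i)).
by rewrite /gd; lia.
Qed.

Lemma gmu_le i j : (gmu i j <= gB)%N.
Proof.
apply: leq_trans (leq_bigmax i); exact: (leq_bigmax (F := fun j => gmu i j) j).
Qed.

Lemma gmuE (i j : 'I_n) : i != j -> bform E`_i E`_j = - (gmu i j * lcmn (gd i) (gd j))%:Z.
Proof.
move=> ij; have [r ex] := gc_exceptional L; rewrite /gmu; case: ltnP => lt; last first.
  by rewrite mul0n ex // ltn_neqAle eq_sym ij.
have neg : bform E`_i E`_j <= 0.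
  by apply: (gc_orthogonal (ltn_ord i) (ltn_ord j)) => /eqP; apply/negP.
rewrite divnK; first by lia.
have [_ /(_ E`_j)[d1 _]] := r E`_i (mem_nth 0 (ltn_ord i)).
have [_ /(_ E`_i)[_ d2]] := r E`_j (mem_nth 0 (ltn_ord j)).
by rewrite dvdn_lcm; move: d1 d2; rewrite !dvdzE => -> ->.
Qed.

Notation grep := (rep gd gB gmu).
Implicit Types (M N X Y Z K I Q R : grep).

Definition gcls M : L := \sum_(i < n) E`_i *~ mult M i.

Definition gcat : hcat_data L :=
  @HCatData L grep gcls (fun M N => (hdim_rep M N)%:Z) (@rses _ _ _ _) (@rho L).

Lemma gbform M N : bform (gcls M) (gcls N) = (h0num M N)%:Z - (h1num M N)%:Z.
Proof.
rewrite (h1num_pair gmu_le) /h0num bform_suml !(big_morph Posz PoszD (erefl (Posz 0))) -sumrB; apply: eq_bigr => i _.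
rewrite (big_morph Posz PoszD (erefl (Posz 0))) bform_sumr (bigD1 i) //= [in RHS](bigD1 i) //= !bformE gdE.
have -> : gmu i i = 0%N by rewrite /gmu ltnn.
rewrite mul0n add0r.
have -> : \sum_(j < n | j != i) (Posz (gmu i j * (lcmn (gd i) (gd j) * mult M i * mult N j))) =
   - \sum_(j < n | j != i) bform (E`_i *~ mult M i) (E`_j *~ mult N j).
  rewrite -sumrN; apply: eq_bigr => j ji; rewrite !bformE gmuE 1?eq_sym //; lia.
rewrite opprK; congr (_ + _); lia.
Qed.

Lemma edimE M N : @edim L gcat M N = (edim_rep M N)%:Z.
Proof. by rewrite /edim /= gbform; have := euler gd_gt0 M N; lia. Qed.

(** Here the two heights meet: the linear form of the affine action is the dimension of modules over
    the rationals, since the simple module of e_i has dimension <e_i, e_i>. *)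
Lemma rho_gcls M : rho (gcls M) = (rdim M)%:Z.
Proof.
rewrite /gcls rdim_mult.
have rs (s : seq 'I_n) : rho (\sum_(i <- s) E`_i *~ mult M i) =
    (\sum_(i <- s) mult M i * gd i)%N%:Z.
  elim: s => [|i s IHs]; first by rewrite !big_nil rho0.
  rewrite !big_cons rhoD IHs rhoMz rho_simple ?mem_nth // gdE; lia.
exact: rs.
Qed.

Lemma gcls_eq0 M : gcls M = 0 <-> rdim M = 0%N.
Proof.
split=> [m0|m0]; first by have := rho_gcls M; rewrite m0 rho0 => -[].
by rewrite /gcls big1 // => i _; rewrite mult_rdim0.
Qed.

Lemma gcls_ses K X I : rses K X I -> gcls X = gcls K + gcls I.
Proof.
move=> s; rewrite /gcls -big_split; apply: eq_bigr => i _.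
by rewrite (mult_ses gd_gt0 i s) PoszD mulrzDr.
Qed.

Lemma gbrick X : @brick L gcat X <-> rbrick X.
Proof.
split=> bX K I Q s1 s2 I0; apply/gcls_eq0; last first.
  by apply/(bX K I Q) => // /gcls_eq0.
by apply: (bX K I Q) => //= /gcls_eq0.
Qed.

Lemma gmultiple Y k Z : rmultiple Y k Z -> @multiple_of L gcat Y k Z.
Proof.
case=> h1 h2 h3; split=> [|N] /=; last by rewrite h2 h3 !PoszM.
by rewrite /gcls mulrz_suml; apply: eq_bigr => i _; rewrite h1 PoszM mulrzA.
Qed.

Lemma gcat_hereditary : hereditary gcat.
Proof.
split=> //=.
- exact: rhoD.
- by move=> M; rewrite rho_gcls.
- by move=> M; rewrite rho_gcls => -[] /gcls_eq0.
- by move=> M N; rewrite edimE.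
- by move=> M N /gcls_eq0 M0; rewrite !hdim_rdim0 //; [right|left].
- by move=> M /gcls_eq0/hdim_id_gt0.
- exact: gcls_ses.
- by move=> K X I N s; rewrite lez_nat; apply: hdim_sub s.
- by move=> K X I N s; rewrite lez_nat; apply: hdim_quo s.
- by move=> K X I N s; rewrite -PoszD lez_nat; apply: hdim_midr s.
- by move=> K X I N s; rewrite -PoszD lez_nat; apply: hdim_midl s.
- by move=> K X I N s; rewrite !edimE lez_nat; apply: (edim_quo gd_gt0 N s).
- by move=> K X I N s; rewrite !edimE lez_nat; apply: (edim_sub gd_gt0 N s).
- move=> X Y; rewrite ltz_nat => /rep_factorisation[K [I [Q [s1 s2 I0]]]].
  by exists K, I, Q; split=> // /gcls_eq0.
- move=> X Y /gbrick/(rep_left_approximation gd_gt0 X)[k [Z [K [I [Q [s1 s2 m h1 h2]]]]]].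
  by exists k, Z, K, I, Q; split; rewrite ?h1 ?h2 ?PoszM //; apply: gmultiple.
- move=> X Y /gbrick/(rep_right_approximation gd_gt0 Y)[k [Z [K [I [Q [s1 s2 m h1 h2]]]]]].
  by exists k, Z, K, I, Q; split; rewrite ?h1 ?h2 ?PoszM //; apply: gmultiple.
- move=> X Y /gbrick bY [h]; rewrite edimE ltz_nat => e.
  by have [R [s h0]] := rep_left_extension gd_gt0 bY h e; exists R; rewrite h0.
- move=> X Y /gbrick bX [h]; rewrite edimE ltz_nat => e.
  by have [R [s h0]] := rep_right_extension gd_gt0 bX h e; exists R; rewrite h0.
Qed.

Lemma gcat_image_in_kernel K X I : rses K X I -> 0 < @hdim L gcat X K ->
  exists K' I' Q' Q'', [/\ rses K' X I', rses I' K Q', rses I' X Q'' & gcls I' <> 0].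
Proof.
move=> s; rewrite ltz_nat => /(rep_image_in_kernel s)[K' [I' [Q' [Q'' [s1 s2 s3 h]]]]].
by exists K', I', Q', Q''; split=> // /gcls_eq0.
Qed.

Lemma gcat_simples : exists Xs : seq gcat, mseq Xs /\ map (@cls L gcat) Xs = E.
Proof.
have [S [Sm Sh]] := @simples_exist n gd gB gmu gd_gt0.
have Sc i : gcls (S i) = E`_i.
  rewrite /gcls (bigD1 i) //= big1 => [|j ji]; rewrite Sm ?eqxx ?addr0 //.
  by rewrite eq_sym (negPf ji).
have cE : map (@cls L gcat) (map S (enum 'I_n)) = E.
  rewrite -map_comp (eq_map (g := nth 0 E \o val)) => [|i]; last exact: Sc.
  by rewrite map_comp val_enum_ord; apply: mkseq_nth.
exists (map S (enum 'I_n)); split=> //; split.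
- by rewrite cE; apply: gc_exceptional.
- by rewrite cE; apply: gc_complete.
- rewrite pairwise_map; have : uniq (enum 'I_n) by apply: enum_uniq.
  elim: (enum _) => //= i s IHs /andP[is' us]; rewrite IHs // andbT.
  apply/allP => j js; rewrite /hvan /= Sh //; apply: contraNneq is' => <-; exact: js.
rewrite all_map; apply/allP => i _; rewrite /= /rigid /= Sc gdE.
have := euler gd_gt0 (S i) (S i).
have h1 : h1num (S i) (S i) = 0%N.
  rewrite (h1num_pair gmu_le) big1 // => j _; rewrite big1 // => k _; rewrite !Sm.
  case: eqP => [->|_]; last by rewrite muln0 mul0n muln0.
  case: eqP => [->|_]; last by rewrite !muln0.
  by rewrite /gmu ltnn.
rewrite (edim_rep0 gd_gt0 h1) h1 !addn0 => ->; rewrite /h0num (bigD1 i) //= big1 => [|j ji].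
  by rewrite Sm eqxx !muln1 addn0.
by rewrite !Sm [i == j]eq_sym (negPf ji) muln0.
Qed.

End GCHereditary.

(** * Orthogonal representatives of orbits *)

Lemma map_split2 (T U : Type) (f : T -> U) s (P S : seq U) (a b : U) : map f s = P ++ a :: b :: S ->
  exists s1 x y s2, [/\ s = s1 ++ x :: y :: s2, map f s1 = P, f x = a, f y = b & map f s2 = S].
Proof.
elim: P s => [|p P IHP] [|x s] //=.
  by case: s => //= y s [<- <- <-]; exists [::], x, y, s.
by case=> <- /IHP[s1 [x' [y [s2 [-> <- <- <- <-]]]]]; exists (x :: s1), x', y, s2.
Qed.

Lemma map_split (T U : Type) (f : T -> U) s (P S : seq U) : map f s = P ++ S ->
  exists s1 s2, [/\ s = s1 ++ s2, map f s1 = P & map f s2 = S].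
Proof.
elim: P s => [|p P IHP] s /=; first by move=> e; exists [::], s.
by case: s => //= x s [<- /IHP[s1 [s2 [-> <- <-]]]]; exists (x :: s1), s2.
Qed.

Section OrthogonalReduction.
Variable L : gcLattice.
Implicit Types (a b x y z : L) (A B C F G H S : seq L).
Notation E := (gc_seq L).
Notation mods := (seq (gcat L)).
Notation classes := (map (@cls L (gcat L))).

Lemma posabs_sign a z : real_root a -> pos z -> z = a \/ z = - a -> z = posabs a.
Proof.
move=> /real_signs sa pz; rewrite /posabs; case: asboolP => [pa|na] [] e.
- by [].
- by rewrite e in pz *; rewrite (pos_anti pa pz) oppr0.
- by rewrite e in pz.
- by [].
Qed.

Lemma posabs_pos a : pos a -> posabs a = a.
Proof. by rewrite /posabs; case: asboolP. Qed.

Lemma map_posabs_pos A : (forall a, a \in A -> pos a) -> map (@posabs L) A = A.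
Proof. by move=> pA; rewrite -[RHS]map_id; apply/eq_in_map => a /pA/posabs_pos. Qed.

Lemma posabsP a : posabs a = a \/ posabs a = - a.
Proof. by rewrite /posabs; case: asboolP => _; [left|right]. Qed.

Lemma srefl_posabs a b : real_root a -> srefl (posabs a) (posabs b) = srefl a b \/
  srefl (posabs a) (posabs b) = - srefl a b.
Proof.
move=> /real_is_root ra; have -> x : srefl (posabs a) x = srefl a x.
  by case: (posabsP a) => ->; rewrite ?srefl_opp.
by case: (posabsP b) => ->; [left|right]; rewrite ?sreflN.
Qed.

Lemma pos_gcls (X : gcat L) : pos (cls X).
Proof.
rewrite /= /gcls; elim: (index_enum _) => [|i s IHs]; first by rewrite big_nil; apply: pos0.
by rewrite big_cons; apply: posD => //; apply: posMz => //; apply/pos_simple/mem_nth.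
Qed.

(** Hurwitz moves are followed by mutations of modules, starting from the simple ones; the sign left
    open by a mutation is fixed because classes of modules are positive. *)
Lemma orbit_mseq C : braid_orbit E C -> exists Xs : mods, mseq Xs /\ classes Xs = map (@posabs L) C.
Proof.
move=> oC; have [_ //] : reals C /\ exists Xs : mods, mseq Xs /\ classes Xs = map (@posabs L) C.
have rE := reals_simple (L := L); have hC := gcat_hereditary L.
move: C oC; apply: (@bo_ind L E) => [|A x y B oG|A x y B oG|A x B].
- split=> //; have [Xs [ms eXs]] := gcat_simples L; exists Xs; split=> //.
  by rewrite eXs map_posabs_pos // => e /pos_simple.
- move=> [rG [Xs [ms]]]; rewrite map_cat => /(@map_split2 _ _ (@cls L (gcat L)))[As [X [Y [Bs [eXs eA eX eY eB]]]]].
  have rG' := reals_bo rE (bo_sigma oG); split=> //.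
  rewrite eXs in ms; have [R [eR msR]] := mutation_right hC ms.
  exists (As ++ Y :: R :: Bs); split=> //.
  rewrite [LHS](map_cat _ As) eA [RHS]map_cat; congr (_ ++ _).
  rewrite -[LHS]/(cls Y :: cls R :: classes Bs) eY eB; congr (_ :: _ :: _).
  have /reals_cat[_ /reals_cons[ry /reals_cons[rR _]]] := rG'.
  apply: posabs_sign => //; first exact: pos_gcls.
  move: eR; rewrite eX eY; case: (srefl_posabs x ry) => -> [->|->];
  by rewrite ?opprK; auto.
- move=> [rG [Xs [ms]]]; rewrite map_cat => /(@map_split2 _ _ (@cls L (gcat L)))[As [X [Y [Bs [eXs eA eX eY eB]]]]].
  have rG' := reals_bo rE (bo_sigmaV oG); split=> //.
  rewrite eXs in ms; have [R [eR msR]] := mutation_left hC ms.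
  exists (As ++ R :: X :: Bs); split=> //.
  rewrite [LHS](map_cat _ As) eA [RHS]map_cat; congr (_ ++ _).
  rewrite -[LHS]/(cls R :: cls X :: classes Bs) eX eB; congr (_ :: _).
  have /reals_cat[_ /reals_cons[rR /reals_cons[rx _]]] := rG'.
  apply: posabs_sign => //; first exact: pos_gcls.
  move: eR; rewrite eX eY; case: (srefl_posabs y rx) => -> [->|->];
  by rewrite ?opprK; auto.
move=> [/reals_cat[rA /reals_cons[rx rB]] [Xs [ms eXs]]]; split.
  by apply/reals_cat; split=> //; apply/reals_cons; split=> //; apply: real_opp.
exists Xs; split=> //; rewrite eXs !map_cat /=; congr (_ ++ _ :: _).
apply: posabs_sign; [exact: real_opp|exact: pos_posabs|].
by rewrite opprK; case: (posabsP x); auto.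
Qed.

(** The species is hidden from here on; only the numerical laws remain accessible. *)
Lemma module_sequences : exists C : hcat_data L, [/\ hereditary C,
  forall K X I : C, ses K X I -> 0 < hdim X K ->
    exists K' I' Q' Q'' : C, [/\ ses K' X I', ses I' K Q', ses I' X Q'' & cls I' <> 0]
  & forall A, braid_orbit E A -> exists Xs : seq C, mseq Xs /\ map (@cls L C) Xs = map (@posabs L) A].
Proof.
exists (gcat L); split; [exact: gcat_hereditary|exact: gcat_image_in_kernel|].
exact: orbit_mseq.
Qed.

Lemma real_pos_rho_gt0 a : real_root a -> pos a -> 0 < rho a.
Proof. by move=> /real_is_root/root_nz a0 pa; apply: rho_gt0. Qed.

(* The displacements of s_x s_y and s_y s_x are positive; if no Hurwitz move
   lowers the pair (x, y) and <x, y> > 0, then the first one has height 0. *)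
Lemma lowest_pair_obtuse x y : real_root x -> real_root y -> pos x -> pos y -> bform y x = 0 ->
  rho x <= rho (posabs (srefl y x)) -> rho y <= rho (posabs (srefl x y)) -> bform x y <= 0.
Proof.
move=> rx ry px py yx lx ly; rewrite leNgt; apply/negP => c0.
have [rtx rty] := (real_is_root rx, real_is_root ry).
have [gx gy] := (real_good rx, real_good ry).
have p0 := real_pos_rho_gt0 rx px; have q0 := real_pos_rho_gt0 ry py.
have ep := cohtE gx; have eq := cohtE gy.
have [dx dy] := (root_gt0 rtx, root_gt0 rty).
have ek : root_coef y x * bform y y = bform x y by rewrite root_coefE // /symform yx addr0.
have el : root_coef x y * bform x x = bform x y by rewrite root_coefE // /symform yx add0r.
have P0 : 0 < coht x by move: p0; rewrite -ep pmulr_lgt0.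
have Q0 : 0 < coht y by move: q0; rewrite -eq pmulr_lgt0.
have rho_abs z : rho (posabs z) = rho z \/ rho (posabs z) = - rho z.
  by case: (posabsP z) => ->; rewrite ?rhoN; auto.
(* The height of s_y x is rho x - <x, y> coht y, less than rho x; so minimality can hold only
   through the opposite sign. *)
have key1 : rho x * 2 <= bform x y * coht y.
  have e : bform x y * coht y = rho y * root_coef y x by rewrite -ek -eq; ring.
  have : 0 < bform x y * coht y by apply: mulr_gt0.
  move: lx; case: (rho_abs (srefl y x)) => ->; rewrite rho_srefl; lia.
have key2 : rho y * 2 <= bform x y * coht x.
  have e : bform x y * coht x = rho x * root_coef x y by rewrite -el -ep; ring.
  have : 0 < bform x y * coht x by apply: mulr_gt0.
  move: ly; case: (rho_abs (srefl x y)) => ->; rewrite rho_srefl; lia.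
have pD : pos (displ [:: x; y]) by apply: displ_pos_real => z; rewrite !inE => /orP[] /eqP->.
have D0 : displ [:: x; y] = 0.
  apply: rho_eq0 => //; apply/eqP; rewrite eq_le rho_ge0 // andbT.
  rewrite displ2 // rhoD !rhoMz.
  have -> : rho x * (coht x - coht y * root_coef x y) =
      rho x * coht x - coht x * (bform x y * coht y) by rewrite -el -ep; ring.
  have := ler_wpM2l (ltW P0) key1; have := ler_wpM2l (ltW Q0) key2; lia.
(* As <y, x> = 0, pairing with y on the left leaves coht y times <y, y>, which is nonzero. *)
have := congr1 (bform y) D0; rewrite displ2 // !bformE yx mul0r add0r => /eqP.
by rewrite mulf_eq0 (gt_eqF dy) (gt_eqF Q0).
Qed.

Definition height_sum G : int := \sum_(g <- G) rho g.

Definition lowest F G := [/\ braid_orbit F G, forall g, g \in G -> pos g &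
  forall G', braid_orbit F G' -> (forall g, g \in G' -> pos g) -> height_sum G <= height_sum G'].

Lemma reals_posabs G : reals G -> forall g, g \in map (@posabs L) G -> pos g.
Proof. by move=> rG g /mapP[a /rG/pos_posabs pa ->]. Qed.

Lemma lowest_exists F : reals F -> exists G, lowest F G.
Proof.
move=> rF.
pose good m := `[< exists G, [/\ braid_orbit F G, forall g, g \in G -> pos g &
  height_sum G = m%:Z] >].
have hs0 G : (forall g, g \in G -> pos g) -> 0 <= height_sum G.
  elim: G => [|g G IHG] pG; first by rewrite /height_sum big_nil.
  rewrite /height_sum big_cons; apply: addr_ge0; first by apply/rho_ge0/pG/mem_head.
  by apply: IHG => h hG; apply: pG; rewrite inE hG orbT.
have ex : exists m, good m.
  exists `|height_sum (map (@posabs L) F)|%N; apply/asboolP; exists (map (@posabs L) F); split.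
  - exact/bo_posabs/BraidOrbit_id.
  - exact: reals_posabs.
  - by have := hs0 _ (reals_posabs rF); lia.
case: (ex_minnP ex) => m /asboolP[G [oG pG hG]] minm; exists G; split=> // G' oG' pG'.
have e := hs0 _ pG'; rewrite hG.
have : good `|height_sum G'|%N by apply/asboolP; exists G'; split=> //; lia.
by move/minm; lia.
Qed.

Lemma lowest_swap F As a b Cs : is_root b -> symform a b = 0 ->
  lowest F (As ++ a :: b :: Cs) -> lowest F (As ++ b :: a :: Cs).
Proof.
move=> rb ab [oG pG minG]; split=> [|g gG|G' oG' pG'].
- by have := bo_sigma oG; rewrite srefl_orth.
- by apply: pG; move: gG; rewrite !mem_cat !inE; case/or4P=> ->; rewrite ?orbT.
apply: le_trans (minG _ oG' pG'); rewrite /height_sum !big_cat !big_cons /=; lia.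
Qed.

Lemma lowest_adjacent F As x y Cs : reals F -> exceptional (As ++ x :: y :: Cs) ->
  lowest F (As ++ x :: y :: Cs) -> bform x y <= 0.
Proof.
move=> rF /exceptional_cat[_ /exceptional_cons[_ _ exx] _] [oG pG minG].
have /reals_cat[rAs /reals_cons[rx /reals_cons[ry rCs]]] := reals_bo rF oG.
have px : pos x by apply: pG; rewrite mem_cat inE eqxx orbT.
have py : pos y by apply: pG; rewrite mem_cat !inE eqxx !orbT.
have pC z : z \in Cs -> pos z by move=> zC; apply: pG; rewrite mem_cat !inE zC !orbT.
have pA z : z \in As -> pos z by move=> zA; apply: pG; rewrite mem_cat zA.
have height_cat P z z' S : height_sum (P ++ z :: z' :: S) =
    height_sum P + rho z + rho z' + height_sum S.
  by rewrite /height_sum big_cat !big_cons /=; ring.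
apply: lowest_pair_obtuse => //; first by apply: exx; rewrite inE eqxx.
  have := minG _ (bo_posabs (bo_sigma oG)).
  have := reals_bo rF (bo_sigma oG) => /reals_posabs pG' /(_ pG').
  by rewrite map_cat /= (posabs_pos py) !map_posabs_pos // !height_cat; lia.
have := minG _ (bo_posabs (bo_sigmaV oG)).
have := reals_bo rF (bo_sigmaV oG) => /reals_posabs pG' /(_ pG').
by rewrite map_cat /= (posabs_pos px) !map_posabs_pos // !height_cat; lia.
Qed.

(** By induction on the number of entries between [x] and [y]. If <x, y> > 0, there is a nonzero map
    X -> Y, mono or epi. If mono, Ext(Y, B) = 0 gives Ext(X, B) = 0 for the neighbour b of x, so <x,
    b>, nonpositive by induction, is 0; then b commutes past x and the distance shrinks. If epi, the
    neighbour of y is moved past y in the same way. *)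
Lemma lowest_obtuse F H As x Bs y Cs : reals F -> braid_orbit E (F ++ H) ->
  lowest F (As ++ x :: Bs ++ y :: Cs) -> bform x y <= 0.
Proof.
move=> rF oFH; have rE := reals_simple (L := L); have [C [hC _ mseqC]] := module_sequences.
have [m] := ubnP (size Bs); elim: m As x Bs y Cs => // m IHm As x Bs y Cs; rewrite ltnS => le_m low.
have [oG pG _] := low.
have oGH : braid_orbit E ((As ++ x :: Bs ++ y :: Cs) ++ H).
  by apply: bo_trans oFH _; apply: bo_catl.
have /reals_cat[rG _] := reals_bo rE oGH.
have exG : exceptional (As ++ x :: Bs ++ y :: Cs).
  by have := exceptional_bo (gc_exceptional L) oGH => /exceptional_cat[].
case: (ltnP 0 (size Bs)) => [Bs0|]; last first.
  by rewrite leqn0 => /nilP eBs; rewrite eBs in exG low; apply: lowest_adjacent exG low.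
have /exceptional_cat[_ /exceptional_cons[rx /exceptional_cat[_ /exceptional_cons[ry _ _] exB] exx] _] := exG.
rewrite leNgt; apply/negP => c0.
have obt B1 b B2 : Bs = B1 ++ b :: B2 -> bform x b <= 0 /\ bform b y <= 0.
  move=> eBs; rewrite eBs in le_m low.
  have sz : (size B1 < m)%N /\ (size B2 < m)%N by move: le_m; rewrite size_cat /=; lia.
  split.
    by move: low; rewrite -catA /=; apply: IHm; case: sz.
  apply: (IHm (As ++ x :: B1) b B2 y Cs); first by case: sz.
  by move: low; rewrite -!catA.
have [Xs [ms]] := mseqC _ oGH; have [_ _ pw _] := ms.
rewrite map_cat map_posabs_pos // -catA /= -catA.
case/map_split=> As' [Xs1 [eXs _]]; case: Xs1 eXs => // X Xs1 eXs [eX].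
case/map_split=> Bs' [Ys1 [eXs1 eBs]]; case: Ys1 eXs1 => // Y Cs' eXs1 [eY _].
rewrite {}eXs1 in eXs; rewrite {Xs}eXs in ms pw.
have h0 : 0 < hdim X Y.
  by move: c0 (edim_ge0 hC X Y); rewrite -eX -eY /edim; lia.
have [_ []] := mseq_hom hC ms h0 => mono.
  case: Bs Bs0 eBs obt low exB exx le_m {oG pG oGH rG exG} => // b Bs _.
  case: Bs' ms pw => // B Bs' ms pw [eB _] obt low exB exx le_m.
  have [xb _] := obt [::] b Bs erefl.
  move: pw; rewrite pairwise_cat /= !all_cat /= => /and3P[_ _ /and3P[_ /and3P[_ /eqP hYB _] _]].
  have yb : bform y b = 0 by apply: exB; rewrite ?mem_head.
  have e0 : edim Y B = 0 by rewrite /edim hYB; move: yb; rewrite -eY -eB => ->.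
  have := mono _ e0; rewrite /edim => e1.
  have xb0 : bform x b = 0.
    by move: xb e1 (hdim_ge0 hC X B); rewrite -eX -eB; lia.
  have bx : bform b x = 0 by apply: exx; rewrite mem_head.
  have rb : is_root b.
    have [/reals_cat[_ /reals_cons[_ /reals_cons[/real_is_root]]]] : reals (As ++ x :: b :: Bs ++ y :: Cs) /\ True.
      by split=> //; have [oG _ _] := low; apply: reals_bo oG.
    by [].
  have low' : lowest F ((rcons As b) ++ x :: Bs ++ y :: Cs).
    by rewrite cat_rcons; apply: lowest_swap low; rewrite // /symform xb0 bx.
  by have := IHm _ _ _ _ _ le_m low'; rewrite leNgt c0.
case/lastP: Bs Bs0 eBs obt low exB exx le_m {oG pG oGH rG exG} => // Bs b _.
case/lastP: Bs' ms pw => [|Bs' B] ms pw; first by case: (Bs).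
rewrite map_rcons => /rcons_inj[_ eB] obt low exB exx le_m.
have [_ by_] := obt Bs b [::] (esym (cats1 _ _)).
move: pw; rewrite pairwise_cat /= !all_cat all_rcons /= => /and3P[_ _ /andP[/andP[/andP[/eqP hBX _] _] _]].
have bx : bform b x = 0 by apply: exx; rewrite mem_cat mem_rcons mem_head.
have e0 : edim B X = 0 by rewrite /edim hBX; move: bx; rewrite -eX -eB => ->.
have := mono _ e0; rewrite /edim => e1.
have by0 : bform b y = 0.
  by move: by_ e1 (hdim_ge0 hC B Y); rewrite -eY -eB; lia.
have yb : bform y b = 0 by apply: exB; rewrite ?mem_rcons ?mem_head.
have low' : lowest F (As ++ x :: Bs ++ y :: b :: Cs).
  have := @lowest_swap F (As ++ x :: Bs) b y Cs ry.
  rewrite /symform by0 yb -!catA /=; apply=> //.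
  by move: low; rewrite -cats1 -!catA.
have sz : (size Bs < m)%N by move: le_m; rewrite size_rcons.
by have := IHm _ _ _ _ _ sz low'; rewrite leNgt c0.
Qed.

Lemma orthogonal_representative F H : braid_orbit E (F ++ H) ->
  exists G, [/\ braid_orbit F G, forall g, g \in G -> pos g &
    pairwise (fun x y => bform x y <= 0) G].
Proof.
move=> oFH; have /reals_cat[rF _] := reals_bo (reals_simple (L := L)) oFH.
have [G low] := lowest_exists rF; have [oG pG _] := low; exists G; split=> //.
have : forall As x Bs y Cs, G = As ++ x :: Bs ++ y :: Cs -> bform x y <= 0.
  by move=> As x Bs y Cs eG; move: low; rewrite eG; apply: lowest_obtuse rF oFH.
elim: G {low oG pG} => //= g G IHG obt; apply/andP; split.
  apply/allP => y yG; move: obt; case/splitPr: G / yG {IHG} => Bs Cs obt.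
  exact: (obt [::]).
by apply: IHG => As x Bs y Cs eG; apply: (obt (g :: As)); rewrite eG.
Qed.

End OrthogonalReduction.

(** * Permutations of exceptional sequences and the monoids they generate *)

Section SumsOfExceptionals.
Variable L : bilLattice.
Implicit Types (a b f g x y z : L) (A B F G s t : seq L).

Lemma exceptional_nz F f : exceptional F -> f \in F -> f != 0.
Proof.
move=> /exceptional_roots rF /rF/root_neq0.
by apply: contraNneq => ->; rewrite bform0l.
Qed.

Lemma exceptional_uniq F : exceptional F -> uniq F.
Proof.
elim: F => //= f F IHF /exceptional_cons[rf oF fF]; rewrite IHF // andbT.
by apply/negP => /fF /eqP; rewrite (negPf (root_neq0 rf)).
Qed.

(** Two entries that occur in both orders are orthogonal on both sides, so their reflections fix
    each other and the braid moves used here are plain transpositions. *)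
Lemma perm_exceptional_bo F G : exceptional F -> exceptional G -> perm_eq F G -> braid_orbit F G.
Proof.
elim: G F => [|g G IHG] F oF.
  by move=> _ /perm_nilP->; apply: BraidOrbit_id.
move=> /exceptional_cons[rg oG gG] pFG.
have gF : g \in F by rewrite (perm_mem pFG) mem_head.
case/splitPr: F / gF oF pFG => A B oF pFG.
have pAB : perm_eq (A ++ B) G.
  by rewrite -(perm_cons g) -[g :: A ++ B]/([:: g] ++ A ++ B) -(perm_catCA A).
have /exceptional_cat[oA /exceptional_cons[_ oB gB] AB] := oF.
have oAB : exceptional (A ++ B).
  apply/exceptional_cat; split=> // a b aA bB; apply: AB => //.
  by rewrite inE bB orbT.
have gA c : c \in A -> srefl g c = c.
  move=> cA; rewrite srefl_orth // /symform (gG c) ?AB ?mem_head //.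
  by rewrite -(perm_mem pAB) mem_cat cA.
have move_front C B' : {subset C <= A} -> braid_orbit (C ++ g :: B') (g :: C ++ B').
  elim/last_ind: C B' => [|C c IHC] B' sC; first exact: BraidOrbit_id.
  rewrite !cat_rcons; have cA : c \in A by apply: sC; rewrite mem_rcons mem_head.
  have sC' : {subset C <= A} by move=> x xC; apply: sC; rewrite mem_rcons inE xC orbT.
  apply: bo_trans (IHC _ sC'); rewrite -{2}(gA c cA).
  exact/bo_sigma/BraidOrbit_id.
apply: bo_trans (move_front A B (fun _ => id)) _.
exact/(bo_catr [:: g])/IHG.
Qed.

Definition sum_of F x := exists2 s, {subset s <= F} & x = \sum_(y <- s) y.

Lemma sum_of0 F : sum_of F 0.
Proof. by exists [::]; rewrite ?big_nil. Qed.

Lemma sum_ofD F x y : sum_of F x -> sum_of F y -> sum_of F (x + y).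
Proof.
move=> [s sF ->] [t tF ->]; exists (s ++ t); last by rewrite big_cat.
by move=> z; rewrite mem_cat => /orP[/sF|/tF].
Qed.

Lemma sum_of_mem F x : x \in F -> sum_of F x.
Proof. by move=> xF; exists [:: x]; rewrite ?big_seq1 // => y; rewrite inE => /eqP->. Qed.

Lemma sum_of_big F s : (forall x, x \in s -> sum_of F x) -> sum_of F (\sum_(y <- s) y).
Proof.
elim: s => [_|x s IHs sF]; first by rewrite big_nil; apply: sum_of0.
rewrite big_cons; apply: sum_ofD; first by apply: sF; rewrite mem_head.
by apply: IHs => y ys; apply: sF; rewrite inE ys orbT.
Qed.

Lemma sum_count F s : uniq F -> {subset s <= F} ->
  \sum_(y <- s) y = \sum_(i < size F) F`_i *~ (count_mem F`_i s)%:Z.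
Proof.
move=> uF; elim: s => [_|x s IHs sF].
  by rewrite big_nil big1 // => i _; rewrite mulr0z.
have xF : x \in F by apply: sF; rewrite mem_head.
rewrite big_cons {}IHs => [|y ys]; last by apply: sF; rewrite inE ys orbT.
have lx : (index x F < size F)%N by rewrite index_mem.
rewrite (bigD1 (Ordinal lx)) //= [RHS](bigD1 (Ordinal lx)) //= nth_index // eqxx.
rewrite PoszD mulrzDr mulr1z -addrA; congr (_ + (_ + _)).
apply: eq_bigr => i ne; congr (_ *~ _); case: eqP => // ex; case/eqP: ne.
by apply: val_inj; rewrite /= ex index_uniq.
Qed.

Lemma sum_exceptional F f s : exceptional F -> f \in F -> {subset s <= F} ->
  \sum_(y <- s) y = f -> s = [:: f].
Proof.
move=> oF fF sF es; have uF := exceptional_uniq oF.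
have c0 : forall i, (i < size F)%N -> count_mem F`_i s = (F`_i == f).
  move=> i lti; apply/eqP; rewrite -eqz_nat -subr_eq0; apply/eqP.
  apply: (exceptional_sum_eq0 (c := fun i => (count_mem F`_i s)%:Z - (F`_i == f)%:Z) oF _ lti).
  have e1 := sum_count uF sF; rewrite es in e1.
  have f1 : {subset [:: f] <= F} by move=> y; rewrite inE => /eqP->.
  have e2 := sum_count uF f1; rewrite big_seq1 in e2.
  have := etrans (esym e2) e1; move/eqP; rewrite -subr_eq0 -sumrB => /eqP e; rewrite -[RHS]oppr0 -[in RHS]e -sumrN.
  apply: eq_bigr => j _; rewrite mulrzBr opprB; congr (_ - _ *~ _).
  by rewrite /= addn0 [f == _]eq_sym.
apply: perm_small_eq => //; apply/allP => x xs.
have xF : x \in F by move: xs; rewrite mem_cat inE => /orP[/sF|/eqP->].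
by apply/eqP; rewrite -(nth_index 0 xF) c0 ?index_mem //= addn0 eq_sym.
Qed.

(** Substituting one set of sums into the other writes f as a sum of members of [F]; by linear
    independence there is a single summand, so the first g in the sum for f already equals f. *)
Lemma mutual_sums_sub F G : exceptional F -> exceptional G ->
  (forall f, f \in F -> sum_of G f) -> (forall g, g \in G -> sum_of F g) -> {subset F <= G}.
Proof.
move=> oF oG FG GF f fF; have [s sG ef] := FG f fF.
case: s sG ef => [_|g s sG ef].
  by rewrite big_nil => f0; have := exceptional_nz oF fF; rewrite f0 eqxx.
have gG : g \in G by apply: sG; rewrite mem_head.
have [t tF eg] := GF g gG.
have [t' tF' es] : sum_of F (\sum_(y <- s) y).
  by apply: sum_of_big => y ys; apply/GF/sG; rewrite inE ys orbT.
have : t ++ t' = [:: f].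
  apply: (sum_exceptional oF) => //; last by rewrite big_cat -eg -es ef big_cons.
  by move=> z; rewrite mem_cat => /orP[/tF|/tF'].
case: t eg {tF} => [|x [|//]] eg.
  by rewrite big_nil in eg; have := exceptional_nz oG gG; rewrite eg eqxx.
by case=> ex _; rewrite -ex; move: eg; rewrite big_seq1 => <-.
Qed.

End SumsOfExceptionals.

(** * Sequences with equal products *)

Section EqualProducts.
Variable L : gcLattice.
Implicit Types (a b f g x y z : L) (A B F G H s t : seq L).
Notation E := (gc_seq L).

Lemma orbit_complete C : braid_orbit E C -> [/\ exceptional C, complete C & reals C].
Proof.
move=> oC; have oE := gc_exceptional L; split; first exact: exceptional_bo oC.
  by apply: complete_bo (gc_complete (g := L)) oC; apply: exceptional_roots.
by apply: reals_bo oC; apply: reals_simple.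
Qed.

Lemma real_exceptionalP F : real_exceptional F <-> exists H, braid_orbit E (F ++ H).
Proof.
split=> [[C [oC cC rC sFC]]|[H oFH]]; last first.
  by exists (F ++ H); have [? ? ?] := orbit_complete oFH; split=> //; apply: prefix_subseq.
have [H oH] := bo_subseq_front (exceptional_roots oC) sFC; exists H.
exact: bo_trans (complete_real_orbit oC cC rC) oH.
Qed.

Lemma real_exceptional_reals F : real_exceptional F -> reals F.
Proof. by case=> C [_ _ rC /mem_subseq sFC] f /sFC/rC. Qed.

Lemma real_exceptional_roots F : real_exceptional F -> all_roots F.
Proof. by move/real_exceptional_reals/reals_roots. Qed.

Lemma real_exceptional_exc F : real_exceptional F -> exceptional F.
Proof. by case=> C [oC _ _ sFC]; apply: exceptional_subseq sFC oC. Qed.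

Lemma real_exceptional_bo F G : real_exceptional F -> braid_orbit F G -> real_exceptional G.
Proof.
move=> /real_exceptionalP[H oFH] oG; apply/real_exceptionalP; exists H.
by apply: bo_trans oFH _; apply: bo_catl.
Qed.

Lemma cox_orbit A : braid_orbit E A -> srefl_seq A =1 srefl_seq E.
Proof. by apply/bo_srefl_seq/exceptional_roots/gc_exceptional. Qed.

(** Followed by [H], a shorter factorisation of s_F would give the Coxeter element with fewer than n
    factors. *)
Lemma factor_length F H A : braid_orbit E (F ++ H) -> reals A ->
  srefl_seq A =1 srefl_seq F -> (size F <= size A)%N.
Proof.
move=> oFH rA eA; have [_ _ /reals_cat[rF rH]] := orbit_complete oFH.
have := @cox_length_ge L (A ++ H); rewrite -(bo_size oFH) !size_cat leq_add2r; apply.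
  exact/reals_cat.
by move=> x; rewrite -(cox_orbit oFH) !srefl_seq_cat eA.
Qed.

Lemma equal_products_bo F G : real_exceptional F -> real_exceptional G ->
  srefl_seq F =1 srefl_seq G -> braid_orbit F G.
Proof.
move=> reF reG eFG; have [rF rG] := (real_exceptional_reals reF, real_exceptional_reals reG).
have /real_exceptionalP[H oFH] := reF; have /real_exceptionalP[H' oGH'] := reG.
have [_ _ /reals_cat[_ rH]] := orbit_complete oFH.
have sz : size F = size G.
  apply/eqP; rewrite eqn_leq (factor_length oFH rG) ?(factor_length oGH' rF) //.
(* The completion [H] of [F] completes [G] too: the product is the Coxeter element and the length is
   right. *)
have oGH : braid_orbit E (G ++ H).
  apply: cox_factorization_orbit; first exact/reals_cat.
    by move=> x; rewrite -(cox_orbit oFH) !srefl_seq_cat eFG.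
  by rewrite -(bo_size oFH) !size_cat sz.
have [F' [oF' pF' obF']] := orthogonal_representative oFH.
have [G' [oG' pG' obG']] := orthogonal_representative oGH.
have [eF' eG'] : exceptional F' /\ exceptional G'.
  by split; apply/real_exceptional_exc; [apply: real_exceptional_bo oF'|apply: real_exceptional_bo oG'].
have [C [hC iC mC]] := module_sequences L.
have [Xs [ms eXs]] := mC _ (bo_trans oFH (bo_catl H oF')).
have [Ys [ms' eYs]] := mC _ (bo_trans oGH (bo_catl H oG')).
rewrite map_cat map_posabs_pos // in eXs; rewrite map_cat map_posabs_pos // in eYs.
have {eXs} [X1 [X2 [eX eX1 eX2]]] := map_split eXs.
have {eYs} [Y1 [Y2 [eY eY1 eY2]]] := map_split eYs.
rewrite {}eX in ms; rewrite {}eY in ms'.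
(* The tails P' and Q' are different lifts of the classes of [H]. *)
have sums A B P Q P' Q' : mseq (P ++ P' : seq C) -> mseq (Q ++ Q') -> 
    map (@cls L C) P = A -> map (@cls L C) Q = B -> map (@cls L C) P' = map (@cls L C) Q' ->
    pairwise (fun x y => bform x y <= 0) A -> forall b, b \in B -> sum_of A b.
  move=> mP mQ <- <- eP'; rewrite pairwise_map => ob.
  apply: (orthogonal_cone hC iC mP mQ eP') => // [|x y|x]; first exact: sum_of0.
    exact: sum_ofD.
  exact: sum_of_mem.
have GF := sums _ _ _ _ _ _ ms ms' eX1 eY1 (etrans eX2 (esym eY2)) obF'.
have FG := sums _ _ _ _ _ _ ms' ms eY1 eX1 (etrans eY2 (esym eX2)) obG'.
have pFG : perm_eq F' G'.
  apply: uniq_perm; [exact: exceptional_uniq|exact: exceptional_uniq|].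
  by move=> x; apply/idP/idP; apply: mutual_sums_sub.
apply: bo_trans oF' (bo_trans (perm_exceptional_bo eF' eG' pFG) _).
by apply: bo_sym oG'; apply: reals_roots.
Qed.

End EqualProducts.

(** * Non-crossing partitions and subobjects *)

Lemma proj1_sig_inj (T : Type) (P : T -> Prop) : injective (@proj1_sig T P).
Proof. by move=> [x Px] [y Py] /=; apply: eq_exist. Qed.

(** * The absolute order *)

Section AbsoluteOrder.
Variable L : gcLattice.
Implicit Types (u v w : L -> L) (A B F G H : seq L).
Notation E := (gc_seq L).

Lemma weyl_reals w : weyl w <-> exists2 A, reals A & w = srefl_seq A.
Proof.
split=> [/weylP[u wu ->]|[A rA ->]].
  by exists u => // e /(allP wu); apply: real_simple.
have [u wu eu] := reals_word rA; apply/weylP; exists u => //; apply: funext => x.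
have gu : goods u by apply: reals_goods => e /(allP wu); apply: real_simple.
have gA := reals_goods rA.
have := eu x; rewrite !arefl_seqE // /displ eu => /(congr1 (fun y => y - arefl_seq A 0)).
by rewrite !addrK.
Qed.

Lemma weyl_srefl_seq A : reals A -> weyl (srefl_seq A).
Proof. by move=> rA; apply/weyl_reals; exists A. Qed.

Lemma abs_length_le A : reals A -> (abs_length (srefl_seq A) <= size A)%N.
Proof.
move=> rA; rewrite /abs_length; case: xgetP => [k _ [_]|_] //.
by apply; exists A; split.
Qed.

Lemma abs_length_seq w : weyl w ->
  exists A, [/\ reals A, w = srefl_seq A & size A = abs_length w].
Proof.
move/weyl_reals=> [A rA ew].
pose good k := `[< is_refl_product w k >].
have ex : exists k, good k by exists (size A); apply/asboolP; exists A.
case: (ex_minnP ex) => k /asboolP gk mink.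
rewrite /abs_length; case: xgetP => [l _ [[B [sB rB eB]] _]|/(_ k)[]]; first by exists B.
by split=> // j gj; apply/mink/asboolP.
Qed.

Lemma abs_length_id : abs_length (@id L) = 0%N.
Proof. by apply/eqP; rewrite -leqn0; apply: (@abs_length_le [::]). Qed.

Lemma abs_length_cat A B : reals A -> reals B ->
  (abs_length (srefl_seq (A ++ B)) <= abs_length (srefl_seq A) + abs_length (srefl_seq B))%N.
Proof.
move=> /weyl_srefl_seq/abs_length_seq[A' [rA' eA <-]] /weyl_srefl_seq/abs_length_seq[B' [rB' eB <-]].
rewrite -size_cat; have -> : srefl_seq (A ++ B) = srefl_seq (A' ++ B').
  by apply: funext => x; rewrite !srefl_seq_cat eA eB.
exact/abs_length_le/reals_cat.
Qed.

(** The factorisation [B] of the quotient is automatically a shortest one, by subadditivity of the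
    length. *)
Lemma abs_leP G w : reals G -> weyl w -> abs_le (srefl_seq G) w <->
  exists B, [/\ reals B, w = srefl_seq (G ++ B) &
    (abs_length (srefl_seq G) + size B)%N = abs_length w].
Proof.
move=> rG /weyl_reals[W rW eW]; have rtG := reals_roots rG.
have rvG := srefl_seq_revK rtG; have vrG := srefl_seqK rtG.
split=> [[u' [uu' u'u e]]|[B [rB eB e]]].
  have eu' : u' = srefl_seq (rev G) by apply: funext => x; rewrite -{1}[x]vrG uu'.
  have : weyl (u' \o w).
    rewrite eu' eW; apply/weyl_reals; exists (rev G ++ W); first exact/reals_cat/(conj (reals_rev rG)).
    by apply: funext => x; rewrite srefl_seq_cat.
  move/abs_length_seq=> [B [rB eB sB]]; exists B; split=> //; last by rewrite sB.
  by apply: funext => x; rewrite srefl_seq_cat -eB /= u'u.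
exists (srefl_seq (rev G)); split=> //.
have -> : srefl_seq (rev G) \o w = srefl_seq B.
  by apply: funext => x /=; rewrite eB srefl_seq_cat rvG.
have := abs_length_cat rG rB; have := abs_length_le rB; rewrite -eB -e; lia.
Qed.

Lemma abs_length_factor F H : braid_orbit E (F ++ H) -> abs_length (srefl_seq F) = size F.
Proof.
move=> oFH; have [_ _ /reals_cat[rF _]] := orbit_complete oFH.
apply/eqP; rewrite eqn_leq abs_length_le //=.
have [A [rA eA <-]] := abs_length_seq (weyl_srefl_seq rF).
by apply: factor_length oFH rA _; rewrite eA.
Qed.

Lemma abs_length_real F : real_exceptional F -> abs_length (srefl_seq F) = size F.
Proof. by move/real_exceptionalP=> [H /abs_length_factor]. Qed.

Lemma weyl_real_exceptional F : real_exceptional F -> weyl (srefl_seq F).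
Proof. by move/real_exceptional_reals/weyl_srefl_seq. Qed.

Lemma real_exceptional_simple : real_exceptional E.
Proof. by apply/real_exceptionalP; exists [::]; rewrite cats0; apply: BraidOrbit_id. Qed.

Lemma weyl_cox : weyl (@cox L).
Proof. exact: weyl_real_exceptional real_exceptional_simple. Qed.

Lemma real_exceptional_NC F : real_exceptional F ->
  [/\ weyl (srefl_seq F), abs_le id (srefl_seq F) & abs_le (srefl_seq F) (@cox L)].
Proof.
move=> reF; have wF := weyl_real_exceptional reF; have rF := real_exceptional_reals reF.
split=> //.
  by exists id; split=> //; rewrite abs_length_id.
have /real_exceptionalP[H oFH] := reF; have [_ _ /reals_cat[_ rH]] := orbit_complete oFH.
apply/(abs_leP rF weyl_cox); exists H; split=> //.
  by apply: funext => x; rewrite (cox_orbit oFH).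
rewrite (abs_length_real reF) (abs_length_real real_exceptional_simple).
by rewrite -(bo_size oFH) size_cat.
Qed.

(** Shortest factorisations of w and of its complement form together a factorisation of the Coxeter
    element into n reflections, hence lie in the orbit of [E]. *)
Lemma NC_real_exceptional w : weyl w -> abs_le w (@cox L) ->
  exists2 F, real_exceptional F & w = srefl_seq F.
Proof.
move/abs_length_seq=> [A [rA -> sA]] /(abs_leP rA weyl_cox)[B [rB eB e]].
exists A => //; apply/real_exceptionalP; exists B.
apply: cox_factorization_orbit; first exact/reals_cat.
  by move=> x; rewrite -eB.
by rewrite size_cat sA e (abs_length_real real_exceptional_simple).
Qed.

Lemma abs_le_real F G : real_exceptional F -> real_exceptional G ->
  abs_le (srefl_seq G) (srefl_seq F) <-> exists B, braid_orbit F (G ++ B).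
Proof.
move=> reF reG; have [rF rG] := (real_exceptional_reals reF, real_exceptional_reals reG).
have wF := weyl_real_exceptional reF; split=> [/(abs_leP rG wF)[B [rB eB e]]|[B oGB]].
  have /real_exceptionalP[H oFH] := reF; have [_ _ /reals_cat[_ rH]] := orbit_complete oFH.
  (* Followed by a completion of [F], the sequence [G ++ B] factors the Coxeter element with n
     factors, so it is real exceptional with the same product as [F]. *)
  exists B; apply: equal_products_bo => //; last by move=> x; rewrite eB.
  apply/real_exceptionalP; exists H; apply: cox_factorization_orbit.
  - by apply/reals_cat; split=> //; apply/reals_cat.
  - by move=> x; rewrite -(cox_orbit oFH) srefl_seq_cat -eB srefl_seq_cat.
  - move: e; rewrite -(bo_size oFH) !size_cat !abs_length_real //; lia.
have /reals_cat[_ rB] := reals_bo rF oGB.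
apply/(abs_leP rG wF); exists B; split=> //.
  by apply: funext => x; rewrite (bo_srefl_seq (reals_roots rF) oGB).
by rewrite !abs_length_real // -(bo_size oGB) size_cat.
Qed.

Lemma abs_le_order : Relation_Definitions.order (NC L) (@NC_le L).
Proof.
have seqNC (w : NC L) : exists2 A, reals A & sval w = srefl_seq A.
  by case: w => w [ww _ _] /=; apply/weyl_reals.
have W (w : NC L) : weyl (sval w) by case: w => w [].
split=> [u|u v w|u v]; rewrite /NC_le.
- have [A rA eA] := seqNC u; rewrite eA; apply/(abs_leP rA); first by rewrite -eA.
  by exists [::]; rewrite cats0 addn0.
- have [A rA eA] := seqNC u; have [B rB eB] := seqNC v.
  have := W v; have := W w; rewrite eA eB => ww wv.
  move=> /(abs_leP rA wv)[A' [rA' eA' e1]] /(abs_leP rB ww)[B' [rB' eB' e2]].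
  apply/(abs_leP rA ww); exists (A' ++ B'); split; first exact/reals_cat.
    by rewrite eB'; apply: funext => x; rewrite srefl_seq_cat eA' -srefl_seq_cat catA.
  by rewrite size_cat addnA e1.
have [A rA eA] := seqNC u; have [B rB eB] := seqNC v.
have := W u; have := W v; rewrite eA eB => wv wu.
move=> /(abs_leP rA wv)[A' [rA' eA' e1]] /(abs_leP rB wu)[B' [rB' eB' e2]].
have A'0 : A' = [::] by apply: size0nil; lia.
by apply: proj1_sig_inj; rewrite eA eB eA' A'0 cats0.
Qed.

End AbsoluteOrder.

(** * Isometric embeddings *)

Section IsometricEmbedding.
Variables (L' L : bilLattice) (phi : {additive L' -> L}).
Hypothesis phi_form : forall x y, bform (phi x) (phi y) = bform x y.
Implicit Types (a x y : L') (S T : seq L').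

Lemma emb_inj : injective phi.
Proof.
move=> x y e; apply/eqP; rewrite -subr_eq0; apply/eqP/bform_nondegl => z.
by rewrite -phi_form raddfB /= e subrr bform0l.
Qed.

Lemma emb_srefl a x : phi (srefl a x) = srefl (phi a) (phi x).
Proof. by rewrite /srefl /symform !phi_form raddfB raddfMz. Qed.

Lemma emb_bo S T : braid_orbit S T -> braid_orbit (map phi S) (map phi T).
Proof.
move: T; apply: (@bo_ind L' S) => [|A x y B _|A x y B _|A x B]; rewrite ?map_cat /=.
- exact: BraidOrbit_id.
- by rewrite emb_srefl; apply: bo_sigma.
- by rewrite emb_srefl; apply: bo_sigmaV.
- by rewrite raddfN => o; apply: bo_trans o (bo_opp _ _ _).
Qed.

Lemma emb_bo_lift S G : braid_orbit (map phi S) G -> exists2 T, G = map phi T & braid_orbit S T.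
Proof.
move: G; apply: (@bo_ind L (map phi S)) => [|A x y B _ [T eT]|A x y B _ [T eT]|A x B [T eT]].
- by exists S => //; apply: BraidOrbit_id.
- have [T1 [x' [y' [T2 [-> <- <- <- <-]]]]] := map_split2 (esym eT) => /bo_sigma o.
  by exists (T1 ++ y' :: srefl y' x' :: T2); rewrite // map_cat /= emb_srefl.
- have [T1 [x' [y' [T2 [-> <- <- <- <-]]]]] := map_split2 (esym eT) => /bo_sigmaV o.
  by exists (T1 ++ srefl x' y' :: x' :: T2); rewrite // map_cat /= emb_srefl.
have [T1 [[|x' T2] [-> <-]]] // := map_split (esym eT) => -[<- <-] o.
by exists (T1 ++ - x' :: T2); [rewrite map_cat /= raddfN|apply: bo_trans o (bo_opp _ _ _)].
Qed.

Lemma emb_root a : is_root (phi a) -> is_root a.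
Proof.
move=> [a0 ra]; rewrite phi_form in a0; split=> // x.
by have := ra (phi x); rewrite !phi_form.
Qed.

Lemma emb_exceptional S : exceptional (map phi S) -> exceptional S.
Proof.
move=> /exceptionalP[rS oS]; apply/exceptionalP; split.
  by move=> a aS; apply/emb_root/rS/map_f.
by move: oS; rewrite pairwise_map; apply: sub_pairwise => x y; rewrite /= /bforth phi_form.
Qed.

End IsometricEmbedding.

Lemma pairwise_orthogonal_seq (L : bilLattice) (F : seq L) : exceptional F ->
  pairwise (fun x y => bform x y <= 0) F -> orthogonal_seq F.
Proof.
move=> [_ oF] /(pairwiseP 0) obF i j lti ltj /eqP.
case: (ltngtP i j) => // lt _; first exact: obF.
by rewrite oF.
Qed.

(** * The generalised Cartan lattice spanned by an orthogonal sequence *)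

Section SpannedLattice.
Variables (L : bilLattice) (F : seq L).
Hypothesis oF : exceptional F.
Hypothesis obF : pairwise (fun x y => bform x y <= 0) F.
Notation r := (size F).

(** The span is modelled on coordinate vectors, with the form pulled back along this map, which is
    injective by the independence of an exceptional sequence. *)
Definition combination (x : 'rV[int]_r) : L := \sum_(i < r) F`_i *~ x 0 i.

Lemma combinationB : {morph combination : x y / x - y}.
Proof.
move=> x y; rewrite /combination -sumrB; apply: eq_bigr => i _.
by rewrite !mxE mulrzBr.
Qed.

HB.instance Definition _ := GRing.isZmodMorphism.Build 'rV[int]_r L combination combinationB.

Lemma combination_delta i : combination (delta_mx 0 i) = F`_i.
Proof.
rewrite /combination (bigD1 i) //= big1 ?addr0 => [|j ji]; rewrite mxE eqxx /=.
  by rewrite eqxx mulr1z.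
by rewrite (negPf ji) mulr0z.
Qed.

Lemma combination_spn x : spn F (combination x).
Proof.
rewrite /combination; elim: (index_enum _) => [|i s IHs]; first by rewrite big_nil; apply: spn0.
by rewrite big_cons; apply: spnD => //; apply/spnMz/spn_mem/mem_nth.
Qed.

Lemma combination_eq0 x : combination x = 0 -> x = 0.
Proof.
move=> x0; apply/rowP => i; rewrite mxE.
pose c k := if insub k is Some j then x 0 (j : 'I_r) else 0.
have ce j : c (val j) = x 0 j by rewrite /c valK.
rewrite -ce; apply: (exceptional_sum_eq0 (c := c) oF) (ltn_ord i).
by rewrite -[RHS]x0; apply: eq_bigr => j _; rewrite ce.
Qed.

Definition combination_form (x y : 'rV[int]_r) : int := bform (combination x) (combination y).

Lemma combination_nth f : f \in F -> exists x, combination x = f.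
Proof.
move=> fF; have lt : (index f F < r)%N by rewrite index_mem.
by exists (delta_mx 0 (Ordinal lt)); rewrite combination_delta nth_index.
Qed.

(** Kept transparent, so that the embedding is isometric by conversion. *)
Definition spanned_bilLattice : bilLattice.
Proof.
refine (@BilLattice 'rV[int]_r combination_form _ _ _ _) => [x y z|x y z|x x0|y y0].
- by rewrite /combination_form raddfD bformDl.
- by rewrite /combination_form raddfD bformDr.
- apply: combination_eq0; apply: (spn_perpl oF (combination_spn x)) => f.
  by move=> /combination_nth[y <-]; apply: x0.
- apply: combination_eq0; apply: (spn_perpr oF (combination_spn y)) => f.
  by move=> /combination_nth[x <-]; apply: y0.
Defined.

Definition spanned_emb : {additive spanned_bilLattice -> L} := combination.

Lemma spanned_form x y : bform (spanned_emb x) (spanned_emb y) = bform x y.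
Proof. by []. Qed.

Definition unit_seq : seq spanned_bilLattice := [seq delta_mx 0 i | i <- enum 'I_r].

Lemma map_unit_seq : map spanned_emb unit_seq = F.
Proof.
rewrite -map_comp (eq_map (g := nth 0 F \o val)) => [|i]; last exact: combination_delta.
by rewrite map_comp val_enum_ord; apply: mkseq_nth.
Qed.

Lemma exceptional_unit_seq : exceptional unit_seq.
Proof. by apply: (emb_exceptional spanned_form); rewrite map_unit_seq. Qed.

Lemma complete_unit_seq : complete unit_seq.
Proof.
apply/completeP => x; rewrite [x](row_sum_delta x).
elim: (index_enum _) => [|i s IHs]; first by rewrite big_nil; apply: spn0.
rewrite big_cons -[x 0 i]intz scaler_int; apply: spnD => //; apply/spnMz/spn_mem.
by apply: map_f; rewrite mem_enum.
Qed.

Lemma orthogonal_unit_seq : orthogonal_seq unit_seq.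
Proof.
apply: pairwise_orthogonal_seq exceptional_unit_seq _.
by move: obF; rewrite -{1}map_unit_seq pairwise_map.
Qed.

Definition spanned_gcLattice : gcLattice :=
  GCLattice exceptional_unit_seq complete_unit_seq orthogonal_unit_seq.

End SpannedLattice.

Section Morphisms.
Variables (L' L : gcLattice) (phi : gcMorphism L' L).

Lemma gcm_inj : injective phi.
Proof. exact: emb_inj (gcm_form phi). Qed.

Lemma gcm_is_mono : is_mono phi.
Proof. by move=> K psi psi' e x; apply: gcm_inj; apply: e. Qed.

End Morphisms.

(** * Subobjects and orbits compared through products of reflections *)

Section Subobjects.
Variable L : gcLattice.
Implicit Types (phi psi : monoInto L) (F G : seq L).
Notation E := (gc_seq L).

Definition sub_seq phi : seq L := map phi (gc_seq (mi_dom phi)).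

Lemma sub_seq_real phi : real_exceptional (sub_seq phi).
Proof. exact: gcm_exceptional. Qed.

Lemma real_exceptional_emb (L' : gcLattice) (phi : gcMorphism L' L) (S : seq L') :
  real_exceptional S -> exists B, braid_orbit (map phi (gc_seq L')) (map phi S ++ B).
Proof.
move=> /real_exceptionalP[B /(emb_bo (gcm_form phi))]; rewrite map_cat => o.
by exists (map phi B).
Qed.

Lemma spn_emb_image (L' : gcLattice) (phi : gcMorphism L' L) (S : seq L') x :
  spn (map phi S) x -> exists y, phi y = x.
Proof.
elim: S x => /= [x ->|a S IHS x [k /IHS[y ey]]]; first by exists 0; rewrite raddf0.
by exists (y + a *~ k); rewrite raddfD /= raddfMz ey subrK.
Qed.

Lemma spn_emb (L' : gcLattice) (phi : gcMorphism L' L) (S : seq L') x :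
  spn S x -> spn (map phi S) (phi x).
Proof.
elim: S x => /= [x ->|a S IHS x [k /IHS]]; first by rewrite raddf0.
by rewrite raddfB /= raddfMz; exists k.
Qed.

Lemma factors_throughP phi psi : factors_through phi psi <->
  abs_le (srefl_seq (sub_seq phi)) (srefl_seq (sub_seq psi)).
Proof.
have [reF reG] := (sub_seq_real psi, sub_seq_real phi).
split=> [[theta e]|/(abs_le_real reF reG)[B oGB]].
  have [B oB] := real_exceptional_emb psi (gcm_exceptional theta).
  apply/(abs_le_real reF reG); exists B.
  by move: oB; rewrite -map_comp -(eq_map e).
(* Braid moves commute with [psi], so the whole orbit of its sequence lies in the image and can be
   lifted. *)
have [T eT oT] := emb_bo_lift (gcm_form psi) oGB.
have [T1 [T2 [eT12 eT1 _]]] := map_split (esym eT).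
have reT1 : real_exceptional T1 by apply/real_exceptionalP; exists T2; rewrite -eT12.
(* The sequence of [phi] is the image of [T1] and spans the image of [phi], so [phi] takes its
   values in the image of [psi]. *)
have im x : exists y, psi y = phi x.
  apply: (@spn_emb_image _ _ T1); rewrite eT1; apply: spn_emb.
  exact: ((completeP _).1 (gc_complete (g := mi_dom phi)) x).
pose th x := sval (cid (im x)).
have thE x : psi (th x) = phi x by exact: svalP (cid (im x)).
have thB : {morph th : x y / x - y}.
  by move=> x y; apply: (@gcm_inj _ _ psi); rewrite raddfB /= !thE raddfB.
pose thA : {additive mi_dom phi -> mi_dom psi} :=
  HB.pack th (GRing.isZmodMorphism.Build _ _ th thB).
have th_form x y : bform (thA x) (thA y) = bform x y.
  by rewrite -(gcm_form psi) /= !thE gcm_form.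
have th_real : real_exceptional (map thA (gc_seq (mi_dom phi))).
  suff -> : map thA (gc_seq (mi_dom phi)) = T1 by [].
  apply: (inj_map (@gcm_inj _ _ psi)); rewrite eT1 -map_comp.
  by apply: eq_map => x; apply: thE.
by exists (GCMorphism th_form th_real) => x; rewrite /= thE.
Qed.

Lemma abs_le_real_order : [/\ forall F, real_exceptional F -> abs_le (srefl_seq F) (srefl_seq F),
  forall F G H : seq L, real_exceptional F -> real_exceptional G -> real_exceptional H ->
    abs_le (srefl_seq F) (srefl_seq G) -> abs_le (srefl_seq G) (srefl_seq H) ->
    abs_le (srefl_seq F) (srefl_seq H)
  & forall F G, real_exceptional F -> real_exceptional G ->
    abs_le (srefl_seq F) (srefl_seq G) -> abs_le (srefl_seq G) (srefl_seq F) ->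
    srefl_seq F = srefl_seq G].
Proof.
have [rf tr an] := abs_le_order L.
pose nc F (h : real_exceptional F) : NC L := exist _ (srefl_seq F) (real_exceptional_NC h).
split=> [F hF|F G H hF hG hH|F G hF hG].
- exact: rf (nc F hF).
- exact: tr (nc F hF) (nc G hG) (nc H hH).
- by move=> h1 h2; have := an (nc F hF) (nc G hG) h1 h2 => /(congr1 (@proj1_sig _ _)).
Qed.

Lemma sub_equivP phi psi : sub_equiv phi psi <->
  srefl_seq (sub_seq phi) = srefl_seq (sub_seq psi).
Proof.
have [rf tr an] := abs_le_real_order.
split=> [[/factors_throughP h1 /factors_throughP h2]|e].
  by apply: an => //; apply: sub_seq_real.
by split; apply/factors_throughP; rewrite e; apply/rf/sub_seq_real.
Qed.

Lemma subobj_classP phi psi : subobj_class phi = subobj_class psi <->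
  srefl_seq (sub_seq phi) = srefl_seq (sub_seq psi).
Proof.
split=> [/(congr1 (@proj1_sig _ _)) /= e|e].
  by apply/sub_equivP; rewrite e; apply/sub_equivP.
by apply: proj1_sig_inj; apply: funext => chi; apply: propext; rewrite /= !sub_equivP e.
Qed.

Lemma Subobj_leP phi psi : Subobj_le (subobj_class phi) (subobj_class psi) <->
  abs_le (srefl_seq (sub_seq phi)) (srefl_seq (sub_seq psi)).
Proof.
split=> [[phi' [psi' [/subobj_classP-> /subobj_classP->]]]|h]; first by move/factors_throughP.
by exists phi, psi; split=> //; apply/factors_throughP.
Qed.

Lemma exc_classP F G (hF : real_exceptional F) (hG : real_exceptional G) :
  exc_class hF = exc_class hG <-> srefl_seq F = srefl_seq G.
Proof.
have rF := real_exceptional_roots hF.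
split=> [/(congr1 (@proj1_sig _ _)) /= e|e].
  have : braid_orbit F G by rewrite e; apply: BraidOrbit_id.
  by move/(bo_srefl_seq rF)=> eGF; apply: funext => x; rewrite eGF.
have oFG : braid_orbit F G by apply: equal_products_bo => // x; rewrite e.
apply: proj1_sig_inj => /=; apply/seteqP; split=> H; last exact: bo_trans.
by apply: bo_trans; apply: bo_sym.
Qed.

Lemma Exc_leP F G (hF : real_exceptional F) (hG : real_exceptional G) :
  Exc_le (exc_class hG) (exc_class hF) <-> abs_le (srefl_seq G) (srefl_seq F).
Proof.
split=> [[G' [F' [hG' [hF' [/exc_classP-> /exc_classP-> [A oA /prefixP[B eA]]]]]]]|].
  by apply/(abs_le_real hF' hG'); exists B; rewrite -eA.
move/(abs_le_real hF hG)=> [B oB]; exists G, F, hG, hF; split=> //.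
by exists (G ++ B) => //; apply: prefix_prefix.
Qed.

Lemma exc_surj (C : Exc L) : exists F (hF : real_exceptional F), C = exc_class hF.
Proof.
case: C => C [F hF eC]; exists F, hF; exact: proj1_sig_inj.
Qed.

Lemma subobj_surj (C : Subobj L) : exists phi, C = subobj_class phi.
Proof. by case: C => C [phi eC]; exists phi; apply: proj1_sig_inj. Qed.

Lemma monoInto_exists F : real_exceptional F ->
  exists phi, srefl_seq (sub_seq phi) = srefl_seq F.
Proof.
move=> hF; have /real_exceptionalP[H oFH] := hF.
have [G [oG _ obG]] := orthogonal_representative oFH.
have hG := real_exceptional_bo hF oG; have oeG := real_exceptional_exc hG.
have re : real_exceptional (map (spanned_emb oeG) (gc_seq (spanned_gcLattice oeG obG))).
  by rewrite map_unit_seq.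
pose m := @GCMorphism (spanned_gcLattice oeG obG) L (spanned_emb oeG) (@spanned_form _ _ oeG) re.
exists (MonoInto (@gcm_is_mono _ _ m)); rewrite /sub_seq /= map_unit_seq.
by apply: funext => x; rewrite (bo_srefl_seq (real_exceptional_roots hF) oG).
Qed.

End Subobjects.

Theorem theorem5p2 (L : gcLattice) :
  exists (f : Subobj L -> Exc L) (g : Exc L -> NC L),
    [/\ poset_iso (@Subobj_le L) (@Exc_le L) f,
        poset_iso (@Exc_le L) (@NC_le L) g,
        forall phi : monoInto L,
          f (subobj_class phi) = exc_class (gcm_exceptional phi)
      & forall (F : seq L) (hF : real_exceptional F),
          sval (g (exc_class hF)) = srefl_seq F].
Proof.
(* Representatives are chosen; that the maps do not depend on them follows because equality of
   classes is equality of products. *)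
pose rep (C : Exc L) := sval (cid (exc_surj C)).
have repP C : exists hF : real_exceptional (rep C), C = exc_class hF.
  exact: svalP (cid (exc_surj C)).
have repR C : real_exceptional (rep C) by case: (repP C).
pose g C : NC L := exist _ (srefl_seq (rep C)) (real_exceptional_NC (repR C)).
pose mono (C : Subobj L) := sval (cid (subobj_surj C)).
have monoP C : C = subobj_class (mono C) by exact: svalP (cid (subobj_surj C)).
pose f C : Exc L := exc_class (gcm_exceptional (mono C)).
have fE phi : f (subobj_class phi) = exc_class (gcm_exceptional phi).
  by apply/exc_classP/subobj_classP; rewrite -monoP.
have gE F (hF : real_exceptional F) : sval (g (exc_class hF)) = srefl_seq F.
  by have [h e] := repP (exc_class hF); apply/esym/(exc_classP hF h).
have g_inj : injective g.
  move=> C D; have [F [hF ->]] := exc_surj C; have [G [hG ->]] := exc_surj D.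
  by move/(congr1 (@proj1_sig _ _)); rewrite !gE => e; apply/exc_classP.
have f_inj : injective f.
  move=> C D; have [phi ->] := subobj_surj C; have [psi ->] := subobj_surj D.
  by rewrite !fE => /exc_classP e; apply/subobj_classP.
have g_surj w : exists C, g C = w.
  have [ww _ wc] := svalP w; have [F hF eF] := NC_real_exceptional ww wc.
  by exists (exc_class hF); apply: proj1_sig_inj; rewrite gE.
have f_surj C : exists D, f D = C.
  have [F [hF ->]] := exc_surj C; have [phi e] := monoInto_exists hF.
  by exists (subobj_class phi); rewrite fE; apply/exc_classP.
have g_le C D : Exc_le C D <-> NC_le (g C) (g D).
  have [F [hF ->]] := exc_surj C; have [G [hG ->]] := exc_surj D.
  by rewrite /NC_le !gE; apply: Exc_leP.
have f_le C D : Subobj_le C D <-> Exc_le (f C) (f D).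
  have [phi ->] := subobj_surj C; have [psi ->] := subobj_surj D.
  by rewrite !fE Subobj_leP Exc_leP.
(* The partial order axioms on orbits and on subobjects are pulled back from the absolute order
   along the bijections. *)
have transport (A B : Type) (leA : A -> A -> Prop) (leB : B -> B -> Prop) (h : A -> B) :
    Relation_Definitions.order B leB -> injective h -> (forall y, exists x, h x = y) ->
    (forall x y, leA x y <-> leB (h x) (h y)) -> poset_iso leA leB h.
  move=> oB h_inj h_surj h_le; have [rf tr an] := oB; split=> //.
    split=> [x|x y z|x y]; rewrite !h_le; [exact: rf|exact: tr|].
    by move=> xy yx; apply/h_inj/an.
  exists (fun y => sval (cid (h_surj y))) => [x|y]; last exact: svalP (cid (h_surj y)).
  exact/h_inj/(svalP (cid (h_surj (h x)))).
have gI := transport _ _ _ _ g (abs_le_order L) g_inj g_surj g_le.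
have [oE _ _ _] := gI; have fI := transport _ _ _ _ f oE f_inj f_surj f_le.
by exists f, g.
Qed.
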